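(* For every $K$ and every $c_0>0$ there exists $a_0$ (depending only on $K$ and $c_0$) such that the following holds. Let $G=(V,E)$ be a graph with all degrees at most $K$ and with Cheeger constant $\iota\ge c_0$, and let $v_0\in V$. Then for every $a>a_0$ the linearly edge reinforced random walk on $G$ started at $v_0$, with initial weight $a$ on all edges, is transient.
   Context: Graphs are undirected. The linearly edge reinforced random walk (LRRW) $X_0,X_1,\dots$ on $G=(V,E)$ with starting vertex $v_0$ and constant initial weight $a>0$ is defined by $X_0=v_0$ and $$\mathbb P(X_{k+1}=w\mid X_0,\dots,X_k)=\frac{a+N_k(\langle v,w\rangle)}{d_v a+N_k(v)}\,\mathbf 1\{v\sim w\}\qquad\text{on } X_k=v,$$ where $d_v$ is the degree of $v$, $N_k(e)=|\{j<k: e=\langle X_j,X_{j+1}\rangle\}|$ is the number of traversals (in either direction) of the undirected edge $e$ up to time $k$, and $N_k(v)=\sum_{e\ni v}N_k(e)$. The walk is transient if almost surely it visits every vertex only finitely many times. For $A\subset V$, $\partial A=\{x\in V:\operatorname{dist}(x,A)=1\}$ is the external vertex boundary. The Cheeger constant $\iota$ of $G$ is the largest constant such that $|\partial A|\ge\iota|A|$ for every finite nonempty set $A\subset V$. *)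

(* Defs.v *)
(* MathComp-Analysis world. *)
From mathcomp Require Export all_boot all_order all_algebra finmap.
From mathcomp Require Export all_classical all_reals all_analysis.

Set Implicit Arguments.
Unset Strict Implicit.
Unset Printing Implicit Defensive.

Import Order.TTheory GRing.Theory Num.Theory.

Local Open Scope fset_scope.
Local Open Scope classical_set_scope.
Local Open Scope ring_scope.

Record graph (V : choiceType) := Graph {
  adj :> rel V;
  adj_sym : symmetric adj;
  adj_irr : irreflexive adj }.

Definition locally_finite (V : choiceType) (G : graph V) : Prop :=
  forall v, finite_set [set w | G v w].

(* [fset_set] returns the empty set on infinite sets, so [neighbors] and
   [degree] are meaningful for locally finite graphs only. *)
Definition neighbors (V : choiceType) (G : graph V) (v : V) : {fset V} :=
  fset_set [set w | G v w].

Definition degree (V : choiceType) (G : graph V) (v : V) : nat :=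
  #|` neighbors G v|.

(* Distances take the value +oo between distinct components (and to set0). *)
Definition dist (R : realType) (V : choiceType) (G : graph V) (x y : V) :
    \bar R :=
  ereal_inf [set (size p)%:R%:E | p in [set p | path G x p /\ last x p = y]].

Definition dist_set (R : realType) (V : choiceType) (G : graph V) (x : V)
    (A : set V) : \bar R :=
  ereal_inf [set dist R G x y | y in A].

Definition boundary (R : realType) (V : choiceType) (G : graph V)
    (A : set V) : set V :=
  [set x | dist_set R G x A = 1%E].

(* In a locally finite graph the boundary of a finite set is finite, hence its
   [fset_set] is the boundary itself. *)
Definition isoperimetric (R : realType) (V : choiceType) (G : graph V)
    (c : R) : Prop :=
  forall A : {fset V}, A != fset0 ->
    c * #|` A|%:R <= #|` fset_set (boundary R G [set` A])|%:R.

Definition cheeger (R : realType) (V : choiceType) (G : graph V) : \bar R :=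
  ereal_sup [set c%:E | c in [set c : R | isoperimetric G c]].

(* The trajectory is x : nat -> V; the undirected edge <v,w> is the unordered
   pair [fset v; w]. *)
Definition edge_count (V : choiceType) (x : nat -> V) (k : nat)
    (e : {fset V}) : nat :=
  \sum_(j < k) (e == [fset x j; x j.+1]).

(* The map w |-> [fset v; w] is a bijection from the neighbors of v to the edges
   containing v. *)
Definition vertex_count (V : choiceType) (G : graph V) (x : nat -> V)
    (k : nat) (v : V) : nat :=
  \sum_(w <- neighbors G v) edge_count x k [fset v; w].

Definition lrrw_step (R : realType) (V : choiceType) (G : graph V) (a : R)
    (x : nat -> V) (k : nat) (w : V) : R :=
  let v := x k in
  (a + (edge_count x k [fset v; w])%:R) /
  ((degree G v)%:R * a + (vertex_count G x k v)%:R) * (G v w)%:R.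

Definition cond_prob d (T : measurableType d) (R : realType)
    (P : probability T R) (A B : set T) : R :=
  fine (P (A `&` B)) / fine (P B).

Definition history (T : Type) (V : choiceType) (X : nat -> T -> V) (k : nat)
    (x : nat -> V) : set T :=
  [set t | forall i, (i <= k)%N -> X i t = x i].

(* The walk is countably supported, so conditioning on X_0, ..., X_k amounts to
   conditioning on the histories of positive probability. *)
Definition is_LRRW d (T : measurableType d) (R : realType)
    (P : probability T R) (V : choiceType) (G : graph V) (a : R) (v0 : V)
    (X : nat -> T -> V) : Prop :=
  [/\ forall k v, measurable [set t | X k t = v],
      P [set t | X 0%N t = v0] = 1%E &
      forall k (x : nat -> V) (w : V), P (history X k x) != 0%E ->
        cond_prob P [set t | X k.+1 t = w] (history X k x) =
        lrrw_step G a x k w].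

Definition transient d (T : measurableType d) (R : realType)
    (P : probability T R) (V : choiceType) (X : nat -> T -> V) : Prop :=
  {ae P, forall t, forall v, finite_set [set k | X k t = v]}.

(* Main.v *)
(* The weight of a path depends only on its numbers of edge crossings, so loops at
   the starting point v0 may be permuted: conditionally on many returns, the first
   steps of the walk are approximately those of a Markov chain whose conductances W
   are the edge weights reached after j returns. Reading the successive exits from
   each vertex as a stack, a Bellman supermartingale shows that, for large a, the
   conductance ratio W(v0) / W(e) has mean at most a constant times (1 + kappa)^n at
   distance n from v0, with kappa of order 1/a, even though W is arbitrary. On the
   other hand, by non-amenability the gradient of the Dirichlet potential of v0 is a
   unit flow whose energy decays exponentially (Combes-Thomas), with a rate that
   depends on K and c0 only. For small kappa this flow thus has bounded mean energy in
   the network W, and by Thomson's principle the chain then has a positive escape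
   probability. Hence the probability of m returns tends to 0 as m grows. *)

Require Import Defs.
From mathcomp Require Import ring lra zify.

Set Implicit Arguments.
Unset Strict Implicit.
Unset Printing Implicit Defensive.

Import Order.TTheory GRing.Theory Num.Theory.

Local Open Scope fset_scope.
Local Open Scope ring_scope.

(** The classical mixture theorem needs recurrence, while here recurrence with positive probability
    has to be excluded. The proof follows instead the limit [q] of the probability of [m] returns by
    time [l], as [l] and afterwards [m] grow, and shows [q <= 6 * d] for every [d > 0]. All
    statements concern finite sums over paths, with errors [eta]; probability spaces enter only when
    these sums are turned into transience. The obstacle is that a conductance ratio is unbounded and
    not a function of finitely many steps, whereas the walk can be compared with a frozen network
    only through tests with values in [0,1] on a bounded time. The ratio is therefore replaced by a
    payoff truncated at a horizon [H], whose mean in a frozen network is close to the ratio unless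
    some edge is used too rarely; for large [H] such networks have small mass. Truncation costs
    [eta * H ^ n], so [H] depends on the radius and [eta] on [H]. The growth [(1 + kappa) ^ n] must
    stay below the Combes-Thomas rate: this and the condition [4 <= a] of the supermartingale bounds
    determine [a0]. *)

Section Seq.

Lemma edge_eqE (V : choiceType) (x y l u : V) :
  ([fset l; u] == [fset x; y]) = ((l == x) && (u == y)) || ((l == y) && (u == x)).
Proof.
apply/eqP/idP => [E|/orP[]/andP[/eqP-> /eqP->] //]; last by rewrite fsetUC.
have: l \in [fset x; y] by rewrite -E !inE eqxx.
have: u \in [fset x; y] by rewrite -E !inE eqxx orbT.
have: x \in [fset l; u] by rewrite E !inE eqxx.
have: y \in [fset l; u] by rewrite E !inE eqxx orbT.
rewrite !inE ![_ == l]eq_sym ![_ == u]eq_sym.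
by case: (l == x); case: (l == y); case: (u == x); case: (u == y).
Qed.

(** * Word weights that depend on letter multiplicities only *)

Variables (R : realType) (T : eqType) (f : T -> nat -> R).

(** The weight of a word whose j-th occurrence of [x], counted from 0, weighs [f x j]; grouping
    equal letters makes its permutation invariance evident. *)
Definition countprod (s : seq T) : R :=
  \prod_(x <- undup s) \prod_(j < count_mem x s) f x j.

Lemma countprod_perm s t : perm_eq s t -> countprod s = countprod t.
Proof.
move=> st; rewrite /countprod.
have st' : perm_eq (undup s) (undup t) by exact: perm_undup (perm_mem st).
rewrite (perm_big _ st') /=; apply: eq_bigr => x _.
by have /permP/(_ (pred1 x)) -> := st.
Qed.

Lemma countprod_rcons s x : countprod (rcons s x) = countprod s * f x (count_mem x s).
Proof.
rewrite (@countprod_perm _ (x :: s)); last by rewrite perm_rcons.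
rewrite /countprod /=; case: (boolP (x \in s)) => xs; last first.
  rewrite big_cons mulrC /= eqxx (count_memPn xs) big_ord_recl big_ord0 mulr1.
  congr (_ * _).
  rewrite !big_seq; apply: eq_bigr => y; rewrite mem_undup => ys.
  by rewrite (_ : x == y = false) //; apply: contraNF xs => /eqP ->.
have xu : x \in undup s by rewrite mem_undup.
rewrite (bigD1_seq x) ?undup_uniq //= [in RHS](bigD1_seq x) ?undup_uniq //=.
rewrite eqxx add1n big_ord_recr /= mulrAC; congr (_ * _ * _).
by apply: eq_bigr => y; rewrite eq_sym => /negPf ->.
Qed.

End Seq.

(** * Sums over finite paths and supermartingales *)

Section Paths.
Variables (R : realType) (V : choiceType) (G : graph V).

Notation nbr := (neighbors G).

Fixpoint pths (n : nat) (v : V) : seq (seq V) :=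
  if n is n'.+1 then
    flatten [seq [seq u :: c | c <- pths n' u] | u <- enum_fset (nbr v)]
  else [:: [::]].

Lemma big_pths0 v (F : seq V -> R) : \sum_(c <- pths 0 v) F c = F [::].
Proof. by rewrite big_seq1. Qed.

Lemma big_pthsS n v (F : seq V -> R) :
  \sum_(c <- pths n.+1 v) F c = \sum_(u <- nbr v) \sum_(c <- pths n u) F (u :: c).
Proof.
by rewrite /= big_flatten /= big_map; apply: eq_bigr => u _; rewrite big_map.
Qed.

Lemma big_pthsD m n v (F : seq V -> R) :
  \sum_(c <- pths (m + n) v) F c =
  \sum_(c <- pths m v) \sum_(c' <- pths n (last v c)) F (c ++ c').
Proof.
elim: m v F => [|m IH] v F; first by rewrite add0n big_pths0.
by rewrite addSn !big_pthsS; apply: eq_bigr => u _; rewrite IH.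
Qed.

Hypothesis lf : locally_finite G.

Lemma in_nbr v w : (w \in nbr v) = G v w.
Proof. by rewrite in_fset_set ?inE//; apply/idP/idP; rewrite ?inE => // /set_mem. Qed.

Lemma mem_pths n v c : (c \in pths n v) = (size c == n) && path G v c.
Proof.
elim: n v c => [|n IH] v [|u c] //.
  apply/negP => /flattenP[s /mapP[u _ ->]] /mapP[c' _] //.
rewrite eqSS /= andbCA -IH -in_nbr.
apply/flattenP/andP => [[s /mapP[w hw ->] /mapP[c' hc' [-> ->]]] //|[hu hc]].
by exists [seq u :: c | c <- pths n u]; apply: map_f.
Qed.

Lemma eq_big_pths n v (F F' : seq V -> R) :
  (forall c, path G v c -> size c = n -> F c = F' c) ->
  \sum_(c <- pths n v) F c = \sum_(c <- pths n v) F' c.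
Proof.
move=> E; rewrite !big_seq; apply: eq_bigr => c.
by rewrite mem_pths => /andP[/eqP sz pc]; exact: E.
Qed.

Lemma ler_big_pths n v (F F' : seq V -> R) :
  (forall c, path G v c -> size c = n -> F c <= F' c) ->
  \sum_(c <- pths n v) F c <= \sum_(c <- pths n v) F' c.
Proof.
move=> E; rewrite big_seq [leRHS]big_seq; apply: ler_sum => c.
by rewrite mem_pths => /andP[/eqP sz pc]; exact: E.
Qed.

Variable v0 : V.

(* Paths are coded without their starting point; the kernel [q] depends on the whole
   past [g]. *)
Fixpoint kw (q : seq V -> V -> R) (g c : seq V) : R :=
  if c is u :: c' then q g u * kw q (rcons g u) c' else 1.

Lemma kw_cat q g c c' : kw q g (c ++ c') = kw q g c * kw q (g ++ c) c'.
Proof.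
elim: c g => [|u c IH] g /=; first by rewrite mul1r cats0.
by rewrite IH cat_rcons mulrA.
Qed.

Lemma kw_rcons q g c u : kw q g (rcons c u) = kw q g c * q (g ++ c) u.
Proof. by rewrite -cats1 kw_cat /= mulr1. Qed.

Lemma kw_ge0 q g c : (forall g u, 0 <= q g u) -> 0 <= kw q g c.
Proof. by move=> q0; elim: c g => [|u c IH] g //=; rewrite mulr_ge0. Qed.

Definition prefix_free (S : pred (seq V)) :=
  forall g c, S g -> S (g ++ c) -> c = [::].

(* Total weight of the continuations of length at most [l] of [g] that satisfy
   [S], tested against [F]. *)
Definition path_sum (q : seq V -> V -> R) (l : nat) (g : seq V) (S : pred (seq V))
    (F : seq V -> R) : R :=
  \sum_(i < l.+1) \sum_(c <- pths i (last v0 g) | S (g ++ c)) kw q g c * F (g ++ c).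

Lemma psum0 q g S F : path_sum q 0 g S F = (if S g then F g else 0).
Proof.
by rewrite /path_sum big_ord_recl big_ord0 addr0 big_mkcond big_pths0 cats0 /= mul1r.
Qed.

Lemma psumS q l g S F :
  path_sum q l.+1 g S F = (if S g then F g else 0) +
   \sum_(u <- nbr (last v0 g)) q g u * path_sum q l (rcons g u) S F.
Proof.
rewrite /path_sum big_ord_recl; congr (_ + _).
  by rewrite big_mkcond big_pths0 cats0 /= mul1r.
under eq_bigr do rewrite big_mkcond big_pthsS.
rewrite exchange_big /=; apply: eq_bigr => u _; rewrite mulr_sumr.
apply: eq_bigr => i _; rewrite last_rcons mulr_sumr [RHS]big_mkcond /=.
apply: eq_bigr => c _; rewrite cat_rcons; case: ifP => // _.
by rewrite mulrA.
Qed.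

Lemma psum_eq0 q l g S F : (forall c, ~~ S (g ++ c)) -> path_sum q l g S F = 0.
Proof.
move=> nS; rewrite /path_sum big1// => i _; rewrite big1// => c Sc.
by have := nS c; rewrite Sc.
Qed.

Definition superm (q : seq V -> V -> R) (Phi : seq V -> R) :=
  forall g, path G v0 g ->
    \sum_(u <- nbr (last v0 g)) q g u * Phi (rcons g u) <= Phi g.

Lemma path_rcons_nbr g u : path G v0 g -> u \in nbr (last v0 g) -> path G v0 (rcons g u).
Proof. by move=> pg; rewrite in_nbr rcons_path pg. Qed.

(** Prefix-freeness makes [S] a stopping rule, so this is optional stopping for a nonnegative
    supermartingale. With [Phi = 1] it is Kraft's inequality for prefix codes. *)
Lemma kraft q Phi l g (S : pred (seq V)) : (forall g u, 0 <= q g u) ->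
  (forall g, path G v0 g -> 0 <= Phi g) -> superm q Phi ->
  prefix_free S -> path G v0 g -> path_sum q l g S Phi <= Phi g.
Proof.
move=> q0 P0 sP pS; elim: l g => [|l IH] g pg.
  by rewrite psum0; case: ifP => // _; exact: P0.
rewrite psumS; case: ifP => Sg; last first.
  rewrite add0r; apply: le_trans (sP _ pg); rewrite big_seq [leRHS]big_seq.
  by apply: ler_sum => u hu; apply: ler_wpM2l => //; apply/IH/path_rcons_nbr.
rewrite big1 ?addr0// => u _; rewrite psum_eq0 ?mulr0// => c.
by apply/negP; rewrite cat_rcons => /(pS _ _ Sg).
Qed.

(** Members of [S] beyond [g] all pass through [g ++ c]: the steps of [c] cost [kw q g c], and from
    there on [kraft] applies with the constant 1. *)
Lemma kraft_ext q l g (S : pred (seq V)) c : (forall g u, 0 <= q g u) ->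
  superm q (fun=> 1) -> prefix_free S -> path G v0 g ->
  (forall g', S (g ++ g') -> exists c', g' = c ++ c') -> path G (last v0 g) c ->
  path_sum q l g S (fun=> 1) <= kw q g c.
Proof.
move=> q0 s1 pS; elim: c l g => [|u c IH] l g pg ext /=.
  by move=> _; apply: kraft.
move=> /andP[gu pc].
have nSg : S g = false.
  by apply/negP => Sg; have [] := ext [::]; rewrite ?cats0.
have pos : 0 <= q g u * kw q (rcons g u) c by rewrite mulr_ge0// kw_ge0.
case: l => [|l]; first by rewrite psum0 nSg.
rewrite psumS nSg add0r (bigD1_seq u) ?in_nbr ?fset_uniq //= big1 ?addr0; last first.
  move=> w wu; rewrite psum_eq0 ?mulr0// => c'.
  apply/negP; rewrite cat_rcons => /ext[c'' []] E.
  by rewrite E eqxx in wu.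
apply: ler_wpM2l => //; apply: IH; rewrite ?last_rcons ?rcons_path ?pg//.
move=> g'; rewrite cat_rcons => /ext[c' [->]]; by exists c'.
Qed.

Lemma prefix_free_size n : prefix_free (fun c : seq V => size c == n).
Proof.
move=> g c /eqP <-; rewrite size_cat => /eqP sz.
by apply: size0nil; apply/eqP; rewrite -(eqn_add2l (size g)) sz addn0.
Qed.

Lemma prefix_free_sub (S S' : pred (seq V)) : (forall c, S' c -> S c) ->
  prefix_free S -> prefix_free S'.
Proof. by move=> sub pS g c /sub h /sub; exact: pS. Qed.

Lemma sum_pths_psum q n (A : pred (seq V)) F :
  \sum_(c <- pths n v0 | A c) kw q [::] c * F c =
  path_sum q n [::] (fun c => (size c == n) && A c) F.
Proof.
rewrite /path_sum big_ord_recr /= [X in _ = X + _]big1 ?add0r.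
  rewrite big_seq_cond [RHS]big_seq_cond; apply: eq_bigl => c.
  by rewrite mem_pths; case: (size c == n).
move=> i _; rewrite big_seq_cond big1// => c; rewrite mem_pths.
by case/andP => /andP[/eqP -> _] /andP[/eqP E]; have := ltn_ord i; rewrite E ltnn.
Qed.

Lemma sum_pths_superm q Phi n : (forall g u, 0 <= q g u) ->
  (forall g, path G v0 g -> 0 <= Phi g) -> superm q Phi ->
  \sum_(c <- pths n v0) kw q [::] c * Phi c <= Phi [::].
Proof.
move=> q0 P0 sP; rewrite (sum_pths_psum q n predT); apply: kraft => //.
by apply: prefix_free_sub (@prefix_free_size n) => c /andP[].
Qed.

End Paths.

(** * Crossings, exits and visits along a path *)

Section Counts.
Variables (V : choiceType) (v0 : V).

Definition steps (x : V) (c : seq V) : seq (V * V) := pairmap pair x c.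

Lemma steps_cat x c c' : steps x (c ++ c') = steps x c ++ steps (last x c) c'.
Proof. exact: pairmap_cat. Qed.

Lemma steps_rcons x c u : steps x (rcons c u) = rcons (steps x c) (last x c, u).
Proof. by rewrite -cats1 steps_cat /= cats1. Qed.

Definition ucount (c : seq V) (x y : V) : nat :=
  count (fun z => [fset z.1; z.2] == [fset x; y]) (steps v0 c).

Definition exits (c : seq V) (v : V) : nat :=
  count (fun z => z.1 == v) (steps v0 c).

Definition cross (c : seq V) (v u : V) : nat := count_mem (v, u) (steps v0 c).

Lemma ucount_rcons c w x y :
  ucount (rcons c w) x y = (ucount c x y + ([fset last v0 c; w] == [fset x; y]))%N.
Proof. by rewrite /ucount steps_rcons -cats1 count_cat /= addn0. Qed.

Lemma exits_rcons c w v : exits (rcons c w) v = (exits c v + (last v0 c == v))%N.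
Proof. by rewrite /exits steps_rcons -cats1 count_cat /= addn0. Qed.

Lemma cross_rcons c w v u :
  cross (rcons c w) v u = (cross c v u + ((last v0 c == v) && (w == u)))%N.
Proof. by rewrite /cross steps_rcons -cats1 count_cat /= addn0 xpair_eqE. Qed.

Lemma count_mem_rcons (c : seq V) w v : count_mem v (rcons c w) = (count_mem v c + (w == v))%N.
Proof. by rewrite -cats1 count_cat /= addn0. Qed.

Lemma ucountC c x y : ucount c x y = ucount c y x.
Proof. by rewrite /ucount fsetUC. Qed.

Lemma exits_balance c v :
  (exits c v + (last v0 c == v) = (v0 == v) + count_mem v c)%N.
Proof.
elim/last_ind: c => [|c w IH]; first by rewrite /exits /= addn0.
by rewrite exits_rcons count_mem_rcons last_rcons IH addnA.
Qed.

Lemma cross_le_count c v u : (cross c v u <= count_mem u c)%N.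
Proof.
elim/last_ind: c => [|c w IH]; first by [].
rewrite cross_rcons count_mem_rcons leq_add //.
by case: (w == u); case: (_ == v).
Qed.

Lemma ucount_take c n x y : (ucount (take n c) x y <= ucount c x y)%N.
Proof. by rewrite -{2}(cat_take_drop n c) /ucount steps_cat count_cat leq_addr. Qed.

Lemma ucount_cat_le c c' x y : (ucount (c ++ c') x y <= ucount c x y + size c')%N.
Proof.
rewrite /ucount steps_cat count_cat leq_add2l.
by apply: leq_trans (count_size _ _) _; rewrite size_pairmap.
Qed.

End Counts.

(** * Reinforced weights and invariance under exchange of loops *)

Section Weights.
Variables (R : realType) (V : choiceType) (G : graph V).
Hypothesis lf : locally_finite G.
Variables (v0 : V) (a : R).
Hypothesis a_gt0 : 0 < a.

Notation nbr := (neighbors G).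

Definition Wt (c : seq V) (x y : V) : R := a + (ucount v0 c x y)%:R.
Definition Wv (c : seq V) (x : V) : R := \sum_(y <- nbr x) Wt c x y.
(** Taken at every vertex [x], not just at the end of [c]: the weights frozen after [c] form a
    network, and these are the transition probabilities of its Markov chain. *)
Definition edge_prob (c : seq V) (x y : V) : R := Wt c x y / Wv c x.
Definition step_prob (c : seq V) (u : V) : R := edge_prob c (last v0 c) u.

Lemma Wt_gt0 c x y : 0 < Wt c x y.
Proof. by rewrite ltr_pwDl. Qed.

Lemma WtC c x y : Wt c x y = Wt c y x.
Proof. by rewrite /Wt ucountC. Qed.

Lemma Wv_ge0 c x : 0 <= Wv c x.
Proof. by apply: sumr_ge0 => y _; exact/ltW/Wt_gt0. Qed.

Lemma pr_ge0 c x y : 0 <= edge_prob c x y.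
Proof. by rewrite divr_ge0 ?Wv_ge0// ltW// Wt_gt0. Qed.

Lemma stp_ge0 c u : 0 <= step_prob c u.
Proof. exact: pr_ge0. Qed.

Lemma sum_ucount c x : path G v0 c ->
  (\sum_(y <- nbr x) ucount v0 c x y = exits v0 c x + count_mem x c)%N.
Proof.
elim/last_ind: c => [|c w IH]; first by move=> _; rewrite big1.
rewrite rcons_path => /andP[pc lw].
under eq_bigr do rewrite ucount_rcons.
rewrite big_split /= IH// exits_rcons count_mem_rcons addnACA; congr (_ + _)%N.
set l := last v0 c in lw *.
have lw' : l != w by apply: contraTneq lw => ->; rewrite adj_irr.
under eq_bigr do rewrite edge_eqE.
have key y0 : (\sum_(y <- nbr x) (y0 == y) = (y0 \in nbr x))%N.
  rewrite -(count_uniq_mem _ (fset_uniq _)) -sum1_count [RHS]big_mkcond.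
  by apply: eq_bigr => y _ /=; rewrite [y == _]eq_sym; case: (_ == _).
have [lx|lx] := eqVneq l x.
  have -> : (w == x) = false by rewrite -lx eq_sym; exact: negPf.
  under eq_bigr do rewrite andTb andbF orbF.
  by apply: etrans (key w) _; rewrite in_nbr// -lx lw.
have [wx|wx] /= := eqVneq w x.
  under eq_bigr do rewrite andbT.
  by apply: etrans (key l) _; rewrite -wx in_nbr// adj_sym lw.
by rewrite big1// => y _; rewrite andbF.
Qed.

Lemma Wv_path c x : path G v0 c ->
  Wv c x = (degree G x)%:R * a + (exits v0 c x + count_mem x c)%:R.
Proof.
move=> pc; rewrite /Wv big_split /= -natr_sum sum_ucount//; congr (_ + _).
by rewrite big_const_seq count_predT iter_addr_0 mulr_natl.
Qed.

Lemma Wv_last c : path G v0 c ->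
  Wv c (last v0 c) = (degree G (last v0 c))%:R * a +
    ((exits v0 c (last v0 c)).*2 + (last v0 c != v0))%:R.
Proof.
move=> pc; rewrite Wv_path//; congr (_ + _%:R).
have := exits_balance v0 c (last v0 c); rewrite eqxx [v0 == _]eq_sym.
by case: (_ == v0) => /=; lia.
Qed.

Lemma ucount_le c x y : path G v0 c -> y \in nbr x ->
  (ucount v0 c x y <= exits v0 c x + count_mem x c)%N.
Proof.
move=> pc yx; rewrite -sum_ucount// (bigD1_seq y) ?fset_uniq//=.
exact: leq_addr.
Qed.

Section Swap.

Let fnum (_ : {fset V}) (j : nat) : R := a + j%:R.
Let fden (v : V) (j : nat) : R := (degree G v)%:R * a + (j.*2 + (v != v0))%:R.

(* The factor contributed by the k-th exit from a vertex depends on k only, and the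
   one of the j-th crossing of an edge on j only. *)
Lemma weight_countprod c : path G v0 c ->
  kw step_prob [::] c =
  countprod fnum [seq [fset z.1; z.2] | z <- steps v0 c] /
  countprod fden [seq z.1 | z <- steps v0 c].
Proof.
elim/last_ind: c => [|c w IH]; first by rewrite /countprod !big_nil divr1.
rewrite rcons_path => /andP[pc lw].
rewrite kw_rcons cat0s IH// steps_rcons !map_rcons !countprod_rcons invfM.
rewrite [RHS]mulrACA; congr (_ * _); rewrite /step_prob /edge_prob /Wt.
rewrite Wv_last// /fnum /fden /= /ucount /exits !count_map.
by congr (_ / _).
Qed.

(** Swapping two loops at [v0] only permutes the oriented steps. *)
Lemma weight_swap g1 g2 : path G v0 (g1 ++ g2) ->
  last v0 g1 = v0 -> last v0 g2 = v0 ->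
  kw step_prob [::] (g1 ++ g2) = kw step_prob [::] (g2 ++ g1).
Proof.
move=> p12 l1 l2.
have p21 : path G v0 (g2 ++ g1).
  by move: p12; rewrite !cat_path l1 l2 andbC.
rewrite !weight_countprod// !steps_cat l1 l2.
have P12 : perm_eq (steps v0 g1 ++ steps v0 g2) (steps v0 g2 ++ steps v0 g1).
  by rewrite perm_catC.
by congr (_ / _); apply: countprod_perm; exact: perm_map.
Qed.

End Swap.

Hypothesis deg_gt0 : forall v, (0 < degree G v)%N.

Lemma Wv_gt0 c x : 0 < Wv c x.
Proof.
have := deg_gt0 x; rewrite /Wv /degree.
case: (enum_fset (nbr x)) => [//|y s _]; rewrite big_cons.
by rewrite ltr_pwDl ?Wt_gt0//; apply: sumr_ge0 => z _; exact/ltW/Wt_gt0.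
Qed.

Lemma sum_pr c x : \sum_(y <- nbr x) edge_prob c x y = 1.
Proof. by rewrite -mulr_suml divff// gt_eqF// Wv_gt0. Qed.

Lemma sum_stp c : \sum_(u <- nbr (last v0 c)) step_prob c u = 1.
Proof. exact: sum_pr. Qed.

Lemma superm1 : superm G v0 step_prob (fun=> 1).
Proof. by move=> g pg; under eq_bigr do rewrite mulr1; rewrite sum_stp. Qed.

Variable K : nat.
Hypothesis degK : forall v, (degree G v <= K)%N.

Lemma Wv_last_le c : path G v0 c ->
  Wv c (last v0 c) <= K%:R * a + 2 * (exits v0 c (last v0 c))%:R + 1.
Proof.
move=> pc; rewrite Wv_last// -addrA lerD//.
  by rewrite ler_wpM2r ?ler_nat ?degK// ltW.
rewrite -muln2 natrD natrM mulrC lerD2l.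
by case: (_ == _).
Qed.

Lemma stp_lower c u : path G v0 c ->
  a <= step_prob c u * Wv c (last v0 c).
Proof. by move=> pc; rewrite /step_prob /edge_prob divfK ?gt_eqF ?Wv_gt0// lerDl. Qed.

Lemma stp_upper c u : path G v0 c -> u \in nbr (last v0 c) ->
  step_prob c u * Wv c (last v0 c) <= a + 2 * (exits v0 c (last v0 c))%:R + 1.
Proof.
move=> pc ul; rewrite /step_prob /edge_prob divfK ?gt_eqF ?Wv_gt0//.
rewrite /Wt -addrA lerD2l; have := ucount_le pc ul.
have := exits_balance v0 c (last v0 c); rewrite eqxx => E h.
have : (ucount v0 c (last v0 c) u <= 2 * exits v0 c (last v0 c) + 1)%N by lia.
by rewrite -(ler_nat R) natrD natrM.
Qed.

Lemma stp_le1 c u : u \in nbr (last v0 c) -> step_prob c u <= 1.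
Proof.
move=> ul; rewrite -(sum_stp c) (bigD1_seq u) ?fset_uniq//= lerDl.
by apply: sumr_ge0 => w _; exact: stp_ge0.
Qed.

Lemma pr_le1 c x u : u \in nbr x -> edge_prob c x u <= 1.
Proof.
move=> ul; rewrite -(sum_pr c x) (bigD1_seq u) ?fset_uniq//= lerDl.
by apply: sumr_ge0 => w _; exact: pr_ge0.
Qed.

End Weights.

(** * Comparison, union bound and Markov's inequality for path sums *)

Section PsumTheory.
Variables (R : realType) (V : choiceType) (G : graph V).
Hypothesis lf : locally_finite G.
Variables (v0 : V) (q : seq V -> V -> R).
Hypothesis q_ge0 : forall g u, 0 <= q g u.

Notation psum := (path_sum G v0 q).

Lemma psum_le l (S S' : pred (seq V)) (F F' : seq V -> R) :
  (forall c, path G v0 c -> S c -> 0 <= F c -> S' c /\ F c <= F' c) ->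
  (forall c, 0 <= F c) -> (forall c, 0 <= F' c) ->
  psum l [::] S F <= psum l [::] S' F'.
Proof.
move=> H F0 F'0; apply: ler_sum => i _.
rewrite big_mkcond [leRHS]big_mkcond; apply: ler_big_pths => // c pc _ /=.
case: ifP => [Sc|_]; last first.
  by case: ifP => // _; rewrite mulr_ge0// kw_ge0.
have [-> FF] := H _ pc Sc (F0 c).
by rewrite ler_wpM2l// kw_ge0.
Qed.

Lemma psumZ l g S F (x : R) : psum l g S (fun c => x * F c) = x * psum l g S F.
Proof.
rewrite /path_sum mulr_sumr; apply: eq_bigr => i _; rewrite mulr_sumr.
by apply: eq_bigr => c _; rewrite mulrCA.
Qed.

Lemma psumD l g S F F' :
  psum l g S (fun c => F c + F' c) = psum l g S F + psum l g S F'.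
Proof.
rewrite /path_sum -big_split /=; apply: eq_bigr => i _; rewrite -big_split /=.
by apply: eq_bigr => c _; rewrite mulrDr.
Qed.

Lemma psum_mkcond l g S F :
  psum l g S F = psum l g predT (fun c => if S c then F c else 0).
Proof.
apply: eq_bigr => i _; rewrite big_mkcond; apply: eq_bigr => c _ /=.
by case: ifP; rewrite ?mulr0.
Qed.

Lemma psumU l (S S1 S2 : pred (seq V)) :
  (forall c, path G v0 c -> S c -> S1 c || S2 c) ->
  psum l [::] S (fun=> 1) <= psum l [::] S1 (fun=> 1) + psum l [::] S2 (fun=> 1).
Proof.
move=> H; rewrite !(psum_mkcond _ _ S) !(psum_mkcond _ _ S1) !(psum_mkcond _ _ S2) -psumD.
apply: psum_le => // c; last 2 first.
- by case: ifP.
- by case: ifP; case: ifP => _ _; rewrite ?addr0 ?add0r// addr_ge0.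
move=> pc _ _; split=> //; case: ifP => [/(H _ pc)|_].
  by case: (S1 c); case: (S2 c) => //= _; rewrite ?addr0 ?add0r// lerDl.
by case: ifP; case: ifP => _ _; rewrite ?addr0 ?add0r// addr_ge0.
Qed.

Lemma psum_markov l (S S' : pred (seq V)) (Phi : seq V -> R) (x : R) :
  0 < x -> (forall g, 0 <= Phi g) -> superm G v0 q Phi ->
  prefix_free S -> (forall c, path G v0 c -> S' c -> S c /\ x <= Phi c) ->
  psum l [::] S' (fun=> 1) <= x^-1 * Phi [::].
Proof.
move=> x0 P0 sP pS H.
apply: (@le_trans _ _ (x^-1 * psum l [::] S Phi)); last first.
  by rewrite ler_wpM2l ?invr_ge0 ?(ltW x0)//; exact: kraft.
rewrite -psumZ; apply: psum_le => // c.
  by move=> pc /(H _ pc)[? xP] _; split => //; rewrite mulrC ler_pdivlMr// mul1r.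
by rewrite mulr_ge0// invr_ge0 ltW.
Qed.

End PsumTheory.

(** * Many exits from one vertex force many exits from the others *)

Section Visits.
Variables (R : realType) (V : choiceType) (G : graph V).
Hypothesis lf : locally_finite G.
Variables (v0 : V) (a : R) (K : nat).
Hypothesis a_ge4 : 4 <= a.
Hypothesis deg_gt0 : forall v, (0 < degree G v)%N.
Hypothesis degK : forall v, (degree G v <= K)%N.

Notation nbr := (neighbors G).
Notation stp := (step_prob G v0 a).

Let a_gt0 : 0 < a. Proof. exact: lt_le_trans a_ge4. Qed.

(** After [k] exits from [v] the next one leads to [u] with probability at least
    [a / (K a + 2 k + 1)], which for [4 <= a] is at least [2 / (k + 1 + 2 K)]. Halving at that rate
    outweighs the growth of the linear factor by one. *)
Lemma cross_superm v u : u \in nbr v ->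
  superm G v0 stp (fun g => 2^-1 ^+ (cross v0 g v u) * ((exits v0 g v)%:R + 2 * K%:R)).
Proof.
move=> uv g pg.
under eq_bigr do rewrite cross_rcons exits_rcons.
have [lv|lv] := eqVneq (last v0 g) v; last first.
  by under eq_bigr do rewrite /= !addn0; rewrite -mulr_suml sum_stp// mul1r.
have ul : u \in nbr (last v0 g) by rewrite lv.
rewrite (bigD1_seq u) ?fset_uniq//= eqxx addn1.
rewrite (eq_bigr (fun i => stp g i * (2^-1 ^+ cross v0 g v u * ((exits v0 g v).+1%:R + 2 * K%:R)))); last first.
  by move=> i /negPf ->; rewrite addn0.
rewrite -mulr_suml.
have := sum_stp v0 a_gt0 deg_gt0 g; rewrite (bigD1_seq u) ?fset_uniq//=.
set s := stp g u; set t := \sum_(_ <- _ | _) _ => st.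
have {t st}-> : t = 1 - s by rewrite -st; ring.
rewrite !addn1 exprS; set x := 2^-1 ^+ _.
have x0 : 0 <= x by rewrite exprn_ge0.
rewrite -natr1; set k := (exits v0 g v)%:R.
have k0 : 0 <= k by [].
have D1 := Wv_last_le lf a_gt0 degK pg.
have D2 := stp_lower a_gt0 deg_gt0 u pg.
have D0 := Wv_gt0 v0 a_gt0 deg_gt0 g (last v0 g).
rewrite lv -/k in D1 D2 D0; rewrite -/s in D2.
set D := Wv _ _ _ _ _ in D1 D2 D0.
have s2 : 2 <= s * (k + 1 + 2 * K%:R).
  rewrite -(ler_pM2r D0) mulrAC.
  have K0 : 0 <= K%:R :> R by [].
  have h : a * (k + 1 + 2 * K%:R) <= s * D * (k + 1 + 2 * K%:R) by rewrite ler_wpM2r//; lra.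
  have h2 : 0 <= (a - 4) * k by rewrite mulr_ge0// subr_ge0.
  apply: le_trans h; apply: le_trans (_ : 2 * (K%:R * a + 2 * k + 1) <= _); first by rewrite ler_pM2l.
  rewrite -subr_ge0 (_ : _ - _ = (a - 4) * k + (a - 2)); last by ring.
  by rewrite addr_ge0// subr_ge0; apply: le_trans a_ge4; rewrite ler_nat.
rewrite (_ : _ + _ = x * ((k + 1 + 2 * K%:R) - 2^-1 * (s * (k + 1 + 2 * K%:R)))); last by field.
by rewrite ler_wpM2l//; lra.
Qed.

Lemma few_crossings (l n L : nat) (S : pred (seq V)) v u : u \in nbr v ->
  prefix_free S -> (0 < n)%N ->
  path_sum G v0 stp l [::] (fun c => [&& S c, (n <= exits v0 c v)%N & (cross v0 c v u <= L)%N])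
    (fun=> 1) <= 2 ^+ L * (2 * K%:R) / n%:R.
Proof.
move=> uv pS n0.
have x0 : 0 < 2^-1 ^+ L * n%:R :> R by rewrite mulr_gt0 ?ltr0n// exprn_gt0.
have := @psum_markov _ _ _ lf v0 stp (stp_ge0 G v0 a_gt0) l S
  (fun c => [&& S c, (n <= exits v0 c v)%N & (cross v0 c v u <= L)%N]) _ _ x0 _
  (cross_superm uv) pS.
rewrite /= add0r mul1r invfM -exprVn invrK => H.
apply: le_trans (H _ _) _; last by rewrite mulrAC.
  by move=> g; rewrite mulr_ge0// exprn_ge0.
move=> c pc /and3P[Sc nc cL]; split=> //; apply: ler_pM => //.
- by apply: ler_wiXn2l => //; rewrite ?invr_ge0// invf_le1// ler1n.
- by apply: (@le_trans _ _ (exits v0 c v)%:R); rewrite ?ler_nat// lerDl mulr_ge0.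
Qed.

(** Induction along [p]: by [few_crossings], many exits from [x] with few crossings to the next
    vertex are unlikely, and crossings to that vertex produce exits from it. *)
Lemma few_exits x p (L : nat) (eta : R) : path G x p -> 0 < eta ->
  exists n : nat, forall (S : pred (seq V)) l, prefix_free S ->
    path_sum G v0 stp l [::]
      (fun c => [&& S c, (n <= exits v0 c x)%N & (exits v0 c (last x p) < L)%N])
      (fun=> 1) <= eta.
Proof.
elim: p x eta => [|u p IH] x eta /=.
  move=> _ e0; exists L => S l pS; rewrite psum_eq0 ?ltW// => c /=.
  by rewrite [(L <= _)%N]leqNgt; case: (_ < L)%N; rewrite ?andbF.
move=> /andP[xu pu] e0.
have [n' Hn'] := IH u (eta / 2) pu ltac:(by rewrite divr_gt0).
pose M : R := 2 ^+ n'.+1 * (2 * K%:R) / (eta / 2).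
pose n := (Num.truncn M).+1.
have nM : M <= n%:R by apply/ltW; rewrite /n; apply: truncnS_gt.
exists n => S l pS.
apply: (@le_trans _ _ (eta / 2 + eta / 2)); last by rewrite -splitr.
apply: le_trans (@psumU _ _ _ lf v0 stp (stp_ge0 G v0 a_gt0) l _
  (fun c => [&& S c, (n' <= exits v0 c u)%N & (exits v0 c (last u p) < L)%N])
  (fun c => [&& S c, (n <= exits v0 c x)%N & (cross v0 c x u <= n'.+1)%N]) _) _.
  (* A crossing to [u] is a visit to [u], and every visit except possibly the final one is followed
     by an exit, so fewer than [n'] exits leave at most [n'.+1] crossings. *)
  move=> c pc /and3P[-> -> ->] /=; rewrite andbT.
  have := exits_balance v0 c u; have := cross_le_count v0 c x u.
  by case: (last v0 c == u); case: (v0 == u); lia.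
apply: lerD; first exact: Hn'.
apply: le_trans (few_crossings _ _ _ pS _) _ => //; first by rewrite in_nbr.
rewrite ler_pdivrMr ?ltr0n//.
rewrite [leRHS]mulrC; by move: nM; rewrite /M ler_pdivrMr// divr_gt0.
Qed.

End Visits.

(** * Payoffs read from a stack, Bellman functions and conditional means *)

Section Payoff.
Variables (R : realType) (V : choiceType) (T : pred V) (u : V).

(* Number of successors in [T] read from a stack up to the first [u]. *)
Fixpoint payoff (s : seq V) : R :=
  if s is x :: s' then (T x)%:R + (if x == u then 0 else payoff s') else 0.

(* The Bellman function for [payoff]: [s] has been read from a stack, and [A + B k]
   bounds what an unfinished stack of size k may still yield. *)
Fixpoint payoff_bound (A B : R) (k : nat) (s : seq V) : R :=
  if s is x :: s' then (T x)%:R + (if x == u then 0 else payoff_bound A B k.+1 s')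
  else A + B * k%:R.

Variables (pT pu : R).

(* Expected payoff of [H] independent successors, each in [T] with probability
   [pT] and equal to [u] with probability [pu]. *)
Fixpoint mean_payoff (H : nat) : R :=
  if H is H'.+1 then pT + (1 - pu) * mean_payoff H' else 0.

(** Conditional mean of the payoff of [H] independent successors given that the first ones are
    [s]. *)
Fixpoint cond_payoff (H : nat) (s : seq V) : R :=
  match H, s with
  | 0%N, _ => 0
  | H.+1, [::] => mean_payoff H.+1
  | H.+1, x :: s' => (T x)%:R + (if x == u then 0 else cond_payoff H s')
  end.

Lemma cond_payoff_nil H : cond_payoff H [::] = mean_payoff H.
Proof. by case: H. Qed.

Lemma payoff_ge0 s : 0 <= payoff s.
Proof. by elim: s => [|x s IH] //=; rewrite addr_ge0//; case: ifP. Qed.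

Lemma payoff_bound_ge0 A B k s : 0 <= A -> 0 <= B -> 0 <= payoff_bound A B k s.
Proof.
move=> A0 B0; elim: s k => [|x s IH] k /=; first by rewrite addr_ge0// mulr_ge0.
by rewrite addr_ge0//; case: ifP.
Qed.

Lemma payoff_le_bound A B k s : 0 <= A -> 0 <= B -> payoff s <= payoff_bound A B k s.
Proof.
move=> A0 B0; elim: s k => [|x s IH] k /=; first by rewrite addr_ge0// mulr_ge0.
by rewrite lerD2l; case: ifP.
Qed.

Lemma cond_payoff_le H s : (H <= size s)%N -> cond_payoff H s <= payoff s.
Proof.
elim: H s => [|H IH] [|x s] //= Hs; first by rewrite addr_ge0//; case: ifP; rewrite ?payoff_ge0.
by rewrite lerD2l; case: ifP => // _; exact: IH.
Qed.

Hypotheses (pT0 : 0 <= pT) (pT1 : pT <= 1) (pu0 : 0 <= pu) (pu1 : pu <= 1).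

Lemma mean_payoff_ge0 H : 0 <= mean_payoff H.
Proof. by elim: H => [|H IH] //=; rewrite addr_ge0// mulr_ge0// subr_ge0. Qed.

Lemma mean_payoff_le H : mean_payoff H <= H%:R.
Proof.
elim: H => [|H IH] //=; rewrite -natr1 addrC lerD//.
by apply: le_trans IH; rewrite ler_piMl ?mean_payoff_ge0// gerBl.
Qed.

Lemma cond_payoff_ge0 H s : 0 <= cond_payoff H s.
Proof.
elim: H s => [|H IH] [|x s] //=; first exact: (mean_payoff_ge0 H.+1).
by rewrite addr_ge0//; case: ifP.
Qed.

Lemma cond_payoff_leH H s : cond_payoff H s <= H%:R.
Proof.
elim: H s => [|H IH] [|x s] //=; first exact: (mean_payoff_le H.+1).
rewrite -natr1 addrC lerD//; first by case: ifP.
by case: (T x).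
Qed.

Variables (r : seq V) (p : V -> R).
Hypotheses (r_uniq : uniq r) (ur : u \in r) (sum_p : \sum_(w <- r) p w = 1).
Hypothesis p_ge0 : forall w, 0 <= p w.

Lemma sum_mixed (F : R) : \sum_(w <- r) p w * ((T w)%:R + (if w == u then 0 else F)) =
  \sum_(w <- r) p w * (T w)%:R + (1 - p u) * F.
Proof.
under eq_bigr do rewrite mulrDr.
rewrite big_split /=; congr (_ + _).
rewrite -sum_p (bigD1_seq u)//= eqxx mulr0 add0r [in RHS](bigD1_seq u)//=.
rewrite addrAC subrr add0r mulr_suml; apply: eq_bigr => w /negPf ->.
by [].
Qed.

Lemma sum_const_if (x : V) (F : V -> R) (C : R) :
  \sum_(w <- r) p w * (C + (if x == u then 0 else F w)) =
  C + (if x == u then 0 else \sum_(w <- r) p w * F w).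
Proof.
under eq_bigr do rewrite mulrDr.
rewrite big_split /= -mulr_suml sum_p mul1r; congr (_ + _).
by case: ifP => // _; under eq_bigr do rewrite mulr0; rewrite big1.
Qed.

Lemma cond_payoff_step H s :
  \sum_(w <- r) p w * (T w)%:R = pT -> p u = pu ->
  \sum_(w <- r) p w * cond_payoff H (rcons s w) = cond_payoff H s.
Proof.
move=> EpT Epu; elim: H s => [|H IH] s.
  by rewrite big1 // => w _; rewrite /= mulr0.
case: s => [|x s] /=.
  under eq_bigr do rewrite cond_payoff_nil.
  by rewrite sum_mixed EpT Epu.
by rewrite sum_const_if IH.
Qed.

(** A new entry only replaces the final term [A + B * k] of the recursion, and nothing changes once
    [u] has been read; one inequality at the current stack size is enough. *)
Lemma payoff_bound_step A B k s :
  \sum_(w <- r) p w * (T w)%:R + (1 - p u) * (A + B * (k + size s).+1%:R)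
    <= A + B * (k + size s)%:R ->
  \sum_(w <- r) p w * payoff_bound A B k (rcons s w) <= payoff_bound A B k s.
Proof.
elim: s k => [|x s IH] k /=; first by rewrite sum_mixed addn0.
rewrite sum_const_if addnS -addSn => /IH h; rewrite lerD2l.
by case: ifP.
Qed.

End Payoff.

(** * Products of functions of stacks at distinct vertices *)

Section Product.
Variables (R : realType) (V : choiceType) (G : graph V).
Hypothesis lf : locally_finite G.
Variables (v0 : V) (q : seq V -> V -> R).

Notation nbr := (neighbors G).

Definition stack (g : seq V) (v : V) : seq V := [seq z.2 | z <- steps v0 g & z.1 == v].

Lemma stack_rcons g w v :
  stack (rcons g w) v = if last v0 g == v then rcons (stack g v) w else stack g v.
Proof.
rewrite /stack steps_rcons filter_rcons /=; case: ifP => // _.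
by rewrite map_rcons.
Qed.

Lemma size_stack g v : size (stack g v) = exits v0 g v.
Proof. by rewrite size_map size_filter. Qed.

Hypothesis q_ge0 : forall g u, 0 <= q g u.
Hypothesis q_sum : forall g, path G v0 g -> \sum_(u <- nbr (last v0 g)) q g u = 1.

Lemma sum_pths_mart Phi n :
  (forall g, path G v0 g -> \sum_(u <- nbr (last v0 g)) q g u * Phi (rcons g u) = Phi g) ->
  \sum_(c <- pths G n v0) kw q [::] c * Phi c = Phi [::].
Proof.
move=> H; elim: n => [|n IH]; first by rewrite big_pths0 mul1r.
rewrite -addn1 big_pthsD -IH; apply: eq_big_pths => // c pc _.
rewrite big_pthsS -H// mulr_sumr; apply: eq_bigr => u _.
by rewrite big_pths0 cats1 kw_rcons cat0s mulrA.
Qed.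

Variables (n : nat) (vtx : nat -> V) (f : nat -> seq V -> R).
Hypothesis vtx_inj : forall i j, (i < n)%N -> (j < n)%N -> vtx i = vtx j -> i = j.

Let Phi g := \prod_(i < n) f i (stack g (vtx i)).

(** A step lengthens only the stack of the vertex it leaves, so at most one factor changes. Products
    over distinct vertices thus inherit the (super)martingale property of their factors, with no
    independence of the stacks. *)
Lemma prod_stack_cases g :
  (forall w, Phi (rcons g w) = Phi g) \/
  exists2 i, (i < n)%N /\ last v0 g = vtx i &
    exists2 C, Phi g = C * f i (stack g (vtx i)) /\ C = \prod_(j < n | j != i :> nat) f j (stack g (vtx j)) &
     forall w, Phi (rcons g w) = C * f i (rcons (stack g (vtx i)) w).
Proof.
case: (pickP (fun i : 'I_n => last v0 g == vtx i)) => [i /eqP li|no]; last first.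
  left=> w; apply: eq_bigr => i _; rewrite stack_rcons.
  by rewrite no.
right; exists i; first by split.
exists (\prod_(j < n | j != i :> nat) f j (stack g (vtx j))).
  by split=> //; rewrite /Phi (bigD1 i)//= mulrC.
move=> w; rewrite /Phi (bigD1 i)//= mulrC stack_rcons li eqxx; congr (_ * _).
apply: eq_bigr => j ji; rewrite stack_rcons li; case: eqP => // E.
by case/eqP: ji; apply: val_inj; apply: vtx_inj (ltn_ord j) (ltn_ord i) (esym E).
Qed.

Lemma prod_stack_superm :
  (forall i s, (i < n)%N -> 0 <= f i s) ->
  (forall i g, (i < n)%N -> path G v0 g -> last v0 g = vtx i ->
     \sum_(w <- nbr (vtx i)) q g w * f i (rcons (stack g (vtx i)) w) <=
     f i (stack g (vtx i))) ->
  superm G v0 q Phi.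
Proof.
move=> f0 H g pg; case: (prod_stack_cases g) => [E|[i [ilt li] [C [EC C0] E]]].
  by under eq_bigr do rewrite E; rewrite -mulr_suml q_sum// mul1r.
under eq_bigr do rewrite E mulrCA.
rewrite -mulr_sumr EC ler_wpM2l//; last by rewrite li; exact: H.
by rewrite C0 prodr_ge0// => j _; exact: f0.
Qed.

Lemma prod_stack_mart :
  (forall i g, (i < n)%N -> path G v0 g -> last v0 g = vtx i ->
     \sum_(w <- nbr (vtx i)) q g w * f i (rcons (stack g (vtx i)) w) =
     f i (stack g (vtx i))) ->
  forall g, path G v0 g -> \sum_(u <- nbr (last v0 g)) q g u * Phi (rcons g u) = Phi g.
Proof.
move=> H g pg; case: (prod_stack_cases g) => [E|[i [ilt li] [C [EC C0] E]]].
  by under eq_bigr do rewrite E; rewrite -mulr_suml q_sum// mul1r.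
under eq_bigr do rewrite E mulrCA.
by rewrite -mulr_sumr EC li H.
Qed.

End Product.

(** * Mean payoffs under the reinforced walk *)

Section PayoffLRRW.
Variables (R : realType) (V : choiceType) (G : graph V).
Hypothesis lf : locally_finite G.
Variables (v0 : V) (a : R) (K : nat).
Hypothesis a_ge4 : 4 <= a.
Hypothesis deg_gt0 : forall v, (0 < degree G v)%N.
Hypothesis degK : forall v, (degree G v <= K)%N.

Notation nbr := (neighbors G).
Notation stp := (step_prob G v0 a).

Let a_gt0 : 0 < a. Proof. exact: lt_le_trans a_ge4. Qed.

(** [a * kappa = 4 K + 1] pays for the constants that arise when the total weight at a vertex, at
    most [K a + 2 k + 1] after [k] exits, is multiplied by the slope [4 / a]. *)
Definition kappa : R := (4 * K%:R + 1) / a.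

(** The one-step inequality that makes the Bellman function with slope [4 / a] a supermartingale:
    the next exit pays if it lies in [T], and unless it is [u] the stack goes on with one more
    entry. *)
Definition payoff_drift (A : R) (v u : V) (T : pred V) :=
  forall g, path G v0 g -> last v0 g = v ->
  \sum_(w <- nbr v) stp g w * (T w)%:R +
    (1 - stp g u) * (A + 4 / a * (exits v0 g v).+1%:R) <=
  A + 4 / a * (exits v0 g v)%:R.

(** Everything is multiplied by the total weight [D]. The slope gives
    [a * (4 / a) * (k + 1) = 4 k + 4], whose part [4 k] absorbs the [2 k] in [D * (4 / a)] and
    another [2 k] in the bound [x] on the weight of the target. *)
Lemma drift_scaled (A x D k pu pt : R) : 0 <= k -> 0 < D -> D <= K%:R * a + 2 * k + 1 ->
  0 <= A ->
  a <= pu * D -> pt * D <= x -> x + 4 * K%:R + 2 * k + 1 <= a * A + 4 * k + 4 ->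
  pt + (1 - pu) * (A + 4 / a * (k + 1)) <= A + 4 / a * k.
Proof.
move=> k0 D0 DK A0 hu ht hx; rewrite -(ler_pM2r D0).
set B := 4 / a; have B0 : 0 <= B by rewrite divr_ge0// ltW.
have aB : a * B = 4 by rewrite /B mulrC divfK// gt_eqF.
have B1 : B <= 1 by rewrite /B ler_pdivrMr// mul1r.
have DB : D * B <= 4 * K%:R + 2 * k + 1.
  have : D * B <= (K%:R * a + 2 * k + 1) * B by rewrite ler_wpM2r.
  have -> : (K%:R * a + 2 * k + 1) * B = 4 * K%:R + (2 * k * B + B).
    by rewrite -aB; ring.
  have : 2 * k * B <= 2 * k by rewrite ler_piMr// mulr_ge0.
  lra.
have h : a * (A + B * (k + 1)) <= pu * D * (A + B * (k + 1)).
  by rewrite ler_wpM2r// addr_ge0// mulr_ge0// addr_ge0.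
have e1 : (pt + (1 - pu) * (A + B * (k + 1))) * D =
  pt * D + (A + B * k) * D + D * B - pu * D * (A + B * (k + 1)) by ring.
have e2 : a * (A + B * (k + 1)) = a * A + (a * B) * k + a * B by ring.
rewrite e1; rewrite e2 aB in h; lra.
Qed.

Lemma drift_pred1 v u t : u \in nbr v -> t \in nbr v ->
  payoff_drift (1 + kappa) v u (pred1 t).
Proof.
move=> uv tv g pg lv.
have -> : \sum_(w <- nbr v) stp g w * (pred1 t w)%:R = stp g t.
  rewrite (bigD1_seq t) ?fset_uniq//= eqxx mulr1 big1 ?addr0// => w /negPf ->.
  by rewrite mulr0.
rewrite -[(exits _ _ _).+1%:R]natr1; have D1 := Wv_last_le lf a_gt0 degK pg.
have D2 := stp_lower a_gt0 deg_gt0 u pg.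
have D0 := Wv_gt0 v0 a_gt0 deg_gt0 g (last v0 g).
have tl : t \in nbr (last v0 g) by rewrite lv.
have D3 := stp_upper lf a_gt0 deg_gt0 pg tl.
rewrite !lv in D0 D1 D2 D3.
apply: (drift_scaled _ D0 D1 _ D2 D3) => //.
  by rewrite addr_ge0// divr_ge0 ?(ltW a_gt0)// addr_ge0// mulr_ge0.
rewrite mulrDr mulr1 /kappa mulrCA divff ?gt_eqF//.
by set k := (exits _ _ _)%:R; set K' := K%:R; lra.
Qed.

Lemma drift_predT v u : u \in nbr v ->
  payoff_drift (K%:R + kappa) v u predT.
Proof.
move=> uv g pg lv.
have -> : \sum_(w <- nbr v) stp g w * (predT w)%:R = 1.
  by under eq_bigr do rewrite mulr1; rewrite -lv sum_stp.
rewrite -[(exits _ _ _).+1%:R]natr1; have D1 := Wv_last_le lf a_gt0 degK pg.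
have D2 := stp_lower a_gt0 deg_gt0 u pg.
have D0 := Wv_gt0 v0 a_gt0 deg_gt0 g (last v0 g).
rewrite !lv in D0 D1 D2.
have D3 := D1; rewrite -[X in X <= _]mul1r in D3.
apply: (drift_scaled _ D0 D1 _ D2 D3) => //.
  by rewrite addr_ge0// divr_ge0 ?(ltW a_gt0)// addr_ge0// mulr_ge0.
rewrite mulrDr /kappa [a * (_ / a)]mulrCA divff ?gt_eqF//.
by set k := (exits _ _ _)%:R; set K' := K%:R; lra.
Qed.

Lemma lrrw_payoff_le (n N : nat) (vtx u : nat -> V) (T : nat -> pred V) (A : nat -> R) :
  (forall i j, (i < n)%N -> (j < n)%N -> vtx i = vtx j -> i = j) ->
  (forall i, (i < n)%N -> [/\ u i \in nbr (vtx i), 0 <= A i &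
     payoff_drift (A i) (vtx i) (u i) (T i)]) ->
  \sum_(c <- pths G N v0) kw stp [::] c *
    \prod_(i < n) payoff R (T i) (u i) (stack v0 c (vtx i)) <= \prod_(i < n) A i.
Proof.
move=> inj H.
pose f i s := if (i < n)%N then payoff_bound (T i) (u i) (A i) (4 / a) 0 s else 0.
have B0 : 0 <= 4 / a by rewrite divr_ge0// ltW.
have f0 i s : (i < n)%N -> 0 <= f i s.
  by move=> ilt; rewrite /f ilt payoff_bound_ge0//; case: (H _ ilt).
apply: (@le_trans _ _ (\sum_(c <- pths G N v0) kw stp [::] c *
    \prod_(i < n) f i (stack v0 c (vtx i)))).
  apply: ler_sum => c _; rewrite ler_wpM2l ?kw_ge0//; first by move=> *; exact: stp_ge0.
  apply: ler_prod => i _; rewrite payoff_ge0 /= /f ltn_ord payoff_le_bound//.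
  by case: (H _ (ltn_ord i)).
have -> : \prod_(i < n) A i = \prod_(i < n) f i (stack v0 [::] (vtx i)).
  by apply: eq_bigr => i _; rewrite /f ltn_ord /= mulr0 addr0.
apply: (@sum_pths_superm _ _ _ lf v0 stp (fun g => \prod_(i < n) f i (stack v0 g (vtx i)))).
- by move=> *; exact: stp_ge0.
- by move=> g _; apply: prodr_ge0 => i _; exact: f0.
apply: prod_stack_superm => //.
  by move=> g _; exact: sum_stp.
move=> i g ilt pg li; rewrite /f ilt; have [ui Ai dr] := H _ ilt.
apply: payoff_bound_step; rewrite ?fset_uniq//.
  by rewrite -li sum_stp.
by rewrite add0n size_stack; exact: dr.
Qed.

End PayoffLRRW.

(** * Mean payoffs under a Markov chain *)

Section PayoffMarkov.
Variables (R : realType) (V : choiceType) (G : graph V).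
Hypothesis lf : locally_finite G.
Variables (v0 : V) (p : V -> V -> R).

Notation nbr := (neighbors G).

Hypothesis p_ge0 : forall x y, 0 <= p x y.
Hypothesis p_sum : forall x, \sum_(y <- nbr x) p x y = 1.

Definition markov (g : seq V) (u : V) : R := p (last v0 g) u.

Definition hit_prob (T : pred V) (x : V) : R := \sum_(w <- nbr x) p x w * (T w)%:R.

Lemma p_le1 x y : y \in nbr x -> p x y <= 1.
Proof.
move=> yx; rewrite -(p_sum x) (bigD1_seq y) ?fset_uniq//= lerDl.
exact: sumr_ge0.
Qed.

Lemma hit_prob_ge0 T x : 0 <= hit_prob T x.
Proof. by apply: sumr_ge0 => w _; rewrite mulr_ge0. Qed.

Lemma hit_prob_le1 T x : hit_prob T x <= 1.
Proof.
rewrite -(p_sum x); apply: ler_sum => w _; rewrite ler_piMr//.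
by case: (T w).
Qed.

Lemma sum_markov n g : \sum_(c <- pths G n (last v0 g)) kw markov g c = 1.
Proof.
elim: n g => [|n IH] g; first by rewrite big_pths0.
rewrite big_pthsS -(p_sum (last v0 g)); apply: eq_bigr => u _ /=.
rewrite -mulr_sumr (_ : \sum_(_ <- _) _ = 1) ?mulr1//.
by have := IH (rcons g u); rewrite last_rcons.
Qed.

Lemma markov_payoff (n N H : nat) (vtx u : nat -> V) (T : nat -> pred V) :
  (forall i j, (i < n)%N -> (j < n)%N -> vtx i = vtx j -> i = j) ->
  (forall i, (i < n)%N -> u i \in nbr (vtx i)) ->
  \prod_(i < n) mean_payoff (hit_prob (T i) (vtx i)) (p (vtx i) (u i)) H =
  \sum_(c <- pths G N v0) kw markov [::] c * \prod_(i < n)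
    cond_payoff (T i) (u i) (hit_prob (T i) (vtx i)) (p (vtx i) (u i)) H (stack v0 c (vtx i)).
Proof.
move=> inj ui.
pose f i := cond_payoff (T i) (u i) (hit_prob (T i) (vtx i)) (p (vtx i) (u i)) H.
rewrite -[RHS]/(\sum_(c <- _) kw markov [::] c * \prod_(i < n) f i (stack v0 c (vtx i))).
rewrite (@sum_pths_mart _ _ _ lf v0 markov (fun c => \prod_(i < n) f i (stack v0 c (vtx i)))).
  by apply: eq_bigr => i _; rewrite /f cond_payoff_nil.
move=> g; apply: prod_stack_mart => //.
move=> i {}g ilt pg li; rewrite /f /markov li.
by apply: cond_payoff_step; rewrite ?fset_uniq// ui.
Qed.

(** A stack with at least [H] entries contains the whole horizon, so its payoff dominates the
    conditional mean, which is always at most [H]. The minimum keeps the functional within [H ^ n],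
    as a test for the approximate mixture must be bounded. *)
Lemma markov_payoff_le (n N H : nat) (vtx u : nat -> V) (T : nat -> pred V) :
  (forall i j, (i < n)%N -> (j < n)%N -> vtx i = vtx j -> i = j) ->
  (forall i, (i < n)%N -> u i \in nbr (vtx i)) ->
  \prod_(i < n) mean_payoff (hit_prob (T i) (vtx i)) (p (vtx i) (u i)) H <=
  \sum_(c <- pths G N v0) kw markov [::] c *
    (if [forall i : 'I_n, (H <= exits v0 c (vtx i))%N]
     then Num.min (\prod_(i < n) payoff R (T i) (u i) (stack v0 c (vtx i))) (H%:R ^+ n)
     else H%:R ^+ n).
Proof.
move=> inj ui; rewrite (@markov_payoff n N H vtx u T)//.
apply: ler_sum => c _; rewrite ler_wpM2l ?kw_ge0//.
  by move=> *; exact: p_ge0.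
have le2 : \prod_(i < n) cond_payoff (T i) (u i) (hit_prob (T i) (vtx i))
   (p (vtx i) (u i)) H (stack v0 c (vtx i)) <= H%:R ^+ n.
  rewrite -[in leRHS](card_ord n) -prodr_const; apply: ler_prod => i _.
  by rewrite cond_payoff_ge0 ?hit_prob_ge0 ?p_ge0 ?p_le1 ?ui//= cond_payoff_leH
    ?hit_prob_ge0 ?hit_prob_le1 ?p_ge0 ?p_le1 ?ui.
case: forallP => // h; rewrite le_min le2 andbT.
apply: ler_prod => i _.
rewrite cond_payoff_ge0 ?hit_prob_ge0 ?p_ge0 ?p_le1 ?ui//=.
by apply: cond_payoff_le; rewrite size_stack.
Qed.

End PayoffMarkov.

(** * Balls, electrical networks and Thomson's principle *)

Section Balls.
Variables (V : choiceType) (G : graph V).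
Hypothesis lf : locally_finite G.
Variable v0 : V.

Notation nbr := (neighbors G).

Fixpoint ball (n : nat) : {fset V} :=
  if n is n'.+1 then ball n' `|` \bigcup_(x <- ball n') nbr x else [fset v0].

Lemma ballS n x : (x \in ball n.+1) = (x \in ball n) || has (fun y => G y x) (ball n).
Proof.
rewrite /= inE; congr (_ || _); apply/bigfcupP/hasP => [[y]|[y yb yx]].
  by rewrite andbT in_nbr// => yb yx; exists y.
by exists y; rewrite ?yb// in_nbr.
Qed.

Lemma ball_sub m n : (m <= n)%N -> {subset ball m <= ball n}.
Proof.
move=> /subnK <- x xm; elim: (n - m)%N => [|k IH] //.
by rewrite addSn ballS IH.
Qed.

Lemma ball_center n : v0 \in ball n.
Proof. by apply: (@ball_sub 0) => //; rewrite inE. Qed.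

Lemma ball_nbr n x y : x \in ball n -> G x y -> y \in ball n.+1.
Proof. by move=> xb xy; rewrite ballS; apply/orP; right; apply/hasP; exists x. Qed.

Variable R : realType.

Lemma sum_nbr_ball n x (F : V -> R) : x \in ball n ->
  \sum_(y <- ball n.+1 | G x y) F y = \sum_(y <- nbr x) F y.
Proof.
move=> xb; rewrite -big_filter; apply: perm_big.
apply: uniq_perm; rewrite ?filter_uniq ?fset_uniq// => y.
rewrite mem_filter in_nbr//; case: (boolP (G x y)) => //= xy.
by rewrite (ball_nbr xb).
Qed.

(** Over ordered pairs: each edge occurs twice, hence the factors [2^-1] in energies. *)
Definition edge_sum (N : nat) (F : V -> V -> R) : R :=
  \sum_(x <- ball N) \sum_(y <- ball N | G x y) F x y.

Lemma esum2_sym N F : edge_sum N F = edge_sum N (fun x y => F y x).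
Proof.
rewrite /edge_sum; under eq_bigr do rewrite big_mkcond.
rewrite exchange_big /=; apply: eq_bigr => x _; rewrite [RHS]big_mkcond.
by apply: eq_bigr => y _; rewrite adj_sym.
Qed.

Lemma esum2D N F F' : edge_sum N (fun x y => F x y + F' x y) = edge_sum N F + edge_sum N F'.
Proof. by rewrite -big_split; apply: eq_bigr => x _; rewrite big_split. Qed.

Lemma esum2Z N (k : R) F : edge_sum N (fun x y => k * F x y) = k * edge_sum N F.
Proof. by rewrite mulr_sumr; apply: eq_bigr => x _; rewrite mulr_sumr. Qed.

Lemma esum2_le N F F' : (forall x y, x \in ball N -> y \in ball N -> G x y -> F x y <= F' x y) ->
  edge_sum N F <= edge_sum N F'.
Proof.
move=> H; rewrite /edge_sum big_seq [leRHS]big_seq; apply: ler_sum => x xb.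
rewrite big_seq_cond [leRHS]big_seq_cond; apply: ler_sum => y /andP[yb xy].
exact: H.
Qed.

Lemma esum2_ge0 N F : (forall x y, 0 <= F x y) -> 0 <= edge_sum N F.
Proof. by move=> F0; apply: sumr_ge0 => x _; apply: sumr_ge0 => y _. Qed.

Lemma eq_esum2 N F F' : (forall x y, F x y = F' x y) -> edge_sum N F = edge_sum N F'.
Proof. by move=> E; apply: eq_bigr => x _; apply: eq_bigr => y _. Qed.

Lemma esum2_parts N (w : V -> V -> R) (f g : V -> R) : (forall x y, w x y = w y x) ->
  edge_sum N (fun x y => w x y * f x * (g x - g y)) =
  2^-1 * edge_sum N (fun x y => w x y * (f x - f y) * (g x - g y)).
Proof.
move=> ws; set E := edge_sum N _.
have {1}-> : E = 2^-1 * (E + E) by field.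
congr (_ * _); rewrite {2}/E esum2_sym -esum2D; apply: eq_esum2 => x y.
by rewrite (ws y x); ring.
Qed.

(* A unit flow from v0 which is a gradient, supported in the ball of radius N. *)
Definition unit_potential (N : nat) (u : V -> R) :=
  (forall x, x \notin ball N -> u x = 0) /\
  (forall x, x \in ball N -> \sum_(y <- nbr x) (u x - u y) = (x == v0)%:R).

Section Network.
Variable W : V -> V -> R.
Hypothesis W_gt0 : forall x y, 0 < W x y.
Hypothesis W_sym : forall x y, W x y = W y x.
Hypothesis deg_gt0 : forall v, (0 < degree G v)%N.

Definition vw (x : V) : R := \sum_(y <- nbr x) W x y.
Definition pw (x y : V) : R := W x y / vw x.

Lemma vw_gt0 x : 0 < vw x.
Proof.
have := deg_gt0 x; rewrite /vw /degree.
case: (enum_fset (nbr x)) => [//|y s _]; rewrite big_cons.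
by rewrite ltr_pwDl//; apply: sumr_ge0 => z _; exact/ltW.
Qed.

Lemma pw_ge0 x y : 0 <= pw x y.
Proof. by rewrite divr_ge0// ltW// vw_gt0. Qed.

Lemma pw_sum x : \sum_(y <- nbr x) pw x y = 1.
Proof. by rewrite -mulr_suml divff// gt_eqF// vw_gt0. Qed.

Fixpoint hit (n : nat) (x : V) : R :=
  if x == v0 then 1 else
  if n is n'.+1 then \sum_(y <- nbr x) pw x y * hit n' y else 0.

Definition ret (n : nat) : R := \sum_(y <- nbr v0) pw v0 y * hit n y.

Lemma hitv0 n : hit n v0 = 1.
Proof. by case: n => [|n] /=; rewrite eqxx. Qed.

Lemma hit_ge0 n x : 0 <= hit n x.
Proof.
elim: n x => [|n IH] x /=; case: ifP => // _.
by apply: sumr_ge0 => y _; rewrite mulr_ge0// pw_ge0.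
Qed.

Lemma hit_mono n x : hit n x <= hit n.+1 x.
Proof.
elim: n x => [|n IH] x.
  by rewrite [hit 0 x]/=; case: eqP => [->|_]; rewrite ?hitv0 ?hit_ge0.
rewrite /=; case: ifP => // _; apply: ler_sum => y _.
by rewrite ler_wpM2l ?pw_ge0//; exact: IH.
Qed.

Lemma hit_out n x : x \notin ball n -> hit n x = 0.
Proof.
elim: n x => [|n IH] x; first by rewrite inE /= => /negPf ->.
move=> xb /=; rewrite ifF; last by apply: contraNF xb => /eqP ->; exact: ball_center.
rewrite big_seq big1// => y; rewrite in_nbr// => xy.
rewrite IH ?mulr0//; apply: contraNN xb => yb; apply: (ball_nbr yb).
by rewrite adj_sym.
Qed.

(** By parts the energy is the sum of [hit n] against its Laplacian. Away from [v0] the terms are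
    nonpositive, since averaging [hit n] over the neighbours gives [hit n.+1], which is no smaller;
    the term at [v0] is the right-hand side. *)
Lemma hit_energy n N : (n <= N)%N ->
  2^-1 * edge_sum N.+1 (fun x y => W x y * (hit n x - hit n y) ^+ 2) <= vw v0 * (1 - ret n).
Proof.
move=> nN.
under eq_esum2 do rewrite expr2 mulrA.
rewrite -esum2_parts// /edge_sum.
have -> : vw v0 * (1 - ret n) =
   \sum_(x <- ball N.+1) (if x == v0 then vw v0 * (1 - ret n) else 0).
  rewrite (bigD1_seq v0) ?fset_uniq ?ball_center//= eqxx big1 ?addr0// => x.
  by move=> /negPf ->.
apply: ler_sum => x _.
have [xb|xb] := boolP (x \in ball N); last first.
  have xb' : x \notin ball n by apply: contraNN xb; exact: ball_sub.
  rewrite big1; last by move=> y _; rewrite hit_out// mulr0 mul0r.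
  by case: eqP xb => // ->; rewrite ball_center.
have -> : \sum_(y <- ball N.+1 | G x y) W x y * hit n x * (hit n x - hit n y) =
    hit n x * (vw x * (hit n x - \sum_(y <- nbr x) pw x y * hit n y)).
  rewrite sum_nbr_ball//.
  transitivity (hit n x * (\sum_(y <- nbr x) (W x y * hit n x - W x y * hit n y))).
    by rewrite mulr_sumr; apply: eq_bigr => y _; ring.
  congr (_ * _); rewrite sumrB mulrBr -mulr_suml; congr (_ - _).
  rewrite mulr_sumr; apply: eq_bigr => y _; rewrite mulrA; congr (_ * _).
  by rewrite /pw mulrC divfK// gt_eqF// vw_gt0.
case: eqP => [->|/eqP xv]; first by rewrite hitv0 mul1r.
rewrite mulr_ge0_le0 ?hit_ge0// mulr_ge0_le0 ?(ltW (vw_gt0 x))// subr_le0.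
by have := hit_mono n x; rewrite [X in _ <= X]/= (negPf xv).
Qed.

(** The energy of the gradient flow of [u] through the resistances [1 / W], times the total
    conductance at [v0]: this makes it invariant under scaling of [W], and its inverse bounds an
    escape probability from below. *)
Definition flow_energy (N : nat) (u : V -> R) : R :=
  2^-1 * edge_sum N.+1 (fun x y => (u x - u y) ^+ 2 * (vw v0 / W x y)).

Lemma ret_ge0 n : 0 <= ret n.
Proof. by apply: sumr_ge0 => y _; rewrite mulr_ge0 ?hit_ge0// pw_ge0. Qed.

(* Thomson's principle, by testing the flow against the hitting function. *)
Lemma flow_energy_ret N u n : unit_potential N u -> (n <= N)%N ->
  1 <= flow_energy N u /\ ret n <= 1 - (flow_energy N u)^-1.
Proof.
move=> [u0 uL] nN.
(* Summation by parts puts the Laplacian on [u], where it is the unit mass at [v0]; and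
   [hit n v0 = 1]. *)
have E1 : 1 = 2^-1 * edge_sum N.+1 (fun x y => (hit n x - hit n y) * (u x - u y)).
  under [X in _ * X]eq_esum2 do rewrite -[_ - _ in X in X * _]mul1r.
  rewrite -(@esum2_parts N.+1 (fun _ _ => 1))//.
  rewrite /edge_sum (bigD1_seq v0) ?fset_uniq ?ball_center//.
  rewrite [X in _ = _ + X]big1_seq ?addr0 => [|x /andP[xv _]].
    under eq_bigr do rewrite hitv0 !mul1r.
    by rewrite sum_nbr_ball ?ball_center// uL ?ball_center ?eqxx.
  have [xb|xb] := boolP (x \in ball N); last first.
    rewrite big1// => y _; rewrite hit_out ?mulr0 ?mul0r//.
    by apply: contraNN xb; exact: ball_sub.
  under eq_bigr do rewrite mul1r.
  by rewrite -mulr_sumr sum_nbr_ball// uL// (negPf xv) mulr0.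
have H := hit_energy nN.
set Z := flow_energy N u; set e := 1 - ret n in H.
have W0 := vw_gt0 v0.
(* Young's inequality with a free parameter in place of Cauchy-Schwarz: [t = 1] yields [1 <= Z], and
   [t = Z^-1] the escape bound. *)
have key (t : R) : 0 < t -> 2 <= t * Z + e / t.
  move=> t0.
  have : 2^-1 * edge_sum N.+1 (fun x y => (hit n x - hit n y) * (u x - u y)) <=
    2^-1 * (t / 2 * edge_sum N.+1 (fun x y => (u x - u y) ^+ 2 * (vw v0 / W x y)) +
    (2 * t * vw v0)^-1 * edge_sum N.+1 (fun x y => W x y * (hit n x - hit n y) ^+ 2)).
    rewrite ler_pM2l// -!esum2Z -esum2D; apply: esum2_le => x y _ _ _.
    set h := hit n x - hit n y; set th := u x - u y.
    have Wp := W_gt0 x y; rewrite -subr_ge0.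
    rewrite (_ : _ - _ = (t * vw v0 * th - W x y * h) ^+ 2 / (2 * t * vw v0 * W x y)).
      by rewrite divr_ge0 ?sqr_ge0// !mulr_ge0// ltW.
    by field; rewrite !gt_eqF.
  rewrite -E1 mulrDr mulrCA -/(flow_energy N u) -/Z.
  rewrite (mulrCA 2^-1).
  have : (2 * t * vw v0)^-1 * (2^-1 * edge_sum N.+1 (fun x y => W x y * (hit n x - hit n y) ^+ 2))
     <= (2 * t * vw v0)^-1 * (vw v0 * e).
    by rewrite ler_pM2l// invr_gt0 !mulr_gt0.
  rewrite (_ : (2 * t * vw v0)^-1 * (vw v0 * e) = 2^-1 * (e / t)); last by field; rewrite !gt_eqF.
  by rewrite -[t / 2]mulrC -mulrA; lra.
have e1 : e <= 1 by rewrite gerBl ret_ge0.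
have Z1 : 1 <= Z by have := key 1 ltr01; rewrite divr1 mul1r; lra.
split=> //; have Z0 : 0 < Z by exact: lt_le_trans Z1.
have := key Z^-1; rewrite invr_gt0 mulVf ?gt_eqF// invrK => /(_ Z0) h.
have h1 : 1 <= e * Z by lra.
have : Z^-1 <= e by rewrite -[leLHS]mul1r ler_pdivrMr.
by rewrite /e; lra.
Qed.

Fixpoint mw (x : V) (c : seq V) : R :=
  if c is u :: c' then pw x u * mw u c' else 1.

Lemma kw_markov g c : kw (markov v0 pw) g c = mw (last v0 g) c.
Proof. by elim: c g => [|u c IH] g //=; rewrite IH last_rcons. Qed.

(** Induction over the first step: from [v0] every return costs a factor [rho], while from another
    vertex [v0] has to be met once at the price [hit N x]. The two cases feed each other. *)
Lemma many_returns N (rho : R) (m : nat) x : 0 <= rho ->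
  (forall n, (n <= N)%N -> ret n <= rho) ->
  \sum_(c <- pths G N x | (m.+1 <= count_mem v0 c)%N) mw x c <=
  if x == v0 then rho ^+ m.+1 else rho ^+ m * hit N x.
Proof.
move=> r0; elim: N m x => [|N IH] m x Hr.
  rewrite big_mkcond big_pths0 /=.
  by case: ifP => _; rewrite ?exprn_ge0// mulr_ge0 ?exprn_ge0//; case: ifP.
have {IH}IH' := fun m x => IH m x (fun n h => Hr n (leqW h)).
rewrite big_mkcond big_pthsS.
have step : \sum_(u <- nbr x) \sum_(c <- pths G N u)
   (if (m.+1 <= count_mem v0 (u :: c))%N then mw x (u :: c) else 0) <=
   \sum_(u <- nbr x) pw x u * (rho ^+ m * hit N u).
  apply: ler_sum => u _.
  have -> : \sum_(c <- pths G N u) (if (m.+1 <= count_mem v0 (u :: c))%N then mw x (u :: c) else 0)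
    = pw x u * \sum_(c <- pths G N u | (m.+1 <= count_mem v0 (u :: c))%N) mw u c.
    rewrite mulr_sumr [RHS]big_mkcond; apply: eq_bigr => c _.
    by case: ifP.
  rewrite ler_wpM2l ?pw_ge0//; have [->|uv] /= := eqVneq u v0.
    under eq_bigl do rewrite eqxx add1n ltnS.
    rewrite hitv0 mulr1; case: m => [|m]; last by have := IH' m v0; rewrite eqxx.
    rewrite expr0; under eq_bigl do rewrite leq0n.
    have <- := @sum_markov _ _ _ v0 pw pw_sum N [::].
    by rewrite le_eqVlt; apply/orP; left; apply/eqP; apply: eq_bigr => c _; rewrite kw_markov.
  by under eq_bigl do rewrite (negPf uv) add0n; have := IH' m u; rewrite (negPf uv).
apply: le_trans step _.
have -> : \sum_(u <- nbr x) pw x u * (rho ^+ m * hit N u) =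
   rho ^+ m * \sum_(u <- nbr x) pw x u * hit N u.
  by rewrite mulr_sumr; apply: eq_bigr => u _; rewrite mulrCA.
case: eqP => [->|/eqP xv]; last by rewrite /= (negPf xv).
by rewrite exprSr ler_wpM2l ?exprn_ge0// Hr.
Qed.

Lemma returns_le N u m : unit_potential N u ->
  \sum_(c <- pths G N v0 | (m <= count_mem v0 c)%N) kw (markov v0 pw) [::] c <=
  (1 - (flow_energy N u)^-1) ^+ m.
Proof.
move=> up; under eq_bigr do rewrite kw_markov.
case: m => [|m].
  rewrite expr0 -(@sum_markov _ _ _ v0 pw pw_sum N [::]).
  under [leRHS]eq_bigr do rewrite kw_markov.
  by under eq_bigl do rewrite leq0n.
have [Z1 _] := flow_energy_ret up (leqnn N).
have Z0 : 0 < flow_energy N u by exact: lt_le_trans Z1.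
have := @many_returns N (1 - (flow_energy N u)^-1) m v0; rewrite eqxx; apply.
- by rewrite subr_ge0 invf_le1.
- by move=> n nN; case: (flow_energy_ret up nN).
Qed.

End Network.
End Balls.

(** * Spectral gap and decay of the Dirichlet potential *)

Section Spectral.
Variables (R : realType) (V : choiceType) (G : graph V).
Hypothesis lf : locally_finite G.
Variable v0 : V.

Notation nbr := (neighbors G).
Notation ball := (ball G v0).
Notation esum2 := (edge_sum G v0).

Variables (K : nat) (c : R).
Hypothesis K_gt0 : (0 < K)%N.
Hypothesis degK : forall v, (degree G v <= K)%N.
Hypothesis c_gt0 : 0 < c.

Definition edge_expansion := forall A : {fset V},
  c * #|` A|%:R <= \sum_(x <- A) \sum_(y <- nbr x) (y \notin A)%:R :> R.

Hypothesis expand : edge_expansion.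

(** Induction on the size of [A]: subtracting the minimum [t] of [F] over [A] removes a minimizing
    vertex from the support and lowers the right-hand side by [t] times the number of edges leaving
    [A], which [expand] bounds from below. *)
Lemma coarea (F : V -> R) (A : {fset V}) : (forall x, 0 <= F x) ->
  (forall x, x \notin A -> F x = 0) ->
  c * \sum_(x <- A) F x <= \sum_(x <- A) \sum_(y <- nbr x) Num.max (F x - F y) 0.
Proof.
move: {2}#|` A| (erefl #|` A|) => n.
elim: n F A => [|n IH] F A.
  by move=> /cardfs0_eq -> _ _; rewrite !big_seq_fset0 mulr0.
move=> An F0 FA.
have [x0 x0A] : exists x0, x0 \in A.
  by apply/fset0Pn; rewrite -cardfs_eq0 An.
pose xm := [arg min_(x < [` x0A]) F (val x)]%O.
have xmA : val xm \in A by exact: fsvalP.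
pose t := F (val xm).
have xmin x : x \in A -> t <= F x.
  move=> xA; rewrite /t /xm; case: arg_minP => // i _ /(_ [` xA] isT).
  by [].
pose F' x := if x \in A then F x - t else 0.
pose A' := A `\ val xm.
have A'n : #|` A'| = n.
  by have := cardfsD1 (val xm) A; rewrite An xmA add1n => -[].
have F'0 x : 0 <= F' x by rewrite /F'; case: ifP => // /xmin; rewrite subr_ge0.
have F'A x : x \notin A' -> F' x = 0.
  rewrite !inE negb_and negbK /F'; case: eqP => [->|_ /= /negPf ->//].
  by rewrite subrr; case: ifP.
have AE (g : V -> R) : \sum_(x <- A) g x = g (val xm) + \sum_(x <- A') g x.
  by rewrite (big_fsetD1 (val xm)) ?xmA.
have {}IH := IH F' A' A'n F'0 F'A.
have -> : \sum_(x <- A) F x = \sum_(x <- A') F' x + t * #|` A|%:R.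
  have -> : \sum_(x <- A) F x = \sum_(x <- A) F' x + t * #|` A|%:R.
    have -> : t * #|` A|%:R = \sum_(x <- A) t.
      by rewrite big_const_seq count_predT iter_addr_0 mulr_natr.
    rewrite -big_split /= big_seq [RHS]big_seq; apply: eq_bigr => x xA.
    by rewrite /F' xA subrK.
  by rewrite AE F'A ?add0r// !inE eqxx.
have t0 : 0 <= t by exact: F0.
apply: (@le_trans _ _ (\sum_(x <- A) \sum_(y <- nbr x) (Num.max (F' x - F' y) 0 + t * (y \notin A)%:R))); last first.
  rewrite big_seq [leRHS]big_seq; apply: ler_sum => x xA; apply: ler_sum => y _.
  rewrite /F' xA; case: (boolP (y \in A)) => yA /=.
    by rewrite mulr0 addr0 (_ : F x - t - (F y - t) = F x - F y)//; ring.
  rewrite mulr1 subr0 (FA y yA) subr0 max_l ?subr_ge0 ?xmin// subrK.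
  by rewrite max_l.
under [leRHS]eq_bigr do rewrite big_split /=.
rewrite [leRHS]big_split /= mulrDr; apply: lerD.
  apply: le_trans IH _; rewrite [leRHS]AE lerDr.
  by apply: sumr_ge0 => y _; rewrite le_max lexx orbT.
under [leRHS]eq_bigr do rewrite -mulr_sumr.
by rewrite -mulr_sumr mulrCA ler_wpM2l.
Qed.

Lemma esum2_left N (F : V -> R) : (forall x, 0 <= F x) -> (forall x, x \notin ball N -> F x = 0) ->
  esum2 N.+1 (fun x _ => F x) <= K%:R * \sum_(x <- ball N) F x.
Proof.
move=> F0 FN.
have -> : \sum_(x <- ball N) F x = \sum_(x <- ball N.+1) (if x \in ball N then F x else 0).
  rewrite -big_mkcond -big_filter -[RHS]big_filter; apply: perm_big.
  apply: uniq_perm; rewrite ?filter_uniq ?fset_uniq// => x.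
  rewrite !mem_filter /=; case: (boolP (x \in ball N)) => // xN.
  by rewrite (ball_sub _ (leqnSn N)).
rewrite mulr_sumr /edge_sum; apply: ler_sum => x _.
case: ifP => xN; last first.
  by rewrite mulr0 big1// => y _; rewrite FN// xN.
rewrite sum_nbr_ball// big_const_seq count_predT iter_addr_0 -[F x *+ _]mulr_natl.
by rewrite ler_wpM2r// ler_nat; exact: degK.
Qed.

(** Cheeger's lower bound for the Dirichlet eigenvalues of the Laplacian on balls. *)
Definition gap : R := c ^+ 2 / (2 * K%:R).

Lemma gap_gt0 : 0 < gap.
Proof. by rewrite divr_gt0 ?exprn_gt0// mulr_gt0// ltr0n. Qed.

(* The co-area formula for [f^2], as in Cheeger's inequality. *)
Lemma poincare N (f : V -> R) : (forall x, x \notin ball N -> f x = 0) ->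
  gap * \sum_(x <- ball N) f x ^+ 2 <= 2^-1 * esum2 N.+1 (fun x y => (f x - f y) ^+ 2).
Proof.
move=> fN.
have f2N x : x \notin ball N -> f x ^+ 2 = 0 by move=> /fN ->; rewrite expr0n.
have H := coarea (F := fun x => f x ^+ 2) (A := ball N) (fun x => sqr_ge0 _) f2N.
set S := \sum_(x <- ball N) f x ^+ 2 in H *.
set E := esum2 _ _.
have K0 : 0 < K%:R :> R by rewrite ltr0n.
(* With this value the second term of the Young inequality [H3] amounts to at most [c * S], half of
   the lower bound [2 * (c * S)]. *)
pose s : R := c / (2 * K%:R).
have s0 : 0 < s by rewrite divr_gt0// mulr_gt0.
have H2 : \sum_(x <- ball N) \sum_(y <- nbr x) Num.max (f x ^+ 2 - f y ^+ 2) 0 <=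
   esum2 N.+1 (fun x y => Num.max (f x ^+ 2 - f y ^+ 2) 0).
  have -> : \sum_(x <- ball N) \sum_(y <- nbr x) Num.max (f x ^+ 2 - f y ^+ 2) 0 =
     \sum_(x <- ball N) \sum_(y <- ball N.+1 | G x y) Num.max (f x ^+ 2 - f y ^+ 2) 0.
    by rewrite big_seq [RHS]big_seq; apply: eq_bigr => x xN; rewrite sum_nbr_ball.
  have P : perm_eq [seq x <- ball N.+1 | x \in ball N] (ball N).
    apply: uniq_perm; rewrite ?filter_uniq ?fset_uniq// => x.
    rewrite mem_filter; case: (boolP (x \in ball N)) => // xN.
    exact: (ball_sub lf (leqnSn N)).
  rewrite /edge_sum [leRHS](bigID (fun x => x \in ball N)).
  rewrite -[X in _ <= X + _]big_filter (perm_big _ P) lerDl.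
  apply: sumr_ge0 => x _; apply: sumr_ge0 => y _.
  by rewrite le_max lexx orbT.
have H3 : 2 * esum2 N.+1 (fun x y => Num.max (f x ^+ 2 - f y ^+ 2) 0) <=
  (2 * s)^-1 * E + s * (2 * esum2 N.+1 (fun x _ => f x ^+ 2)).
  have -> : 2 * esum2 N.+1 (fun x y => Num.max (f x ^+ 2 - f y ^+ 2) 0) =
    esum2 N.+1 (fun x y => Num.max (f x ^+ 2 - f y ^+ 2) 0 + Num.max (f y ^+ 2 - f x ^+ 2) 0).
    by rewrite esum2D -[X in _ + X]esum2_sym; ring.
  have -> : 2 * esum2 N.+1 (fun x _ => f x ^+ 2) = esum2 N.+1 (fun x y => f x ^+ 2 + f y ^+ 2).
    by rewrite esum2D -[X in _ + X]esum2_sym; ring.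
  rewrite -!esum2Z -esum2D; apply: esum2_le => x y _ _ _.
  set p := f x; set r := f y.
  have e : (2 * s)^-1 * (p - r) ^+ 2 + s * (p ^+ 2 + r ^+ 2) =
     (2 * s)^-1 * (p - r - s * (p + r)) ^+ 2 + (p ^+ 2 - r ^+ 2) + s / 2 * (p - r) ^+ 2.
    by field; rewrite gt_eqF.
  have e' : (2 * s)^-1 * (p - r) ^+ 2 + s * (p ^+ 2 + r ^+ 2) =
     (2 * s)^-1 * (p - r + s * (p + r)) ^+ 2 + (r ^+ 2 - p ^+ 2) + s / 2 * (p - r) ^+ 2.
    by field; rewrite gt_eqF.
  have q1 : 0 <= (2 * s)^-1 * (p - r - s * (p + r)) ^+ 2.
    by rewrite mulr_ge0 ?sqr_ge0// invr_ge0 mulr_ge0// ltW.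
  have q2 : 0 <= (2 * s)^-1 * (p - r + s * (p + r)) ^+ 2.
    by rewrite mulr_ge0 ?sqr_ge0// invr_ge0 mulr_ge0// ltW.
  have q3 : 0 <= s / 2 * (p - r) ^+ 2 by rewrite mulr_ge0 ?sqr_ge0// divr_ge0// ltW.
  case: (leP (p ^+ 2) (r ^+ 2)) => pr.
    rewrite max_r ?subr_le0// add0r max_l ?subr_ge0//.
    by rewrite e'; lra.
  rewrite max_l ?subr_ge0 ?(ltW pr)// max_r ?subr_le0 ?(ltW pr)// addr0.
  by rewrite e; lra.
have H4 := esum2_left (N := N) (fun x => sqr_ge0 (f x)) f2N.
rewrite -/S in H4.
have H5 : 2 * (c * S) <= (2 * s)^-1 * E + s * (2 * (K%:R * S)).
  apply: le_trans (le_trans H3 _); first by rewrite ler_pM2l//; exact: le_trans H2.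
  by rewrite lerD2l ler_pM2l// ler_pM2l.
have e1 : s * (2 * (K%:R * S)) = c * S by rewrite /s; field; rewrite gt_eqF.
rewrite e1 in H5.
have e2 : gap * S = s * (c * S) by rewrite /gap /s; field; rewrite gt_eqF.
have e3 : 2^-1 * E = s * ((2 * s)^-1 * E) by field; rewrite gt_eqF.
by rewrite e2 e3 ler_pM2l//; lra.
Qed.

(** A function in the kernel of the Dirichlet Laplacian of the ball has zero energy, hence vanishes
    by the Poincare inequality; so the Laplacian is invertible, and the equation with source [v0] is
    solvable. *)
Lemma unit_potential_exists N : exists u : V -> R, unit_potential G v0 N u.
Proof.
pose s : seq V := ball N; pose n := size s.
have us : uniq s by exact: fset_uniq.
pose A : 'M[R]_n := \matrix_(j, i)
  ((j == i)%:R * (degree G (nth v0 s i))%:R - (G (nth v0 s i) (nth v0 s j))%:R).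
pose fn (v : 'rV[R]_n) (x : V) : R := \sum_(j < n) v 0 j * (x == nth v0 s j)%:R.
have fnE v i : fn v (nth v0 s i%N) = \sum_(j < n) v 0 j * (i == j :> nat)%:R \/ (n <= i)%N.
  case: (ltnP i n) => [ilt|]; [left|by right].
  by apply: eq_bigr => j _; rewrite nth_uniq.
have fnE' v (i : 'I_n) : fn v (nth v0 s i) = v 0 i.
  case: (fnE v i) => [->|]; last by rewrite leqNgt ltn_ord.
  rewrite (bigD1 i)//= eqxx mulr1 big1 ?addr0// => j ji.
  by rewrite [_ == _ :> nat]eq_sym (_ : (j == i :> nat) = false) ?mulr0//; exact: negPf.
have fnN v x : x \notin ball N -> fn v x = 0.
  move=> xN; rewrite /fn big1// => j _; case: eqP => [E|]; rewrite ?mulr0//.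
  by case/negP: xN; rewrite E; apply: mem_nth.
have fnA v (i : 'I_n) : (v *m A) 0 i =
    \sum_(y <- nbr (nth v0 s i)) (fn v (nth v0 s i) - fn v y).
  rewrite mxE sumrB; under eq_bigr do rewrite mxE mulrBr.
  rewrite sumrB; congr (_ - _).
    rewrite (bigD1 i)//= eqxx mul1r big1 ?addr0 => [|j /negPf ->]; last first.
      by rewrite mul0r mulr0.
    by rewrite fnE' big_const_seq count_predT iter_addr_0 mulr_natr.
  rewrite exchange_big /=; apply: eq_bigr => j _; rewrite -mulr_sumr; congr (_ * _).
  rewrite -in_nbr// -(count_uniq_mem _ (fset_uniq _)) -sum1_count natr_sum big_mkcond.
  by apply: eq_bigr => y _ /=; case: (y == _).
have Af : row_free A.
  apply: inj_row_free => v vA.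
  have fA x : x \in ball N -> \sum_(y <- nbr x) (fn v x - fn v y) = 0.
    move=> xN; have ilt : (index x s < n)%N by rewrite index_mem.
    have := fnA v (Ordinal ilt); rewrite vA mxE /= nth_index//.
  have P := poincare (fnN v).
  have E0 : 2^-1 * esum2 N.+1 (fun x y => (fn v x - fn v y) ^+ 2) = 0.
    transitivity (2^-1 * esum2 N.+1 (fun x y => 1 * (fn v x - fn v y) * (fn v x - fn v y))).
      by congr (_ * _); apply: eq_esum2 => x y; rewrite mul1r expr2.
    rewrite -(@esum2_parts _ _ _ _ _ (fun _ _ => 1))// /edge_sum big1// => x _.
    case: (boolP (x \in ball N)) => xN.
      under eq_bigr do rewrite mul1r.
      by rewrite -mulr_sumr sum_nbr_ball// fA// mulr0.
    by rewrite big1// => y _; rewrite fnN// mulr0 mul0r.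
  rewrite E0 in P.
  have S0 : \sum_(x <- ball N) fn v x ^+ 2 = 0.
    apply/eqP; rewrite eq_le sumr_ge0 ?andbT => [|x _]; last exact: sqr_ge0.
    by rewrite -(ler_pM2l gap_gt0) mulr0.
  apply/rowP => i; rewrite mxE -fnE'.
  move/eqP: S0; rewrite psumr_eq0 => [/allP/(_ (nth v0 s i))|x _]; last exact: sqr_ge0.
  by rewrite mem_nth// => /(_ isT); rewrite sqrf_eq0 => /eqP.
pose b : 'rV[R]_n := \row_i (nth v0 s i == v0)%:R.
exists (fn (b *m invmx A)); split; first exact: fnN.
move=> x xN; have ilt : (index x s < n)%N by rewrite index_mem.
have := fnA (b *m invmx A) (Ordinal ilt).
by rewrite mulmxKV -?row_free_unit// mxE /= nth_index.
Qed.

(* The distance to [v0], truncated at [M]. *)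
Definition lvl (M : nat) (x : V) : nat := (\sum_(i < M) (x \notin ball i))%N.

Lemma lvl_adj M x y : G x y -> (lvl M y <= (lvl M x).+1)%N.
Proof.
move=> xy; case: M => [|M]; first by rewrite /lvl big_ord0.
rewrite {1}/lvl big_ord_recl -[(lvl _ x).+1]add1n leq_add ?leq_b1//.
rewrite /lvl big_ord_recr /= -[X in (X <= _)%N]addn0; apply: leq_add => //.
apply: leq_sum => i _.
case: (boolP (x \in ball i)) => [xi|_]; last by rewrite leq_b1.
by rewrite (ball_nbr _ xi xy).
Qed.

Lemma lvl_center M : lvl M v0 = 0%N.
Proof. by rewrite /lvl big1// => i _; rewrite ball_center. Qed.

(* The Combes-Thomas argument: test the equation of [u] against [u] multiplied by
   an exponential weight whose commutator is absorbed by the spectral gap. *)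
Lemma potential_decay N M (kap : R) u : unit_potential G v0 N u -> 0 <= kap ->
  kap <= 1 -> 12 * K%:R * kap <= gap ->
  2^-1 * esum2 N.+1 (fun x y => (1 + kap) ^+ (2 * lvl M x) * (u x - u y) ^+ 2) <= 16 / gap.
Proof.
move=> [uN uL] k0 k1 kg.
pose m x : R := (1 + kap) ^+ lvl M x.
have m0 x : 0 < m x by rewrite exprn_gt0// ltr_pwDl.
have madj x y : G x y -> m y <= (1 + kap) * m x.
  by move=> xy; rewrite /m -exprS ler_weXn2l ?lvl_adj// lerDl.
have om x : (1 + kap) ^+ (2 * lvl M x) = m x ^+ 2 by rewrite mulnC exprM.
under eq_esum2 do rewrite om.
set D := 2^-1 * _; pose S := \sum_(x <- ball N) (m x * u x) ^+ 2.
have S0 : 0 <= S by apply: sumr_ge0 => x _; exact: sqr_ge0.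
have g0 := gap_gt0; have K0 : 0 < K%:R :> R by rewrite ltr0n.
have muN x : x \notin ball N -> m x * u x = 0 by move=> /uN ->; rewrite mulr0.
have mu2N x : x \notin ball N -> (m x * u x) ^+ 2 = 0 by move=> /muN ->; rewrite expr0n.
have SK := esum2_left (N := N) (fun x => sqr_ge0 (m x * u x)) mu2N.
rewrite -/S in SK.
(* The Poincare inequality for [m * u]. Across an edge [m] varies by at most [kap * m y], which
   bounds the error term of the product rule. *)
have H1 : gap * S <= 2 * D + kap ^+ 2 * (K%:R * S).
  apply: le_trans (poincare muN) _.
  apply: (@le_trans _ _ (2^-1 * esum2 N.+1 (fun x y =>
     2 * (m x ^+ 2 * (u x - u y) ^+ 2) + 2 * kap ^+ 2 * (m y * u y) ^+ 2))).
    rewrite ler_pM2l//; apply: esum2_le => x y _ _ xy.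
    have yx : G y x by rewrite adj_sym.
    have h1 := madj _ _ xy; have h2 := madj _ _ yx.
    have d2 : (m x - m y) ^+ 2 <= (kap * m y) ^+ 2.
      rewrite -subr_ge0 subr_sqr mulr_ge0//; first by lra.
      have [le|gt] := leP (m y) (m x).
        have : 0 <= kap * m y by rewrite mulr_ge0// ltW.
        lra.
      have : kap * m x <= kap * m y by rewrite ler_wpM2l// ltW.
      lra.
    have d3 : ((m x - m y) * u y) ^+ 2 <= kap ^+ 2 * (m y * u y) ^+ 2.
      by rewrite exprMn [X in _ <= _ * X]exprMn [leRHS]mulrA ler_wpM2r ?sqr_ge0// -exprMn.
    have e : m x * u x - m y * u y = m x * (u x - u y) + (m x - m y) * u y by ring.
    rewrite e -[m x ^+ 2 * _]exprMn.
    move: d3; set p := m x * _; set r := _ * u y => d3.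
    have : 0 <= (p - r) ^+ 2 by exact: sqr_ge0.
    have -> : (p - r) ^+ 2 = 2 * p ^+ 2 + 2 * r ^+ 2 - (p + r) ^+ 2 by ring.
    lra.
  rewrite esum2D !esum2Z /D; set E1 := esum2 _ _; set E2 := esum2 _ _.
  have E2S : kap ^+ 2 * E2 <= kap ^+ 2 * (K%:R * S).
    by rewrite ler_wpM2l ?sqr_ge0// /E2 esum2_sym.
  by rewrite -[2 * kap ^+ 2 * _]mulrA; lra.
have kk : kap ^+ 2 <= kap by rewrite expr2 ler_piMl.
have KS0 : 0 <= K%:R * S by rewrite mulr_ge0.
have S1 : gap * S <= 4 * D.
  have : kap ^+ 2 * (K%:R * S) <= kap * (K%:R * S) by rewrite ler_wpM2r.
  have : 12 * K%:R * kap * S <= gap * S by rewrite ler_wpM2r.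
  have : 0 <= gap * S by rewrite mulr_ge0// ltW.
  have -> : 12 * K%:R * kap * S = 12 * (kap * (K%:R * S)) by ring.
  lra.
(* The equation is tested with [m ^+ 2 * u]; after symmetrization the commutator is half the sum of
   [(m x ^+ 2 - m y ^+ 2) * u x ^+ 2]. *)
have H2 : D - 2^-1 * (((1 + kap) ^+ 2 - 1) * (K%:R * S)) <= u v0.
  have -> : u v0 = esum2 N.+1 (fun x y => m x ^+ 2 * u x * (u x - u y)).
    rewrite /edge_sum (bigD1_seq v0) ?fset_uniq ?ball_center//.
    rewrite [X in _ = _ + X]big1_seq ?addr0 => [|x /andP[xv _]].
      rewrite -mulr_sumr sum_nbr_ball ?ball_center// uL ?ball_center// eqxx.
      by rewrite /m lvl_center expr0 expr1n mulr1 mul1r.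
    rewrite -mulr_sumr; have [xN|xN] := boolP (x \in ball N); last by rewrite uN// mulr0 mul0r.
    by rewrite sum_nbr_ball// uL// (negPf xv) mulr0.
  have -> : esum2 N.+1 (fun x y => m x ^+ 2 * u x * (u x - u y)) =
     D + 2^-1 * esum2 N.+1 (fun x y => (m x ^+ 2 - m y ^+ 2) * u x ^+ 2).
    transitivity (D + 2^-1 * esum2 N.+1 (fun x y => m x ^+ 2 * u x ^+ 2 + - 1 * (m x ^+ 2 * u y ^+ 2))).
      by rewrite /D -!esum2Z -esum2D; apply: eq_esum2 => x y; field.
    congr (_ + _ * _); rewrite esum2D esum2Z [X in _ + _ * X]esum2_sym -esum2Z -esum2D.
    by apply: eq_esum2 => x y; ring.
  rewrite lerD2l -mulrN ler_pM2l//.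
  apply: (@le_trans _ _ (esum2 N.+1 (fun x y => - ((1 + kap) ^+ 2 - 1) * (m x * u x) ^+ 2))).
    rewrite esum2Z -mulNr ler_wnM2l// oppr_le0 subr_ge0 expr_ge1 ?lerDl//.
    by rewrite addr_ge0.
  apply: esum2_le => x y _ _ xy; rewrite exprMn mulrA ler_wpM2r ?sqr_ge0//.
  have h1 := madj _ _ xy.
  have : m y ^+ 2 <= (1 + kap) ^+ 2 * m x ^+ 2.
    by rewrite -exprMn; apply: lerXn2r => //; rewrite nnegrE ?ltW ?mulr_gt0// ltr_pwDl.
  lra.
have D0 : 0 <= D.
  by rewrite /D mulr_ge0// esum2_ge0// => x y; rewrite mulr_ge0 ?sqr_ge0.
have D1 : D <= 2 * u v0.
  have : ((1 + kap) ^+ 2 - 1) * (K%:R * S) <= 3 * kap * (K%:R * S).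
    rewrite ler_wpM2r//; have -> : (1 + kap) ^+ 2 - 1 = 2 * kap + kap ^+ 2 by ring.
    lra.
  have : 12 * K%:R * kap * S <= gap * S by rewrite ler_wpM2r.
  have -> : 12 * K%:R * kap * S = 4 * (3 * kap * (K%:R * S)) by ring.
  lra.
(* The weight is 1 at [v0], which closes the loop: [gap * u v0 ^+ 2 <= gap * S <= 4 * D <= 8 * u
   v0], hence [u v0 <= 8 / gap] and [D <= 16 / gap]. *)
have u2 : u v0 ^+ 2 <= S.
  rewrite /S (bigD1_seq v0) ?fset_uniq ?ball_center//=.
  by rewrite {1}/m lvl_center expr0 mul1r lerDl; apply: sumr_ge0 => x _; exact: sqr_ge0.
have u0 : 0 <= u v0 by lra.
have u3 : gap * u v0 ^+ 2 <= 8 * u v0.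
  have : gap * u v0 ^+ 2 <= gap * S by rewrite ler_pM2l.
  lra.
rewrite ler_pdivlMr//.
have [u00|un] := eqVneq (u v0) 0; first by rewrite (_ : D = 0) ?mul0r//; lra.
have up : 0 < u v0 by rewrite lt_neqAle eq_sym un.
have u4 : gap * u v0 <= 8 by rewrite -(ler_pM2r up) -mulrA -expr2.
have : gap * D <= gap * (2 * u v0) by rewrite ler_pM2l.
by rewrite mulrC; lra.
Qed.

End Spectral.

(** * From the vertex Cheeger constant to edge expansion *)

Section Cheeger.
Local Open Scope classical_set_scope.
Variables (R : realType) (V : choiceType) (G : graph V).
Hypothesis lf : locally_finite G.

Notation nbr := (neighbors G).

Lemma dist_refl (x : V) : (dist R G x x <= 0)%E.
Proof. by apply: ereal_inf_lbound; exists [::]. Qed.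

Lemma boundary_adj (A : set V) (x : V) : boundary R G A x ->
  ~ A x /\ exists2 y, A y & G x y.
Proof.
rewrite /boundary /= /dist_set => dA.
have xA : ~ A x.
  move=> xA; have : (ereal_inf [set dist R G x y | y in A] <= 0)%E.
    by apply: le_trans (dist_refl x); apply: ereal_inf_lbound; exists x.
  by rewrite dA lee_fin ler10.
split=> //.
have : (ereal_inf [set dist R G x y | y in A] < 2%:E)%E by rewrite dA lte_fin ltr1n.
move=> /ereal_inf_lt[_ [y yA <-]] /ereal_inf_lt[_ [p [px py] <-]].
rewrite lte_fin ltr_nat => sp; exists y => //.
case: p px py sp => [|z [|? ?]] //=; first by move=> _ xy; rewrite -xy in yA.
by rewrite andbT => xz <-.
Qed.

Lemma boundary_edges (A : {fset V}) :
  (#|` fset_set (boundary R G [set` A])|%:R : R) <=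
  \sum_(x <- A) \sum_(y <- nbr x) (y \notin A)%:R.
Proof.
set B := fset_set _.
have HB y : y \in B -> (y \notin A) && has (fun x => G x y) A.
  have [fin|inf] := pselect (finite_set (boundary R G [set` A])); last first.
    by rewrite /B /fset_set; case: pselect.
  rewrite in_fset_set// inE => /boundary_adj[yA [x xA yx]].
  apply/andP; split; first by apply/negP.
  by apply/hasP; exists x => //; rewrite adj_sym.
rewrite card_fset_sum1 natr_sum.
apply: (@le_trans _ _ (\sum_(y <- B) \sum_(x <- A) (G x y)%:R)).
  rewrite big_seq [leRHS]big_seq; apply: ler_sum => y /HB /andP[_ /hasP[x xA xy]].
  by rewrite (bigD1_seq x) ?fset_uniq//= xy lerDl; apply: sumr_ge0.
rewrite exchange_big /=; apply: ler_sum => x _.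
rewrite -!natr_sum ler_nat.
have -> : (\sum_(y <- B) G x y = size [seq y <- B | G x y])%N.
  by rewrite size_filter -sum1_count [RHS]big_mkcond; apply: eq_bigr => y _; case: (G x y).
have -> : (\sum_(y <- nbr x) (y \notin A) = size [seq y <- nbr x | y \notin A])%N.
  by rewrite size_filter -sum1_count [RHS]big_mkcond; apply: eq_bigr => y _; case: (_ \notin _).
apply: uniq_leq_size; first by rewrite filter_uniq ?fset_uniq.
move=> y; rewrite !mem_filter in_nbr// => /andP[xy /HB /andP[yA _]].
by rewrite yA.
Qed.

(** [cheeger] is a supremum; [c0 / 2] lies strictly below it, hence below an actual isoperimetric
    constant. Each boundary vertex absorbs at least one edge leaving [A]. *)
Lemma cheeger_edge_expansion (c0 : R) : 0 < c0 -> (c0%:E <= cheeger R G)%E ->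
  edge_expansion G (c0 / 2).
Proof.
move=> c0_gt0 ch A.
have : ((c0 / 2)%:E < cheeger R G)%E.
  apply: lt_le_trans ch; rewrite lte_fin ltr_pdivrMr// ltr_pMr// ltr1n.
  by [].
move=> /ereal_sup_gt[_ [c iso <-]]; rewrite lte_fin => c0c.
have [->|A0] := eqVneq A fset0; first by rewrite cardfs0 mulr0 big_seq_fset0.
apply: le_trans (boundary_edges A); apply: le_trans (iso A A0).
by rewrite ler_wpM2r// ltW.
Qed.

Lemma expansion_deg_gt0 (c : R) : 0 < c -> edge_expansion G c ->
  forall v, (0 < degree G v)%N.
Proof.
move=> c0 ex v; rewrite lt0n; apply/negP => /eqP d0.
have := ex [fset v]; rewrite cardfs1 mulr1 big_seq_fset1.
rewrite (_ : nbr v = fset0); last by apply/eqP; rewrite -cardfs_eq0; apply/eqP.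
by rewrite big_seq_fset0 leNgt c0.
Qed.

End Cheeger.

(** * Return counts and the exchange of loops *)

Section Exchange.
Variables (R : realType) (V : choiceType) (G : graph V).
Hypothesis lf : locally_finite G.
Variables (v0 : V) (a : R) (K : nat).
Hypothesis a_ge4 : 4 <= a.
Hypothesis deg_gt0 : forall v, (0 < degree G v)%N.
Hypothesis degK : forall v, (degree G v <= K)%N.

Notation stp := (step_prob G v0 a).
Notation psum := (path_sum G v0 stp).

Let a_gt0 : 0 < a. Proof. exact: lt_le_trans a_ge4. Qed.
Let stp0 : forall g u, 0 <= stp g u. Proof. exact: stp_ge0. Qed.

(* The initial occurrence of v0 is not listed in [g], so that [count_mem v0 g]
   counts returns. *)
Definition closed_at (j : nat) (g : seq V) :=
  (count_mem v0 g == j) && (last v0 g == v0).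

Lemma closed_at_pf j : prefix_free (closed_at j).
Proof.
move=> g c /andP[/eqP gj _] /andP[]; rewrite count_cat gj -[eqbRHS]addn0 eqn_add2l.
case/lastP: c => [//|c u]; rewrite last_cat last_rcons count_mem_rcons => c0 /eqP uv.
by rewrite uv eqxx addn1 in c0.
Qed.

Lemma sum_closed_at j h :
  (\sum_(i < (size h).+1) closed_at j (take i h))%N = (j <= count_mem v0 h)%N.
Proof.
elim/last_ind: h => [|h u IH].
  by rewrite big_ord_recl big_ord0 /closed_at /= eqxx andbT addn0; case: j.
have tk : take (size h).+1 (rcons h u) = rcons h u by rewrite -(size_rcons h u) take_size.
rewrite size_rcons big_ord_recr /= tk.
rewrite (eq_bigr (fun i : 'I_(size h).+1 => nat_of_bool (closed_at j (take i h)))); last first.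
  by move=> i _; rewrite -cats1 takel_cat// -ltnS.
rewrite IH /closed_at count_mem_rcons last_rcons.
case: (u == v0); rewrite ?andbF ?andbT ?addn0//.
by case: ltngtP; lia.
Qed.

Lemma sum_kw n g : \sum_(c <- pths G n (last v0 g)) kw stp g c = 1.
Proof.
elim: n g => [|n IH] g; first by rewrite big_pths0.
rewrite big_pthsS -(sum_stp v0 a_gt0 deg_gt0 g); apply: eq_bigr => u _ /=.
rewrite -mulr_sumr (_ : \sum_(_ <- _) _ = 1) ?mulr1//.
by have := IH (rcons g u); rewrite last_rcons.
Qed.

Lemma sum_take i l g (F : seq V -> R) : (i <= l)%N ->
  \sum_(h <- pths G l (last v0 g)) kw stp g h * F (take i h) =
  \sum_(c <- pths G i (last v0 g)) kw stp g c * F c.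
Proof.
move=> il; rewrite -{1}(subnKC il) big_pthsD.
apply: eq_big_pths => // c pc sc.
rewrite (eq_bigr (fun c' => kw stp g c * F c * kw stp (g ++ c) c')); last first.
  by move=> c' _; rewrite take_size_cat// kw_cat; ring.
by rewrite -mulr_sumr -last_cat sum_kw mulr1.
Qed.

Lemma sum_returns j l g :
  \sum_(h <- pths G l (last v0 g) | (j <= count_mem v0 h)%N) kw stp g h =
  \sum_(i < l.+1) \sum_(c <- pths G i (last v0 g) | closed_at j c) kw stp g c.
Proof.
transitivity (\sum_(h <- pths G l (last v0 g)) \sum_(i < l.+1)
    kw stp g h * (closed_at j (take i h))%:R).
  rewrite big_mkcond; apply: eq_big_pths => // h _ sh.
  have := sum_closed_at j h; rewrite sh => E.
  rewrite -mulr_sumr -natr_sum E.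
  by case: ifP; rewrite ?mulr1 ?mulr0.
rewrite exchange_big /=; apply: eq_bigr => i _.
rewrite (@sum_take i l g (fun c => (closed_at j c)%:R)); last by rewrite -ltnS.
rewrite [RHS]big_mkcond; apply: eq_bigr => c _.
by case: ifP; rewrite ?mulr1 ?mulr0.
Qed.

Definition return_mass (m l : nat) : R :=
  \sum_(h <- pths G l v0 | (m <= count_mem v0 h)%N) kw stp [::] h.

Lemma rtn_psum m l : return_mass m l = psum l [::] (closed_at m) (fun=> 1).
Proof.
rewrite /return_mass (sum_returns m l [::]); apply: eq_bigr => i _.
by apply: eq_bigr => c _; rewrite mulr1.
Qed.

Lemma rtn_ge0 m l : 0 <= return_mass m l.
Proof. by apply: sumr_ge0 => h _; rewrite kw_ge0. Qed.

Lemma rtn_le1 m l : return_mass m l <= 1.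
Proof.
rewrite -(sum_kw l [::]) /return_mass big_mkcond; apply: ler_sum => h _.
by case: ifP => // _; rewrite kw_ge0.
Qed.

Lemma rtn_mono m l l' : (l <= l')%N -> return_mass m l <= return_mass m l'.
Proof.
move=> /subnKC <-; rewrite !rtn_psum.
elim: (l' - l)%N => [|n IH]; first by rewrite addn0.
apply: le_trans IH _; rewrite addnS /path_sum [leRHS]big_ord_recr /= lerDl.
by apply: sumr_ge0 => c _; rewrite mulr_ge0// kw_ge0.
Qed.

Lemma rtn_anti m m' l : (m <= m')%N -> return_mass m' l <= return_mass m l.
Proof.
move=> mm; rewrite /return_mass big_mkcond [leRHS]big_mkcond; apply: ler_sum => h _.
case: ifP => [h1|_]; first by rewrite (leq_trans mm h1).
by case: ifP => // _; rewrite kw_ge0.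
Qed.

(** [q] is the infimum over [m] of the supremum over [l]: the probability of infinitely many
    returns, expressed without a probability space. *)
Lemma rtn_limits : exists2 q : R, 0 <= q &
  (forall eta, 0 < eta -> exists m0, forall m l, (m0 <= m)%N -> return_mass m l <= q + eta) /\
  (forall m eta, 0 < eta -> exists l0, forall l, (l0 <= l)%N -> q - eta <= return_mass m l).
Proof.
pose E m := [set return_mass m l | l in [set: nat]]%classic.
have supE m : has_sup (E m).
  split; first by exists (return_mass m 0), 0%N.
  by exists 1 => _ [l _ <-]; exact: rtn_le1.
pose s m := sup (E m).
have rs m l : return_mass m l <= s m by apply: sup_upper_bound => //; exists l.
have s0 m : 0 <= s m by apply: le_trans (rs m 0%N); exact: rtn_ge0.
have s_anti m m' : (m <= m')%N -> s m' <= s m.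
  move=> mm; apply: ge_sup; first by case: (supE m').
  by move=> _ [l _ <-]; apply: le_trans (rs m l); exact: rtn_anti.
pose F := [set s m | m in [set: nat]]%classic.
have infF : has_inf F.
  by split; [exists (s 0%N), 0%N | exists 0 => _ [m _ <-]].
exists (inf F); first by apply: lb_le_inf; [case: infF | move=> _ [m _ <-]].
split=> [eta eta0|m eta eta0].
  have [_ [m _ <-] hm] := inf_adherent eta0 infF.
  exists m => m' l mm; apply: le_trans (rs m' l) _.
  by apply: le_trans (s_anti _ _ mm) _; exact: ltW.
have [_ [l _ <-] hl] := sup_adherent eta0 (supE m).
exists l => l' ll; apply: le_trans (rtn_mono m ll); apply: ltW.
apply: le_lt_trans hl; rewrite lerD2r.
by apply: inf_lbound; [case: infF | exists m].
Qed.

Lemma rtn_stable m eta : 0 < eta ->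
  exists l0, forall l l', (l0 <= l)%N -> return_mass m l' <= return_mass m l + eta.
Proof.
move=> eta0; pose E := [set return_mass m l | l in [set: nat]]%classic.
have supE : has_sup E.
  split; first by exists (return_mass m 0), 0%N.
  by exists 1 => _ [l _ <-]; exact: rtn_le1.
have [_ [l0 _ <-] hl] := sup_adherent eta0 supE.
exists l0 => l l' ll; have h1 := rtn_mono m ll.
have h2 : return_mass m l' <= sup E by apply: sup_upper_bound => //; exists l'.
lra.
Qed.

(* The weight of a path depends on its edge counts only; hence it does not change
   when the first k loops are moved behind the next j ones. *)
Lemma exchange_loops j k l c : path G v0 c -> (size c < k)%N ->
  \sum_(h <- pths G l v0 | (take (size c) h == c) && (j + k <= count_mem v0 h)%N)
     kw stp [::] h <= psum l [::] (closed_at j) (fun g => kw stp g c).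
Proof.
move=> pc ck.
pose X g1 := closed_at k g1 && (take (size c) g1 == c).
(* Cut [h] at its k-th return. As [k] loops take at least [k > size c] steps, the prefix [c] lies
   inside the first block [g1]. *)
apply: (@le_trans _ _ (\sum_(i < l.+1) \sum_(g1 <- pths G i v0 | X g1)
   kw stp [::] g1 * \sum_(h' <- pths G (l - i) v0 | (j <= count_mem v0 h')%N) kw stp g1 h')).
  apply: (@le_trans _ _ (\sum_(h <- pths G l v0) \sum_(i < l.+1)
     (if X (take i h) && (j <= count_mem v0 (drop i h))%N then kw stp [::] h else 0))).
    rewrite big_mkcond; apply: ler_big_pths => // h _ sh.
    have pos i : 0 <= (if X (take i h) && (j <= count_mem v0 (drop i h))%N
       then kw stp [::] h else 0) by case: ifP => // _; rewrite kw_ge0.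
    case: ifP => [/andP[/eqP tc jk]|_]; last by apply: sumr_ge0.
    have kh : (k <= count_mem v0 h)%N by lia.
    have := sum_closed_at k h; rewrite kh sh => S1.
    have [i ci] : exists i : 'I_l.+1, closed_at k (take i h).
      case: (pickP (fun i : 'I_l.+1 => closed_at k (take i h))) => [i ci|no]; first by exists i.
      by move: S1; rewrite big1// => i _; rewrite no.
    rewrite (bigD1 i)//= ifT ?lerDl; first by apply: sumr_ge0.
    case/andP: (ci) => /eqP ck' _.
    have cnt : count_mem v0 h = (k + count_mem v0 (drop i h))%N.
      by rewrite -{1}(cat_take_drop i h) count_cat ck'.
    apply/andP; split; last by move: jk; rewrite cnt addnC leq_add2l.
    rewrite /X ci /= take_takel ?tc//.
    have := count_size (pred1 v0) (take i h); rewrite ck' size_take.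
    by case: ltnP => h1 h2; lia.
  rewrite exchange_big /=; apply: ler_sum => i _.
  have il : (i <= l)%N by rewrite -ltnS.
  rewrite -{1}(subnKC il) big_pthsD [leRHS]big_mkcond.
  apply: ler_big_pths => // g1 _ sg.
  case: ifP => [Xg|nX]; last first.
    by rewrite big1// => c' _; rewrite take_size_cat// nX.
  have lg : last v0 g1 = v0 by case/andP: Xg => /andP[_ /eqP].
  rewrite mulr_sumr lg [leRHS]big_mkcond /=; apply: ler_sum => c' _.
  by rewrite take_size_cat// drop_size_cat// Xg /= kw_cat.
(* Cut the rest at its j-th return; [weight_swap] puts this block [g2] in front of [g1]. *)
apply: (@le_trans _ _ (\sum_(i < l.+1) \sum_(g1 <- pths G i v0 | X g1)
   \sum_(i2 < l.+1) \sum_(g2 <- pths G i2 v0 | closed_at j g2) kw stp [::] (g2 ++ g1))).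
  apply: ler_sum => i _; rewrite big_seq_cond [leRHS]big_seq_cond.
  apply: ler_sum => g1 /andP[]; rewrite mem_pths// => /andP[_ pg1] /andP[/andP[_ /eqP lg] _].
  rewrite mulr_sumr.
  have -> : \sum_(h' <- pths G (l - i) v0 | (j <= count_mem v0 h')%N)
     kw stp [::] g1 * kw stp g1 h' =
     \sum_(i2 < (l - i).+1) \sum_(g2 <- pths G i2 v0 | closed_at j g2) kw stp [::] (g2 ++ g1).
    have := sum_returns j (l - i) g1; rewrite lg -mulr_sumr => ->.
    rewrite mulr_sumr; apply: eq_bigr => i2 _; rewrite mulr_sumr.
    rewrite big_seq_cond [RHS]big_seq_cond; apply: eq_bigr => g2 /andP[].
    rewrite mem_pths// => /andP[_ pg2] /andP[_ /eqP lg2].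
    rewrite (@weight_swap _ _ _ lf v0 a a_gt0 g2 g1)//; first by rewrite kw_cat.
    by rewrite cat_path pg2 lg2.
  have le : ((l - i).+1 <= l.+1)%N by rewrite ltnS leq_subr.
  rewrite (big_ord_widen _ (fun i2 => \sum_(g2 <- pths G i2 v0 | closed_at j g2) kw stp [::] (g2 ++ g1)) le).
  rewrite big_mkcond; apply: ler_sum => i2 _; case: ifP => // _.
  by apply: sumr_ge0 => g2 _; rewrite kw_ge0.
have -> : \sum_(i < l.+1) \sum_(g1 <- pths G i v0 | X g1)
   \sum_(i2 < l.+1) \sum_(g2 <- pths G i2 v0 | closed_at j g2) kw stp [::] (g2 ++ g1) =
  \sum_(i2 < l.+1) \sum_(g2 <- pths G i2 v0 | closed_at j g2)
   \sum_(i < l.+1) \sum_(g1 <- pths G i v0 | X g1) kw stp [::] (g2 ++ g1).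
  transitivity (\sum_(i < l.+1) \sum_(i2 < l.+1) \sum_(g1 <- pths G i v0 | X g1)
     \sum_(g2 <- pths G i2 v0 | closed_at j g2) kw stp [::] (g2 ++ g1)).
    by apply: eq_bigr => i _; rewrite exchange_big.
  rewrite exchange_big /=; apply: eq_bigr => i2 _.
  rewrite [RHS]exchange_big /=; apply: eq_bigr => i _.
  by rewrite exchange_big.
apply: ler_sum => i2 _; rewrite big_seq_cond [leRHS]big_seq_cond.
apply: ler_sum => g2 /andP[]; rewrite mem_pths// => /andP[_ pg2] /andP[cj /eqP lg2].
(* After [g2] only blocks of [k] loops that start with [c] contribute, and these are prefix-free, so
   [kraft_ext] bounds their mass by [kw stp g2 c]. *)
pose S g := X (drop (size g2) g).
have k0 : (0 < k)%N by apply: leq_trans ck.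
have Spf : prefix_free S.
  move=> g c'; have [sg|sg] := leqP (size g2) (size g).
    rewrite /S drop_cat; case: ltngtP sg => // [sg _|sg _].
      by move=> /andP[h1 _] /andP[h2 _]; exact: closed_at_pf h1 h2.
    rewrite sg drop_size subnn drop0 => /andP[/andP[/eqP h1 _] _].
    by rewrite -h1 in k0.
  rewrite /S drop_oversize ?(ltnW sg)// => /andP[/andP[/eqP h1 _] _].
  by rewrite -h1 in k0.
have := @kraft_ext _ _ _ lf v0 stp l g2 S c stp0 (superm1 a_gt0 deg_gt0) Spf pg2.
rewrite lg2 => /(_ _ pc) H.
rewrite [leLHS](_ : _ = kw stp [::] g2 * psum l g2 S (fun=> 1)); last first.
  rewrite /path_sum lg2 mulr_sumr; apply: eq_bigr => i _; rewrite mulr_sumr.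
  apply: eq_big => [g1|g1 _]; first by rewrite /S drop_size_cat.
  by rewrite kw_cat mulr1.
rewrite ler_wpM2l ?kw_ge0//; apply: H => g'; rewrite /S drop_size_cat// => /andP[_ /eqP].
by move=> e; exists (drop (size c) g'); rewrite -{1}(cat_take_drop (size c) g') e.
Qed.

End Exchange.

(** * Approximate mixture of Markov chains *)

Section Mixture.
Variables (R : realType) (V : choiceType) (G : graph V).
Hypothesis lf : locally_finite G.
Variables (v0 : V) (a : R) (K : nat).
Hypothesis a_ge4 : 4 <= a.
Hypothesis deg_gt0 : forall v, (0 < degree G v)%N.
Hypothesis degK : forall v, (degree G v <= K)%N.

Notation nbr := (neighbors G).
Notation stp := (step_prob G v0 a).
Notation pr := (edge_prob G v0 a).
Notation ball := (ball G v0).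
Notation psum := (path_sum G v0 stp).
Notation rtn := (return_mass G v0 a).
Notation closed_at := (closed_at v0).

Let a_gt0 : 0 < a. Proof. exact: lt_le_trans a_ge4. Qed.
Let stp0 : forall g u, 0 <= stp g u. Proof. exact: stp_ge0. Qed.
Let K_gt0 : (0 < K)%N. Proof. exact: leq_trans (deg_gt0 v0) (degK v0). Qed.

Lemma ball_path n x : x \in ball n -> exists2 p, path G v0 p & last v0 p = x.
Proof.
elim: n x => [|n IH] x; first by rewrite inE => /eqP ->; exists [::].
rewrite ballS// => /orP[/IH//|/hasP[y /IH[p pp lp] yx]].
by exists (rcons p x); rewrite ?last_rcons// rcons_path pp lp.
Qed.

Lemma path_ball c : path G v0 c -> last v0 c \in ball (size c).
Proof.
elim/last_ind: c => [|c u IH]; first by rewrite inE.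
rewrite rcons_path last_rcons size_rcons => /andP[pc lu].
exact: (ball_nbr lf (IH pc) lu).
Qed.

Lemma pths_uniq n v : uniq (pths G n v).
Proof.
elim: n v => [|n IH] v //=; apply: allpairs_uniq_dep => //.
by move=> [x c] [y c'] _ _ /= [-> ->].
Qed.

Lemma card_pths n v : \sum_(c <- pths G n v) 1 <= K%:R ^+ n :> R.
Proof.
elim: n v => [|n IH] v; first by rewrite big_pths0.
rewrite big_pthsS; apply: (@le_trans _ _ (\sum_(u <- nbr v) K%:R ^+ n)).
  by apply: ler_sum => u _; exact: IH.
rewrite big_const_seq count_predT iter_addr_0 -[X in X <= _]mulr_natl exprS.
by rewrite ler_wpM2r ?exprn_ge0// ler_nat; exact: degK.
Qed.

Lemma kw_le1 g c : path G (last v0 g) c -> kw stp g c <= 1.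
Proof.
elim: c g => [|u c IH] g //= /andP[gu pc].
apply: mulr_ile1 => //; first exact: kw_ge0.
  by apply: stp_le1 => //; rewrite in_nbr.
by apply: IH; rewrite last_rcons.
Qed.

Definition well_visited (w N : nat) (g : seq V) : bool :=
  all (fun v => w <= exits v0 g v)%N (ball N).

(** The crossings along [c] raise the numerator by at most [N], while the denominator only grows and
    is at least [w]. *)
Lemma stp_pr_close w N g c u : (0 < w)%N -> path G v0 (g ++ c) -> last v0 g = v0 ->
  well_visited w N g -> (size c <= N)%N ->
  stp (g ++ c) u <= pr g (last v0 c) u + N%:R / w%:R.
Proof.
move=> w0; rewrite cat_path => /andP[pg pc] lg /allP wv cN.
rewrite lg in pc; rewrite /step_prob last_cat lg /edge_prob.
set v := last v0 c.
have vN : v \in ball N by apply: (ball_sub lf cN); exact: path_ball.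
have wB : w%:R <= Wv G v0 a g v.
  rewrite Wv_path//; apply: (@le_trans _ _ (exits v0 g v)%:R).
    by rewrite ler_nat; exact: wv.
  by rewrite natrD addrA addrAC lerDr addr_ge0// mulr_ge0// ltW.
have w0' : 0 < w%:R :> R by rewrite ltr0n.
have B0 : 0 < Wv G v0 a g v by apply: lt_le_trans wB.
have BB : Wv G v0 a g v <= Wv G v0 a (g ++ c) v.
  apply: ler_sum => y _; rewrite lerD2l ler_nat.
  by rewrite -{1}(take_size_cat c (erefl (size g))) ucount_take.
have B'0 : 0 < Wv G v0 a (g ++ c) v by apply: lt_le_trans BB.
apply: (@le_trans _ _ ((Wt v0 a g v u + N%:R) / Wv G v0 a (g ++ c) v)).
  rewrite ler_pM2r ?invr_gt0// /Wt -addrA lerD2l -natrD ler_nat.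
  by apply: leq_trans (ucount_cat_le _ _ _ _ _) _; rewrite leq_add2l.
rewrite mulrDl; apply: lerD.
  by rewrite ler_pM2l ?Wt_gt0// lef_pV2.
by apply: ler_wpM2l => //; rewrite lef_pV2// (le_trans wB).
Qed.

(** The kernels are exchanged one step at a time; each of the at most [N] steps costs [N / w], the
    other factors being at most 1. *)
Lemma kw_close w N g c : (0 < w)%N -> path G v0 g -> path G v0 c ->
  last v0 g = v0 -> well_visited w N g -> (size c <= N)%N ->
  kw stp g c <= kw (markov v0 (pr g)) [::] c + N%:R * (N%:R / w%:R).
Proof.
move=> w0 pg pc lg wv cN.
set d : R := N%:R / w%:R; have d0 : 0 <= d by rewrite divr_ge0.
have H c1 c2 : c1 ++ c2 = c -> kw stp (g ++ c1) c2 <=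
   kw (markov v0 (pr g)) c1 c2 + (size c2)%:R * d.
  elim: c2 c1 => [|u c2 IH] c1 e /=; first by rewrite mul0r addr0.
  have pc1 : path G v0 (c1 ++ u :: c2) by rewrite e.
  move: (pc1); rewrite cat_path /= => /and3P[pc1' c1u pc2].
  have ul : u \in nbr (last v0 c1) by rewrite in_nbr.
  have pgc : path G v0 (g ++ c1) by rewrite cat_path pg lg.
  have sc1 : (size c1 <= N)%N.
    by apply: leq_trans cN; rewrite -e size_cat leq_addr.
  have h1 := stp_pr_close u w0 pgc lg wv sc1.
  have := IH (rcons c1 u); rewrite cat_rcons => /(_ e) h2.
  rewrite rcons_cat -/d in h1 h2 *.
  have p0 : 0 <= pr g (last v0 c1) u by exact: pr_ge0.
  have p1 : pr g (last v0 c1) u <= 1 by exact: pr_le1.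
  have x0 : 0 <= kw stp (g ++ rcons c1 u) c2 by exact: kw_ge0.
  have x1 : kw stp (g ++ rcons c1 u) c2 <= 1.
    by apply: kw_le1; rewrite last_cat lg last_rcons.
  rewrite -natr1 mulrDl mul1r addrA.
  set X := kw stp _ _ in h2 x0 x1 *; set Y := kw (markov _ _) _ _ in h2 *.
  set p := pr _ _ _ in p0 p1 h1 *; set s := stp _ _ in h1 *.
  have m0 : 0 <= (size c2)%:R * d by rewrite mulr_ge0.
  have : s * X <= (p + d) * X by rewrite ler_wpM2r.
  have : d * X <= d by rewrite ler_piMr.
  have : p * X <= p * (Y + (size c2)%:R * d) by rewrite ler_wpM2l.
  have : p * ((size c2)%:R * d) <= (size c2)%:R * d by rewrite ler_piMl.
  rewrite mulrDl mulrDr (_ : markov v0 (pr g) c1 u = p)//; lra.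
have := H [::] c erefl; rewrite cats0 => h; apply: le_trans h _.
by rewrite lerD2l ler_wpM2r// ler_nat.
Qed.

Lemma psum_has (I : eqType) (s : seq I) l (S : pred (seq V)) (P : I -> pred (seq V)) (x : R) :
  (forall i, i \in s -> psum l [::] (fun c => S c && P i c) (fun=> 1) <= x) ->
  psum l [::] (fun c => S c && has (P^~ c) s) (fun=> 1) <= (size s)%:R * x.
Proof.
elim: s => [|i s IH] H.
  by rewrite mul0r psum_eq0// => c; rewrite andbF.
apply: le_trans (@psumU _ _ _ lf v0 stp stp0 l _ (fun c => S c && P i c)
   (fun c => S c && has (P^~ c) s) _) _.
  by move=> c _ /andP[-> /=].
rewrite -natr1 mulrDl mul1r addrC lerD//; last by apply: H; rewrite inE eqxx.
by apply: IH => j js; apply: H; rewrite inE js orbT.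
Qed.

Lemma badly_visited w N (eta : R) : 0 < eta -> exists j0, forall (S : pred (seq V)) l,
  prefix_free S ->
  psum l [::] (fun g => S g && ((j0 <= exits v0 g v0)%N && ~~ well_visited w N g))
    (fun=> 1) <= eta.
Proof.
move=> e0; pose s : seq V := ball N.
pose x := eta / (size s).+1%:R.
have x0 : 0 < x by rewrite divr_gt0// ltr0n.
have [f Hf] : exists f : V -> nat, forall v, v \in s ->
   forall (S : pred (seq V)) l, prefix_free S ->
    psum l [::] (fun c => [&& S c, (f v <= exits v0 c v0)%N & (exits v0 c v < w)%N])
      (fun=> 1) <= x.
  have ex v : exists n : nat, v \in s -> forall (S : pred (seq V)) l, prefix_free S ->
    psum l [::] (fun c => [&& S c, (n <= exits v0 c v0)%N & (exits v0 c v < w)%N])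
      (fun=> 1) <= x.
    case: (boolP (v \in s)) => [vs|_]; last by exists 0%N.
    have [p pp lp] := ball_path vs.
    have [n Hn] := few_exits lf v0 a_ge4 deg_gt0 degK w pp x0.
    by exists n => _; rewrite -lp.
  by exists (fun v => projT1 (cid (ex v))) => v; case: cid.
pose j0 := \max_(v <- s) f v.
exists j0 => S l Spf.
apply: (@le_trans _ _ (psum l [::] (fun c => S c &&
   has (fun v => (f v <= exits v0 c v0)%N && (exits v0 c v < w)%N) s) (fun=> 1))).
  apply: psum_le => // g pg /andP[Sg /andP[jg nw]] _; split=> //; rewrite Sg /=.
  move: nw; rewrite /well_visited -has_predC => /hasP[v vs /=]; rewrite -ltnNge => ev.
  apply/hasP; exists v => //; rewrite ev andbT; apply: leq_trans jg.
  exact: leq_bigmax_seq.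
apply: le_trans (psum_has (x := x) _) _.
  move=> v vs; exact: (Hf v vs S l Spf).
rewrite /x mulrA ler_pdivrMr ?ltr0n// mulrC ler_wpM2l ?(ltW e0)//.
by rewrite ler_nat.
Qed.

(* Approximate de Finetti theorem: sampling a network from the weights left behind
   after j returns to v0 dominates, up to [eta], the recurrent part of the walk. *)
Lemma approx_mixture (q : R) (N j1 : nat) (eta : R) : 0 < eta ->
  (forall eta, 0 < eta -> exists m0, forall m l, (m0 <= m)%N -> rtn m l <= q + eta) ->
  (forall m eta, 0 < eta -> exists l0, forall l, (l0 <= l)%N -> q - eta <= rtn m l) ->
  exists j l, [/\ (j1 <= j)%N, (N <= l)%N, rtn j l <= q + eta,
    q - eta <= rtn (j + N.+1) l &
    forall n F, (n <= N)%N -> (forall c, 0 <= F c <= 1) ->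
     \sum_(h <- pths G l v0 | (j + N.+1 <= count_mem v0 h)%N)
        kw stp [::] h * F (take n h) - eta <=
     psum l [::] (closed_at j)
       (fun g => \sum_(c <- pths G n v0) kw (markov v0 (pr g)) [::] c * F c)].
Proof.
move=> e0 lim1 lim2.
(* At most [K ^ N] paths have an error [N * (N / w)] each, by [kw_close]; [C <= w] makes the total
   at most [eta / 2]. *)
pose C : R := K%:R ^+ N * (N%:R * N%:R) / (eta / 2).
pose w := (Num.truncn C).+1.
have wC : C <= w%:R by apply/ltW; rewrite /w; apply: truncnS_gt.
have e2 : 0 < eta / 2 by rewrite divr_gt0.
have [m0 Hm0] := lim1 eta e0.
have [j0 Hj0] := badly_visited w N e2.
pose j := maxn j1 (maxn m0 j0).
have [l0 Hl0] := lim2 (j + N.+1)%N eta e0.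
pose l := maxn N l0.
exists j, l; split.
- by rewrite leq_maxl.
- by rewrite leq_maxl.
- by apply: Hm0; rewrite /j; lia.
- by apply: Hl0; rewrite leq_maxr.
move=> n F nN F01.
have F0 c : 0 <= F c by case/andP: (F01 c).
have F1 c : F c <= 1 by case/andP: (F01 c).
pose A g := \sum_(c <- pths G n v0) kw stp g c * F c.
have A0 g : 0 <= A g by apply: sumr_ge0 => c _; rewrite mulr_ge0// kw_ge0.
have E1 : psum l [::] (closed_at j) A =
   \sum_(c <- pths G n v0) F c * psum l [::] (closed_at j) (fun g => kw stp g c).
  under eq_bigr do rewrite -psumZ.
  rewrite /A /path_sum exchange_big /=; apply: eq_bigr => i _.
  rewrite exchange_big /=; apply: eq_bigr => g _; rewrite mulr_sumr.
  by apply: eq_bigr => c _; congr (_ * _); rewrite mulrC.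
have H1 : \sum_(h <- pths G l v0 | (j + N.+1 <= count_mem v0 h)%N)
   kw stp [::] h * F (take n h) <= psum l [::] (closed_at j) A.
  rewrite E1.
  have nl : (n <= l)%N by apply: leq_trans nN _; rewrite leq_maxl.
  have -> : \sum_(h <- pths G l v0 | (j + N.+1 <= count_mem v0 h)%N) kw stp [::] h * F (take n h)
   = \sum_(c <- pths G n v0) F c * \sum_(h <- pths G l v0 |
       (take (size c) h == c) && (j + N.+1 <= count_mem v0 h)%N) kw stp [::] h.
    under [RHS]eq_bigr do rewrite mulr_sumr big_mkcond /=.
    rewrite exchange_big /= big_mkcond /=; apply: eq_big_pths => // h ph sh.
    have tn : take n h \in pths G n v0.
      rewrite mem_pths// take_path//andbT size_take sh.
      by case: ltnP => // ln; rewrite eqn_leq ln nl.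
    have un : uniq (pths G n v0) by exact: pths_uniq.
    have stn : size (take n h) = n by move: tn; rewrite mem_pths// => /andP[/eqP].
    rewrite (bigD1_seq (take n h))//= stn eqxx /= big1_seq ?addr0.
      by case: ifP => // _; rewrite mulrC.
    move=> c /andP[cn]; rewrite mem_pths// => /andP[/eqP -> _].
    by rewrite eq_sym (negPf cn).
  apply: ler_big_pths => // c pc sc; rewrite ler_wpM2l//.
  by apply: exchange_loops => //; rewrite sc ltnS.
pose B g := \sum_(c <- pths G n v0) kw (markov v0 (pr g)) [::] c * F c.
have B0 g : 0 <= B g.
  by apply: sumr_ge0 => c _; rewrite mulr_ge0// kw_ge0// => *; exact: pr_ge0.
have H2 : psum l [::] (closed_at j) A <=
   psum l [::] (closed_at j) B + eta / 2 * psum l [::] (closed_at j) (fun=> 1)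
   + psum l [::] (fun g => closed_at j g && ~~ well_visited w N g) (fun=> 1).
  rewrite -psumZ; set bad := fun g => closed_at j g && _.
  have -> : psum l [::] (closed_at j) B + psum l [::] (closed_at j) (fun=> eta / 2 * 1) +
     psum l [::] bad (fun=> 1) = psum l [::] predT (fun g =>
      (if closed_at j g then B g else 0) + (if closed_at j g then eta / 2 * 1 else 0) +
      (if bad g then 1 else 0)).
    by rewrite !psumD; congr (_ + _ + _); exact: psum_mkcond.
  rewrite psum_mkcond.
  have A1 g : path G v0 g -> closed_at j g -> A g <= 1.
    move=> pg /andP[_ /eqP lg]; have := sum_kw v0 a_ge4 deg_gt0 n g; rewrite lg => <-.
    by apply: ler_sum => c _; rewrite ler_piMr ?kw_ge0.
  apply: psum_le => // g.
  - move=> pg _ _; split=> //; rewrite /bad; case: ifP => cl /=; last by rewrite !addr0.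
    case: ifP => wv /=.
      by rewrite ler_wpDl ?A1// addr_ge0// mulr1 ltW.
    rewrite addr0 mulr1 /A /B.
    have lg : last v0 g = v0 by case/andP: cl => _ /eqP.
    apply: (@le_trans _ _ (\sum_(c <- pths G n v0)
      (kw (markov v0 (pr g)) [::] c * F c + N%:R * (N%:R / w%:R)))).
      apply: ler_big_pths => // c pc sc.
      have := @kw_close w N g c isT pg pc lg (negbFE wv).
      rewrite sc => /(_ nN) h.
      apply: (@le_trans _ _ ((kw (markov v0 (pr g)) [::] c + N%:R * (N%:R / w%:R)) * F c)).
        by rewrite ler_wpM2r.
      rewrite mulrDl lerD2l ler_piMr// mulr_ge0// divr_ge0//.
    rewrite big_split /= lerD2l.
    have -> : \sum_(c <- pths G n v0) N%:R * (N%:R / w%:R) =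
       N%:R * (N%:R / w%:R) * \sum_(c <- pths G n v0) 1 :> R.
      by rewrite mulr_sumr; apply: eq_bigr => c _; rewrite mulr1.
    apply: (@le_trans _ _ (N%:R * (N%:R / w%:R) * K%:R ^+ N)).
      rewrite ler_wpM2l// ?mulr_ge0// ?divr_ge0//.
      apply: le_trans (card_pths n v0) _.
      by rewrite ler_weXn2l// ler1n.
    rewrite mulrA mulrAC ler_pdivrMr ?ltr0n//.
    by move: wC; rewrite /C ler_pdivrMr// [w%:R * _]mulrC [X in X <= _]mulrC.
  - by case: ifP.
  - by rewrite addr_ge0//; case: ifP => // _; rewrite addr_ge0// mulr1 ltW.
have H3 : psum l [::] (closed_at j) (fun=> 1) <= 1.
  by rewrite -rtn_psum// rtn_le1.
have H5 : psum l [::] (fun g => closed_at j g && ~~ well_visited w N g) (fun=> 1) <= eta / 2.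
  apply: le_trans (Hj0 (closed_at j) l (@closed_at_pf _ v0 j)); apply: psum_le => //.
  move=> g _ /andP[cl wv] _; split=> //; rewrite cl wv andbT.
  case/andP: cl => /eqP cj /eqP lg; have := exits_balance v0 g v0.
  by rewrite lg eqxx cj /j; lia.
have H6 : eta / 2 * psum l [::] (closed_at j) (fun=> 1) <= eta / 2.
  by rewrite ler_piMr// ltW.
rewrite -/B; lra.
Qed.

End Mixture.

Section Ratios.
Variables (R : realType) (V : choiceType) (G : graph V).
Hypothesis lf : locally_finite G.
Variables (v0 : V) (a : R) (K : nat).
Hypothesis a_ge4 : 4 <= a.
Hypothesis deg_gt0 : forall v, (0 < degree G v)%N.
Hypothesis degK : forall v, (degree G v <= K)%N.

Notation nbr := (neighbors G).
Notation stp := (step_prob G v0 a).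
Notation pr := (edge_prob G v0 a).
Notation ball := (ball G v0).
Notation psum := (path_sum G v0 stp).
Notation rtn := (return_mass G v0 a).
Notation closed_at := (closed_at v0).
Notation well_visited := (well_visited G v0).

Let a_gt0 : 0 < a. Proof. exact: lt_le_trans a_ge4. Qed.
Let stp0 : forall g u, 0 <= stp g u. Proof. exact: stp_ge0. Qed.

(** Either [j1] returns occur by time [N] without visiting the ball enough, of mass at most [eta] by
    [badly_visited], or the [j1]-th return falls between [N] and [l], of mass at most [eta] by
    [rtn_stable]. *)
Lemma late_unvisited w B (eta : R) : 0 < eta ->
  exists j1 N0, forall N n l, (N0 <= N)%N -> (j1 <= n)%N -> (N <= l)%N ->
  \sum_(h <- pths G l v0 | (n <= count_mem v0 h)%N)
    kw stp [::] h * (~~ well_visited w B (take N h))%:R <= 2 * eta.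
Proof.
move=> e0; have [j1 Hj1] := badly_visited lf v0 a_ge4 deg_gt0 degK w B e0.
have [N0 HN0] := rtn_stable lf v0 a_ge4 deg_gt0 j1 e0.
exists j1, N0 => N n l NN jn Nl.
pose bad c : R := ((j1 <= count_mem v0 c)%N && ~~ well_visited w B c)%:R.
pose few c : R := (j1 <= count_mem v0 c)%:R.
apply: (@le_trans _ _ (\sum_(h <- pths G l v0) kw stp [::] h * bad (take N h) +
   (rtn j1 l - \sum_(h <- pths G l v0) kw stp [::] h * few (take N h)))).
  rewrite /return_mass [X in _ + (X - _)]big_mkcond -sumrB -big_split big_mkcond.
  apply: ler_sum => h _ /=; rewrite /bad /few.
  have k0 : 0 <= kw stp [::] h by exact: kw_ge0.
  have ct : (count_mem v0 (take N h) <= count_mem v0 h)%N.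
    by rewrite -{2}(cat_take_drop N h) count_cat leq_addr.
  case: ifP => nh; last first.
    case: (leqP j1 (count_mem v0 (take N h))) => jt.
      by rewrite (leq_trans jt ct) mulr1 subrr addr0 mulr_ge0.
    by rewrite !mulr0 subr0 add0r; case: ifP.
  rewrite (leq_trans jn nh); case: (leqP j1 (count_mem v0 (take N h))) => jt /=.
    by rewrite mulr1 subrr addr0.
  by rewrite !mulr0 subr0 add0r ler_piMr//; case: (~~ _).
have -> : \sum_(h <- pths G l v0) kw stp [::] h * few (take N h) = rtn j1 N.
  have := @sum_take _ _ _ lf v0 a a_ge4 deg_gt0 N l [::] few Nl => /= ->.
  rewrite /return_mass [RHS]big_mkcond; apply: eq_bigr => c _; rewrite /few.
  by case: ifP; rewrite ?mulr1 ?mulr0.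
have -> : \sum_(h <- pths G l v0) kw stp [::] h * bad (take N h) =
  \sum_(c <- pths G N v0) kw stp [::] c * bad c.
  by have := @sum_take _ _ _ lf v0 a a_ge4 deg_gt0 N l [::] bad Nl.
have h1 : \sum_(c <- pths G N v0) kw stp [::] c * bad c <= eta.
  apply: le_trans (Hj1 (fun c => size c == N) N (@prefix_free_size _ N)).
  rewrite (sum_pths_psum lf v0 stp N predT).
  apply: (@le_trans _ _ (psum N [::] (fun c => (size c == N) && predT c)
    (fun c => if (j1 <= exits v0 c v0)%N && ~~ well_visited w B c then 1 else 0))).
    apply: psum_le => // [c pc sc _|c]; last by case: ifP.
    split=> //; rewrite /bad; case: (boolP (well_visited w B c)) => wv; rewrite ?andbF//= !andbT.
    case: (leqP j1 (count_mem v0 c)) => jc; last by case: ifP.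
    rewrite ifT//; apply: leq_trans jc _.
    by have := exits_balance v0 c v0; rewrite eqxx; case: (_ == _); lia.
  rewrite psum_mkcond [leRHS]psum_mkcond; apply: psum_le => // c.
  - by move=> _ _ _; split=> //; case: (size c == N) => //=; case: ifP.
  - by do 2 case: ifP => //.
  - by case: ifP.
have := HN0 N l NN; lra.
Qed.

Definition mixture (q : R) (N : nat) (eta : R) (j l : nat) :=
  [/\ (N <= l)%N, rtn j l <= q + eta, q - eta <= rtn (j + N.+1) l &
   forall n F, (n <= N)%N -> (forall c, 0 <= F c <= 1) ->
     \sum_(h <- pths G l v0 | (j + N.+1 <= count_mem v0 h)%N)
        kw stp [::] h * F (take n h) - eta <=
     psum l [::] (closed_at j)
       (fun g => \sum_(c <- pths G n v0) kw (markov v0 (pr g)) [::] c * F c)].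

(** The mixture dominates tests from one side only, so it is applied to the complement [1 - Ft / X]
    of the truncated payoff. The error [5 * eta] consists of [2 * eta] for the total masses, [eta]
    for the mixture and [2 * eta] for insufficiently visited balls. *)
Lemma mixture_payoff q N eta j l (n H B : nat) (vtx u : nat -> V)
    (T : nat -> pred V) (A : nat -> R) : (0 < H)%N ->
  mixture q N eta j l ->
  \sum_(h <- pths G l v0 | (j + N.+1 <= count_mem v0 h)%N)
    kw stp [::] h * (~~ well_visited H B (take N h))%:R <= 2 * eta ->
  (forall i k, (i < n)%N -> (k < n)%N -> vtx i = vtx k -> i = k) ->
  (forall i, (i < n)%N -> [/\ u i \in nbr (vtx i), 0 <= A i,
     payoff_drift G v0 a (A i) (vtx i) (u i) (T i) & vtx i \in ball B]) ->
  psum l [::] (closed_at j) (fun g => \prod_(i < n)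
    mean_payoff (hit_prob G (pr g) (T i) (vtx i)) (pr g (vtx i) (u i)) H) <=
  \prod_(i < n) A i + 5 * eta * H%:R ^+ n.
Proof.
move=> H0 [Nl up lo mix] obs inj stages.
pose X : R := H%:R ^+ n.
have X0 : 0 < X by rewrite exprn_gt0// ltr0n.
pose P c : R := \prod_(i < n) payoff R (T i) (u i) (stack v0 c (vtx i)).
have P0 c : 0 <= P c by apply: prodr_ge0 => i _; exact: payoff_ge0.
pose Ft c := if [forall i : 'I_n, (H <= exits v0 c (vtx i))%N] then Num.min (P c) X else X.
have Ft0 c : 0 <= Ft c by rewrite /Ft; case: ifP; rewrite ?le_min ?P0 ?ltW.
have FtX c : Ft c <= X by rewrite /Ft; case: ifP => // _; rewrite ge_min lexx orbT.
pose F c := 1 - Ft c / X.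
have F01 c : 0 <= F c <= 1.
  by rewrite /F subr_ge0 ler_pdivrMr// mul1r FtX lerBlDr lerDl divr_ge0// ltW.
have step1 : psum l [::] (closed_at j) (fun g => \prod_(i < n)
    mean_payoff (hit_prob G (pr g) (T i) (vtx i)) (pr g (vtx i) (u i)) H) <=
   X * rtn j l - X * psum l [::] (closed_at j)
     (fun g => \sum_(c <- pths G N v0) kw (markov v0 (pr g)) [::] c * F c).
  have -> : X * rtn j l = psum l [::] (closed_at j) (fun=> X * 1).
    by rewrite psumZ rtn_psum.
  rewrite -mulNr -psumZ -psumD.
  have E g : X * 1 + - X * \sum_(c <- pths G N v0) kw (markov v0 (pr g)) [::] c * F c =
     \sum_(c <- pths G N v0) kw (markov v0 (pr g)) [::] c * Ft c.
    have p_sum x : \sum_(y <- nbr x) pr g x y = 1 by exact: sum_pr.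
    rewrite -(@sum_markov _ _ G v0 (pr g) p_sum N [::]) !mulr_sumr -big_split.
    apply: eq_bigr => c _; rewrite /F /=; field.
    by rewrite gt_eqF.
  apply: psum_le => // g.
  - move=> pg cl _; split=> //; rewrite E; apply: markov_payoff_le => //.
    + by move=> x y; exact: pr_ge0.
    + by move=> x; exact: sum_pr.
    + by move=> i /stages[].
  - apply: prodr_ge0 => i _; apply: mean_payoff_ge0.
    + by apply: hit_prob_ge0 => x y; exact: pr_ge0.
    + by apply: pr_le1 => //; case: (stages i (ltn_ord i)).
  - rewrite E; apply: sumr_ge0 => c _; rewrite mulr_ge0// kw_ge0//.
    by move=> g' u'; exact: pr_ge0.
have step2 := mix N F (leqnn N) F01.
have step3 : \sum_(h <- pths G l v0 | (j + N.+1 <= count_mem v0 h)%N)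
    kw stp [::] h * F (take N h) =
    rtn (j + N.+1) l - X^-1 * \sum_(h <- pths G l v0 | (j + N.+1 <= count_mem v0 h)%N)
    kw stp [::] h * Ft (take N h).
  rewrite mulr_sumr -sumrB; apply: eq_bigr => h _; rewrite /F.
  by rewrite mulrBr mulr1; congr (_ - _); rewrite mulrA mulrC.
have step4 : \sum_(h <- pths G l v0 | (j + N.+1 <= count_mem v0 h)%N)
    kw stp [::] h * Ft (take N h) <= \prod_(i < n) A i + X * (2 * eta).
  apply: (@le_trans _ _ (\sum_(h <- pths G l v0) kw stp [::] h * P (take N h) +
    X * \sum_(h <- pths G l v0 | (j + N.+1 <= count_mem v0 h)%N)
     kw stp [::] h * (~~ well_visited H B (take N h))%:R)).
    rewrite mulr_sumr [X in X <= _]big_mkcond [X in _ <= _ + X]big_mkcond -big_split.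
    apply: ler_sum => h _ /=; case: ifP => _; last by rewrite addr0 mulr_ge0// kw_ge0.
    rewrite mulrCA -mulrDr ler_wpM2l ?kw_ge0//.
    case: (boolP (well_visited H B (take N h))) => wv /=.
      rewrite mulr0 addr0 /Ft ifT ?ge_min ?lexx//.
      apply/forallP => i; move/allP: wv; apply.
      by case: (stages i (ltn_ord i)).
    by rewrite mulr1; apply: le_trans (FtX _) _; rewrite lerDr.
  apply: lerD; last by rewrite ler_pM2l.
  have -> : \sum_(h <- pths G l v0) kw stp [::] h * P (take N h) =
    \sum_(c <- pths G N v0) kw stp [::] c * P c.
    by have := @sum_take _ _ _ lf v0 a a_ge4 deg_gt0 N l [::] P Nl.
  by apply: lrrw_payoff_le => // i /stages[].
rewrite step3 in step2.
set S1 := psum _ _ _ _ in step1 *; set S2 := psum _ _ _ _ in step1 step2.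
set S3 := \sum_(_ <- _ | _) _ in step2 step4.
apply: le_trans step1 _.
have h1 : X * (rtn (j + N.+1) l - X^-1 * S3 - eta) <= X * S2 by rewrite ler_pM2l.
have h2 : X * (rtn (j + N.+1) l - X^-1 * S3 - eta) = X * rtn (j + N.+1) l - S3 - X * eta.
  by field; rewrite gt_eqF.
have h3 : X * rtn j l <= X * (q + eta) by rewrite ler_pM2l.
have h4 : X * (q - eta) <= X * rtn (j + N.+1) l by rewrite ler_pM2l.
rewrite -/X; rewrite h2 in h1.
rewrite !mulrDr in h3; rewrite mulrBr in h4; lra.
Qed.

End Ratios.

(** Geometric sum: for [0 < pu] and large [H] the mean payoff tends to [pT / pu], the ratio of
    transition probabilities to be estimated. *)
Lemma mean_payoffM (R : realType) (pT pu : R) H :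
  mean_payoff pT pu H * pu = pT * (1 - (1 - pu) ^+ H).
Proof.
elim: H => [|H IH] /=; first by rewrite mul0r expr0 subrr mulr0.
by rewrite mulrDl -mulrA IH exprS; ring.
Qed.

Lemma mean_payoff1_ge (R : realType) (pu : R) H : 0 <= pu -> pu <= 1 ->
  H%:R * (1 - pu) ^+ H <= mean_payoff 1 pu H.
Proof.
move=> p0 p1; elim: H => [|H IH] /=; first by rewrite mul0r.
rewrite -natr1 mulrDl mul1r addrC; apply: lerD.
  by rewrite exprn_ile1// ?subr_ge0// gerBl.
by rewrite exprS mulrCA ler_wpM2l// subr_ge0.
Qed.

Lemma bernoulli_ge (R : realType) (t : R) k : 0 <= t -> t <= 1 ->
  1 - k%:R * t <= (1 - t) ^+ k.
Proof.
move=> t0 t1; elim: k => [|k IH]; first by rewrite mul0r subr0.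
rewrite exprS; apply: le_trans (_ : (1 - t) * (1 - k%:R * t) <= _); last first.
  by rewrite ler_wpM2l// subr_ge0.
have : 0 <= k%:R * (t * t) by rewrite !mulr_ge0.
rewrite -natr1; have -> : (1 - t) * (1 - k%:R * t) = 1 - (k%:R + 1) * t + k%:R * (t * t) by ring.
lra.
Qed.

Section Network.
Variables (R : realType) (V : choiceType) (G : graph V).
Hypothesis lf : locally_finite G.
Variables (v0 : V) (a : R) (K : nat).
Hypothesis a_ge4 : 4 <= a.
Hypothesis deg_gt0 : forall v, (0 < degree G v)%N.
Hypothesis degK : forall v, (degree G v <= K)%N.

Notation nbr := (neighbors G).
Notation stp := (step_prob G v0 a).
Notation pr := (edge_prob G v0 a).
Notation ball := (ball G v0).
Notation psum := (path_sum G v0 stp).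
Notation closed_at := (closed_at v0).
Notation well_visited := (well_visited G v0).
Notation kap := (kappa a K).

Let a_gt0 : 0 < a. Proof. exact: lt_le_trans a_ge4. Qed.
Let stp0 : forall g u, 0 <= stp g u. Proof. exact: stp_ge0. Qed.
Let kap0 : 0 <= kap.
Proof. by rewrite divr_ge0 ?(ltW a_gt0)// addr_ge0// mulr_ge0. Qed.

Definition stage_vtx (p : seq V) (i : nat) : V := nth v0 (v0 :: p) i.
(** The default of [nth] matters: at the last stage [i = size p] the successor is [y]. *)
Definition stage_next (p : seq V) (y : V) (i : nat) : V := nth y p i.
(** [v0] has no previous vertex; counting all successors there puts its total weight into the
    numerator of the ratio. *)
Definition stage_prev (p : seq V) (i : nat) : pred V :=
  if i is i'.+1 then pred1 (stage_vtx p i') else predT.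

Lemma hit_prob_predT g x : hit_prob G (pr g) predT x = 1.
Proof.
rewrite -(sum_pr v0 a_gt0 deg_gt0 g x); apply: eq_bigr => w _.
by rewrite mulr1.
Qed.

Lemma hit_prob_pred1 g x t : t \in nbr x -> hit_prob G (pr g) (pred1 t) x = pr g x t.
Proof.
move=> tx; rewrite /hit_prob (bigD1_seq t) ?fset_uniq//= eqxx mulr1 big1 ?addr0//.
by move=> w /negPf ->; rewrite mulr0.
Qed.

(* The conductance ratio is a product of ratios of transition probabilities along
   a geodesic, each of which is the mean of a payoff. *)
Lemma ratio_telescope g p y : path G v0 p ->
  \prod_(i < (size p).+1) (hit_prob G (pr g) (stage_prev p i) (stage_vtx p i) /
     pr g (stage_vtx p i) (stage_next p y i)) =
  Wv G v0 a g v0 / Wt v0 a g (last v0 p) y.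
Proof.
elim/last_ind: p y => [|p x IH] y.
  by rewrite big_ord_recl big_ord0 mulr1 hit_prob_predT /edge_prob invf_div mul1r.
rewrite rcons_path => /andP[pp lx].
rewrite size_rcons big_ord_recr.
have -> : \prod_(i < (size p).+1) (hit_prob G (pr g) (stage_prev (rcons p x) i) (stage_vtx (rcons p x) i) /
     pr g (stage_vtx (rcons p x) i) (stage_next (rcons p x) y i)) =
   \prod_(i < (size p).+1) (hit_prob G (pr g) (stage_prev p i) (stage_vtx p i) /
     pr g (stage_vtx p i) (stage_next p x i)).
  have vE k : (k <= size p)%N -> stage_vtx (rcons p x) k = stage_vtx p k.
    by move=> kp; rewrite /stage_vtx -rcons_cons nth_rcons /= ltnS kp.
  apply: eq_bigr => i _; have ip : (i <= size p)%N by rewrite -ltnS.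
  have nE : stage_next (rcons p x) y i = stage_next p x i.
    rewrite /stage_next nth_rcons; case: ltngtP ip => // [ip _|-> _].
      exact: set_nth_default.
    by rewrite nth_default.
  rewrite vE// nE; congr (hit_prob _ _ _ _ / _).
  by case: (i : nat) ip => [|k] kp //=; rewrite vE// ltnW.
rewrite IH// last_rcons.
have v1 : stage_vtx (rcons p x) (@ord_max (size p).+1) = x.
  by rewrite /stage_vtx /= nth_rcons ltnn eqxx.
have v2 : stage_prev (rcons p x) (@ord_max (size p).+1) = pred1 (last v0 p).
  by rewrite /stage_prev /stage_vtx /= -rcons_cons nth_rcons /= leqnn (last_nth v0).
have v3 : stage_next (rcons p x) y (@ord_max (size p).+1) = y.
  by rewrite /stage_next nth_default// size_rcons.
rewrite v1 v2 v3 hit_prob_pred1; last by rewrite in_nbr// adj_sym.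
rewrite /edge_prob (WtC v0 a g x (last v0 p)).
by rewrite /=; field; rewrite !gt_eqF ?Wt_gt0 ?Wv_gt0.
Qed.

(** The path is made simple because the stages of a product of payoffs must sit at distinct
    vertices. *)
Lemma ball_walk k x : x \in ball k ->
  exists p, [/\ path G v0 p, last v0 p = x, uniq (v0 :: p) & (size p <= k)%N].
Proof.
move=> xk.
have [p [pp lp sp]] : exists p, [/\ path G v0 p, last v0 p = x & (size p <= k)%N].
  elim: k x xk => [|k IH] x; first by rewrite inE => /eqP ->; exists [::].
  rewrite ballS// => /orP[/IH[p [pp lp sp]]|/hasP[y /IH[p [pp lp sp]] yx]].
    by exists p; split=> //; exact: leqW.
  by exists (rcons p x); rewrite ?last_rcons rcons_path pp lp size_rcons.
case/shortenP: pp lp => p' pp' up' sub lp; exists p'; split=> //.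
apply: leq_trans sp; apply: uniq_leq_size; first by case/andP: up'.
exact: sub.
Qed.

Lemma ball_lvl M x : x \in ball M -> x \in ball (lvl G v0 M x).
Proof.
move=> xM; apply/negPn/negP => xl.
have nb i : (i <= lvl G v0 M x)%N -> x \notin ball i.
  by move=> il; apply: contraNN xl; exact: ball_sub.
have lM : (lvl G v0 M x < M)%N.
  by rewrite ltnNge; apply/negP => /nb; rewrite xM.
have : (\sum_(i < (lvl G v0 M x).+1) 1 <= lvl G v0 M x)%N.
  rewrite {2}/lvl (big_ord_widen M (fun=> 1%N) lM) big_mkcond /=.
  by apply: leq_sum => i _; case: ifP => // il; rewrite nb// -ltnS.
by rewrite sum1_card card_ord ltnn.
Qed.

(* In a light network every edge out of the ball's vertices is likely to be taken
   within [H] independent trials. *)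
Definition light (H : nat) (tau : R) (B : nat) (g : seq V) : bool :=
  all (fun z => (1 - pr g z.1 z.2) ^+ H <= tau) [seq (x, y) | x <- ball B, y <- nbr x].

Variables (q eta : R) (N j l B H : nat).
Hypotheses (H_gt0 : (0 < H)%N) (eta_ge0 : 0 <= eta).
Hypothesis mix : mixture G v0 a q N eta j l.
Hypothesis obs : \sum_(h <- pths G l v0 | (j + N.+1 <= count_mem v0 h)%N)
    kw stp [::] h * (~~ well_visited H B (take N h))%:R <= 2 * eta.
Variable tau : R.
Hypotheses (tau_gt0 : 0 < tau) (tauB : tau * (2 * (B.+1)%:R) <= 1).

(** On a light network the mean payoff of each stage is at least [1 - tau] times its ratio of
    probabilities, and by [tauB] the loss over at most [B.+1] stages is at most a factor 2. So the
    bound on mean payoffs carries over to the conductance ratio. *)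
Lemma mixture_edge x y : x \in ball B -> y \in nbr x ->
  psum l [::] (fun g => closed_at j g && light H tau B g)
    (fun g => Wv G v0 a g v0 / Wt v0 a g x y) <=
  2 * ((K%:R + kap) * (1 + kap) ^+ lvl G v0 B x + 5 * eta * H%:R ^+ B.+1).
Proof.
move=> xB yx.
have [p [pp lp up sp]] := ball_walk (ball_lvl xB).
have lB : (lvl G v0 B x <= B)%N.
  rewrite /lvl; apply: (@leq_trans (\sum_(i < B) 1)%N).
    by apply: leq_sum => i _; exact: leq_b1.
  by rewrite sum1_card card_ord.
have spB : (size p <= B)%N by exact: leq_trans lB.
pose n := (size p).+1.
pose A i : R := if i is 0%N then K%:R + kap else 1 + kap.
pose M g : R := \prod_(i < n)
    mean_payoff (hit_prob G (pr g) (stage_prev p i) (stage_vtx p i))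
      (pr g (stage_vtx p i) (stage_next p y i)) H.
have vB i : (i < n)%N -> stage_vtx p i \in ball B.
  move=> ilt; have -> : stage_vtx p i = last v0 (take i p).
    rewrite (last_nth v0) size_takel// -[v0 :: take i p]/(take i.+1 (v0 :: p)) nth_take//.
  apply: (@ball_sub _ _ lf v0 (size (take i p))).
    by rewrite size_takel//; apply: leq_trans spB; rewrite -ltnS.
  by apply: path_ball => //; exact: take_path.
have adjn i : (i < size p)%N -> G (stage_vtx p i) (stage_vtx p i.+1).
  by move=> ilt; exact: (pathP v0 pp).
have nb i : (i < n)%N -> stage_next p y i \in nbr (stage_vtx p i).
  rewrite ltnS leq_eqVlt => /orP[/eqP ->|ilt].
    by rewrite /stage_next nth_default// /stage_vtx -(last_nth v0) lp.
  rewrite in_nbr// /stage_next (set_nth_default v0)//.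
  exact: adjn.
have st i : (i < n)%N -> [/\ stage_next p y i \in nbr (stage_vtx p i), 0 <= A i,
    payoff_drift G v0 a (A i) (stage_vtx p i) (stage_next p y i) (stage_prev p i)
    & stage_vtx p i \in ball B].
  move=> ilt; split; [exact: nb| |
   |exact: vB].
    by case: i {ilt} => [|i] /=; rewrite addr_ge0.
  case: i ilt => [|i] ilt /=; first by apply: drift_predT => //; exact: nb.
  apply: drift_pred1 => //; first exact: nb.
  by rewrite in_nbr// adj_sym; exact: adjn.
have inj i k : (i < n)%N -> (k < n)%N -> stage_vtx p i = stage_vtx p k -> i = k.
  move=> il kl /eqP; rewrite /stage_vtx nth_uniq//.
  by move/eqP.
have HM : psum l [::] (closed_at j) M <= \prod_(i < n) A i + 5 * eta * H%:R ^+ n.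
  exact: (mixture_payoff lf a_ge4 deg_gt0 H_gt0 mix obs inj st).
have tau1 : tau <= 1.
  have B2 : 1 <= 2 * (B.+1)%:R :> R by rewrite -natrM ler1n.
  by apply: le_trans tauB; rewrite -[leLHS]mulr1 ler_pM2l.
have tn : 2^-1 <= (1 - tau) ^+ n.
  apply: le_trans (bernoulli_ge n (ltW tau_gt0) tau1).
  have : n%:R * tau <= (B.+1)%:R * tau by rewrite ler_pM2r// ler_nat.
  have : 2 * ((B.+1)%:R * tau) <= 1 by move: tauB; rewrite mulrCA [tau * _]mulrC.
  set z := _ * tau; lra.
have M0 g : 0 <= M g.
  apply: prodr_ge0 => i _; apply: mean_payoff_ge0.
    by apply: hit_prob_ge0 => *; exact: pr_ge0.
  by apply: pr_le1 => //; exact: nb.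
have WM g : light H tau B g -> Wv G v0 a g v0 / Wt v0 a g x y <= 2 * M g.
  move=> /allP lg; rewrite -lp -ratio_telescope//.
  have le i : (i < n)%N -> hit_prob G (pr g) (stage_prev p i) (stage_vtx p i) /
     pr g (stage_vtx p i) (stage_next p y i) * (1 - tau) <=
     mean_payoff (hit_prob G (pr g) (stage_prev p i) (stage_vtx p i))
      (pr g (stage_vtx p i) (stage_next p y i)) H.
    move=> ilt; set hp := hit_prob _ _ _ _; set pu := pr _ _ _.
    have pu0 : 0 < pu by rewrite divr_gt0 ?Wt_gt0 ?Wv_gt0.
    have hp0 : 0 <= hp by apply: hit_prob_ge0 => *; exact: pr_ge0.
    rewrite mulrAC ler_pdivrMr// mean_payoffM ler_wpM2l// lerD2l lerN2.
    apply: (lg (stage_vtx p i, stage_next p y i)).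
    by apply/allpairsPdep; exists (stage_vtx p i), (stage_next p y i); rewrite vB// nb.
  have : \prod_(i < n) (hit_prob G (pr g) (stage_prev p i) (stage_vtx p i) /
     pr g (stage_vtx p i) (stage_next p y i) * (1 - tau)) <= M g.
    apply: ler_prod => i _; rewrite le// andbT mulr_ge0 ?subr_ge0//.
    by rewrite divr_ge0 ?pr_ge0//; apply: hit_prob_ge0 => *; exact: pr_ge0.
  rewrite big_split /= prodr_const card_ord => h.
  rewrite -ler_pdivrMl// mulrC; apply: le_trans h; rewrite ler_wpM2l//.
  apply: prodr_ge0 => i _; rewrite divr_ge0 ?pr_ge0//.
  by apply: hit_prob_ge0 => *; exact: pr_ge0.
apply: (@le_trans _ _ (psum l [::] (closed_at j) (fun g => 2 * M g))).
  apply: psum_le => // [g _ /andP[-> lg] _|g|g]; first by split=> //; exact: WM.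
  - by rewrite divr_ge0 ?Wv_ge0 ?ltW ?Wt_gt0.
  - by rewrite mulr_ge0.
rewrite psumZ ler_pM2l//; apply: le_trans HM _; apply: lerD.
  rewrite big_ord_recl /= ler_wpM2l ?addr_ge0// prodr_const card_ord.
  by rewrite ler_weXn2l// lerDl.
rewrite ler_wpM2l ?mulr_ge0// ler_weXn2l ?ler1n//.
Qed.

(** An edge that violates lightness gives the one-stage payoff that counts all successors a mean of
    at least [H * tau], whereas averaged over networks this mean is at most [K + kap + 5 * eta * H].
    Markov's inequality and a union bound over edges conclude. *)
Lemma mixture_heavy :
  psum l [::] (fun g => closed_at j g && ~~ light H tau B g) (fun=> 1) <=
  (size [seq (x, y) | x <- ball B, y <- nbr x])%:R *
    ((K%:R + kap + 5 * eta * H%:R) / (H%:R * tau)).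
Proof.
have HH : 0 < H%:R * tau by rewrite mulr_gt0// ltr0n.
have pos : 0 <= K%:R + kap + 5 * eta * H%:R by rewrite !addr_ge0// !mulr_ge0.
apply: (@le_trans _ _ (psum l [::] (fun g => closed_at j g &&
   has (fun z : V * V => tau < (1 - pr g z.1 z.2) ^+ H)
    [seq (x, y) | x <- ball B, y <- nbr x]) (fun=> 1))).
  apply: psum_le => // g _ /andP[-> nl] _; split=> //=.
  by move: nl; rewrite /light -has_predC; apply: sub_has => z /=; rewrite -ltNge.
apply: (psum_has lf a_ge4 (P := fun (z : V * V) g => tau < (1 - pr g z.1 z.2) ^+ H)) => //.
move=> _ /allpairsPdep[x [y [xB yx ->]]] /=.
have HM : psum l [::] (closed_at j) (fun g => \prod_(i < 1)
    mean_payoff (hit_prob G (pr g) predT x) (pr g x y) H) <=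
    \prod_(i < 1) (K%:R + kap) + 5 * eta * H%:R ^+ 1.
  apply: (mixture_payoff lf a_ge4 deg_gt0 H_gt0 mix obs
    (vtx := fun=> x) (u := fun=> y) (T := fun=> predT) (A := fun=> K%:R + kap)).
    by case=> [|i] [|k].
  by move=> i _; split=> //; [rewrite addr_ge0|exact: drift_predT].
rewrite big_ord_recl big_ord0 mulr1 expr1 in HM.
rewrite mulrC; apply: (@le_trans _ _ ((H%:R * tau)^-1 * psum l [::] (closed_at j) (fun g => \prod_(i < 1)
    mean_payoff (hit_prob G (pr g) predT x) (pr g x y) H))); last first.
  by rewrite ler_pM2l// invr_gt0.
have m0 g : 0 <= \prod_(i < 1) mean_payoff (hit_prob G (pr g) predT x) (pr g x y) H.
  apply: prodr_ge0 => i _; apply: mean_payoff_ge0.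
    by apply: hit_prob_ge0 => *; exact: pr_ge0.
  exact: pr_le1.
rewrite -psumZ; apply: psum_le => // g; last by rewrite mulr_ge0// invr_ge0 ltW.
move=> _ /andP[-> tg] _; split=> //.
rewrite mulrC ler_pdivlMr// mul1r big_ord_recl big_ord0 mulr1 hit_prob_predT.
apply: le_trans (mean_payoff1_ge H _ _); [|exact: pr_ge0|exact: pr_le1].
by rewrite ler_pM2l ?ltr0n// ltW.
Qed.

End Network.

Lemma pow_small (R : realType) (t d : R) : 0 < t -> t <= 1 -> 0 < d ->
  exists m, (1 - t) ^+ m <= d.
Proof.
move=> t0 t1 d0.
have key m : (1 - t) ^+ m * (1 + m%:R * t) <= 1.
  elim: m => [|m IH]; first by rewrite mul0r addr0 mulr1.
  apply: le_trans IH; rewrite exprSr -mulrA ler_wpM2l ?exprn_ge0 ?subr_ge0//.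
  have : 0 <= (m%:R + 1) * (t * t) by rewrite !mulr_ge0// ?addr_ge0// ltW.
  rewrite -natr1; have -> : (1 - t) * (1 + (m%:R + 1) * t) = 1 + m%:R * t - (m%:R + 1) * (t * t) by ring.
  lra.
pose m := (Num.truncn ((d * t)^-1)).+1; exists m.
have mt : (d * t)^-1 <= m%:R by apply/ltW; rewrite /m; apply: truncnS_gt.
have mt0 : 0 <= m%:R * t by rewrite mulr_ge0// ltW.
have dm : 1 <= d * (m%:R * t).
  rewrite mulrCA -ler_pdivrMr; first by rewrite div1r.
  by rewrite mulr_gt0.
have p0 : 0 <= (1 - t) ^+ m by rewrite exprn_ge0// subr_ge0.
have km := key m.
have h1 : 0 < 1 + m%:R * t by rewrite ltr_pwDl.
rewrite -(ler_pM2r h1); apply: le_trans km _; rewrite mulrDr mulr1.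
by apply: le_trans dm _; rewrite lerDr ltW.
Qed.

(** * Vanishing of the probability of many returns *)

Section Vanish.
Variables (R : realType) (V : choiceType) (G : graph V).
Hypothesis lf : locally_finite G.
Variables (v0 : V) (a : R) (K : nat) (c : R).
Hypothesis a_ge4 : 4 <= a.
Hypothesis deg_gt0 : forall v, (0 < degree G v)%N.
Hypothesis degK : forall v, (degree G v <= K)%N.
Hypothesis c_gt0 : 0 < c.
Hypothesis expand : edge_expansion G c.

Notation nbr := (neighbors G).
Notation stp := (step_prob G v0 a).
Notation pr := (edge_prob G v0 a).
Notation ball := (ball G v0).
Notation psum := (path_sum G v0 stp).
Notation rtn := (return_mass G v0 a).
Notation closed_at := (closed_at v0).
Notation kap := (kappa a K).

Hypotheses (kap_le1 : kap <= 1) (kap_gap : 12 * K%:R * kap <= gap K c).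

Let a_gt0 : 0 < a. Proof. exact: lt_le_trans a_ge4. Qed.
Let stp0 : forall g u, 0 <= stp g u. Proof. exact: stp_ge0. Qed.
Let K_gt0 : (0 < K)%N. Proof. exact: leq_trans (deg_gt0 v0) (degK v0). Qed.
Let kap0 : 0 <= kap.
Proof. by rewrite divr_ge0 ?(ltW a_gt0)// addr_ge0// mulr_ge0. Qed.

Lemma psum_sum (I : Type) (r : seq I) (P : pred I) l S (F : I -> seq V -> R) :
  psum l [::] S (fun g => \sum_(i <- r | P i) F i g) =
  \sum_(i <- r | P i) psum l [::] S (F i).
Proof.
rewrite /path_sum exchange_big /=; apply: eq_bigr => k _.
by rewrite exchange_big /=; apply: eq_bigr => g _; rewrite mulr_sumr.
Qed.

(** [16 / gap] is the weighted energy of [potential_decay]; the other factor comes from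
    [mixture_edge], with 1 for the truncation error. *)
Definition energy_bound : R := 2 * (K%:R + kap + 1) * (16 / gap K c).

Lemma energy_bound_gt0 : 0 < energy_bound.
Proof.
rewrite !mulr_gt0 ?invr_gt0 ?gap_gt0//.
by rewrite ltr_wpDl// addr_ge0.
Qed.

Let Z (N : nat) (u : V -> R) (g : seq V) := flow_energy G v0 (Wt v0 a g) N u.

(** The energy is linear in the ratios [W(v0) / W(e)], whose means grow at most like
    [(1 + kap) ^+ lvl], within the weight of [potential_decay]. The radius [N1.+1] covers all edges
    that carry flow. *)
Lemma mean_energy q eta N j l (N1 H : nat) tau u : (0 < H)%N -> 0 <= eta ->
  mixture G v0 a q N eta j l ->
  \sum_(h <- pths G l v0 | (j + N.+1 <= count_mem v0 h)%N)
    kw stp [::] h * (~~ well_visited G v0 H N1.+1 (take N h))%:R <= 2 * eta ->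
  0 < tau -> tau * (2 * (N1.+2)%:R) <= 1 -> 5 * eta * H%:R ^+ N1.+2 <= 1 ->
  unit_potential G v0 N1 u ->
  psum l [::] (fun g => closed_at j g && light G v0 a H tau N1.+1 g) (Z N1 u) <=
  energy_bound.
Proof.
move=> H0 e0 mix obs t0 tB eH up.
rewrite /Z /flow_energy psumZ /edge_sum psum_sum.
under eq_bigr do rewrite psum_sum.
have dec := @potential_decay R V G lf v0 K c K_gt0 degK c_gt0 expand N1 N1.+1 kap u up kap0 kap_le1 kap_gap.
rewrite /energy_bound; apply: le_trans (ler_wpM2l _ dec); last first.
  by rewrite mulr_ge0// addr_ge0// addr_ge0.
rewrite mulrCA ler_pM2l// /edge_sum mulr_sumr.
rewrite big_seq [leRHS]big_seq; apply: ler_sum => x xB.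
rewrite mulr_sumr; apply: ler_sum => y xy.
rewrite psumZ mulrC [leRHS]mulrA ler_wpM2r ?sqr_ge0//.
have yx : y \in nbr x by rewrite in_nbr.
have := mixture_edge lf a_ge4 deg_gt0 degK H0 e0 mix obs t0 tB xB yx.
move=> h; apply: le_trans h _.
set lv := lvl _ _ _ _.
rewrite -[leRHS]mulrA ler_pM2l//.
have L1 : (1 + kap) ^+ lv <= (1 + kap) ^+ (2 * lv).
  by rewrite ler_weXn2l ?lerDl// mul2n -addnn leq_addr.
have L2 : 1 <= (1 + kap) ^+ (2 * lv) by rewrite exprn_ege1// lerDl.
rewrite [leRHS]mulrDl mul1r; apply: lerD; last by apply: le_trans eH _.
by rewrite ler_wpM2l// addr_ge0.
Qed.

(** A walk with very many returns has made [m] of them by time [N], up to mass [d]. In a frozen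
    network this has probability at most [(1 - Z^-1) ^+ m]: light networks with [Z <= z], light ones
    with [Z > z] and the others contribute at most [d] each, and the approximation errors raise the
    total to [6 * d]. *)
Lemma rtn_vanish (eps : R) : 0 < eps -> exists m, forall l, rtn m l <= eps.
Proof.
move=> eps0.
have [q q0 [lim1 lim2]] := rtn_limits lf v0 a_ge4 deg_gt0.
suff qd d : 0 < d -> q <= 6 * d.
  have q00 : q <= 0.
    rewrite leNgt; apply/negP => qp; have := qd (q / 12); rewrite divr_gt0// => /(_ isT).
    lra.
  have [m0 Hm0] := lim1 eps eps0.
  by exists m0 => l; apply: le_trans (Hm0 m0 l (leqnn _)) _; rewrite gerDr.
move=> d0.
have C0 := energy_bound_gt0.
(* Chosen for Markov's inequality: light networks with energy above [z] have mass at most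
   [energy_bound / z <= d]. *)
pose z := energy_bound / d + 1.
have z1 : 1 <= z by rewrite lerDr divr_ge0 ?ltW.
have z0 : 0 < z by exact: lt_le_trans z1.
have Cz : energy_bound / z <= d.
  rewrite ler_pdivrMr// /z mulrDr mulr1 mulrC divfK ?gt_eqF//.
  by rewrite lerDl ltW.
have [m Hm] : exists m, (1 - z^-1) ^+ m <= d.
  by apply: pow_small => //; rewrite ?invr_gt0// invf_le1.
have [N HN] := rtn_stable lf v0 a_ge4 deg_gt0 m d0.
pose B := N.+1.
pose tau : R := (2 * (B.+1)%:R)^-1.
have t0 : 0 < tau by rewrite invr_gt0 mulr_gt0.
have tB : tau * (2 * (B.+1)%:R) <= 1 by rewrite mulVf// mulf_neq0// pnatr_eq0.
pose E : R := (size [seq (x, y) | x <- ball B, y <- nbr x])%:R.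
(* [D <= H] brings the bound of [mixture_heavy] below [d] as soon as [5 * eta * H <= 1]. *)
pose D : R := E * (K%:R + kap + 1) / (tau * d).
pose H := (Num.truncn D).+1.
have HD : D <= H%:R by apply/ltW; rewrite /H; apply: truncnS_gt.
have H0 : 0 < H%:R :> R by rewrite ltr0n.
have HB0 : 0 < 5 * H%:R ^+ B.+1 :> R by rewrite mulr_gt0// exprn_gt0.
(* Only now, with [H] fixed, can the truncation error [5 * eta * H ^+ B.+1] be brought below 1. *)
pose eta := Num.min d (5 * H%:R ^+ B.+1)^-1.
have e0 : 0 < eta by rewrite lt_min d0 invr_gt0.
have ed : eta <= d by rewrite ge_min lexx.
have eH : 5 * eta * H%:R ^+ B.+1 <= 1.
  rewrite mulrAC -ler_pdivlMl// mulr1 ge_min lexx orbT//.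
have eH1 : 5 * eta * H%:R <= 1.
  apply: le_trans eH; rewrite ler_pM2l ?mulr_gt0//.
  by rewrite -[leLHS]expr1 ler_weXn2l// ler1n.
have [j1 [N0 obs]] := late_unvisited lf v0 a_ge4 deg_gt0 degK H B e0.
pose N2 := maxn N N0.
have [j [l [jj Nl up lo mx]]] := approx_mixture lf a_ge4 deg_gt0 degK N2 (maxn j1 m) e0 lim1 lim2.
have mix : mixture G v0 a q N2 eta j l by split.
have {}obs : \sum_(h <- pths G l v0 | (j + N2.+1 <= count_mem v0 h)%N)
    kw stp [::] h * (~~ well_visited G v0 H B (take N2 h))%:R <= 2 * eta.
  apply: obs => //; first exact: leq_maxr.
  by apply: leq_trans (leq_addr _ _); apply: leq_trans jj; exact: leq_maxl.
have [u pot] := unit_potential_exists lf v0 K_gt0 degK c_gt0 expand N.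
have ME := mean_energy (isT : (0 < H)%N) (ltW e0) mix obs t0 tB eH pot.
have MH := mixture_heavy lf a_ge4 deg_gt0 degK (isT : (0 < H)%N) (ltW e0) mix obs t0.
have MHd : psum l [::] (fun g => closed_at j g && ~~ light G v0 a H tau B g) (fun=> 1) <= d.
  apply: le_trans MH _; rewrite -/E.
  apply: (@le_trans _ _ (E * ((K%:R + kap + 1) / (H%:R * tau)))).
    by rewrite ler_wpM2l// ler_pM2r ?invr_gt0 ?mulr_gt0// lerD2l.
  rewrite mulrA ler_pdivrMr ?mulr_gt0//.
  by move: HD; rewrite /D ler_pdivrMr ?mulr_gt0// [d * _]mulrC -mulrA.
have NN2 : (N <= N2)%N by rewrite leq_maxl.
have Nl' : (N <= l)%N by exact: leq_trans Nl.
pose F (c0 : seq V) : R := (m <= count_mem v0 c0)%N%:R.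
have F01 c0 : 0 <= F c0 <= 1 by rewrite /F; case: (m <= _)%N; rewrite ?lexx ler01.
have := mx N F NN2 F01.
set S1 := \sum_(_ <- _ | _) _; set S2 := psum _ _ _ _ => h1.
(* With [j + N2.+1] returns there are at least [m], because [m <= j]; an m-th return between [N] and
   [l] has mass at most [d] by the choice of [N]. *)
have h2 : rtn (j + N2.+1) l - d <= S1.
  have s1 : \sum_(h <- pths G l v0) kw stp [::] h * F (take N h) = rtn m N.
    have := @sum_take _ _ _ lf v0 a a_ge4 deg_gt0 N l [::] F Nl' => /= ->.
    rewrite /return_mass [RHS]big_mkcond; apply: eq_bigr => c1 _; rewrite /F.
    by case: ifP; rewrite ?mulr1 ?mulr0.
  have s2 : rtn (j + N2.+1) l <= S1 + (rtn m l - rtn m N).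
    rewrite -s1 /return_mass /S1 [X in X <= _]big_mkcond [X in _ <= X + _]big_mkcond.
    rewrite [X in _ <= _ + (X - _)]big_mkcond -sumrB -big_split; apply: ler_sum => h _ /=.
    have k0 : 0 <= kw stp [::] h by exact: kw_ge0.
    rewrite /F; have ct : (count_mem v0 (take N h) <= count_mem v0 h)%N.
      by rewrite -{2}(cat_take_drop N h) count_cat leq_addr.
    case: ifP => nh.
      have mj : (m <= j)%N by apply: leq_trans jj; exact: leq_maxr.
      have -> : (m <= count_mem v0 h)%N.
        by apply: leq_trans mj (leq_trans _ nh); exact: leq_addr.
      by rewrite addrC subrK.
    rewrite add0r; case: (leqP m (count_mem v0 (take N h))) => mt.
      by rewrite (leq_trans mt ct) mulr1 subrr.
    by rewrite mulr0 subr0; case: ifP.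
  have := HN N l (leqnn N); lra.
have h3 : S2 <= psum l [::] (fun g => closed_at j g && ~~ light G v0 a H tau B g) (fun=> 1) +
   (z^-1 * psum l [::] (fun g => closed_at j g && light G v0 a H tau B g) (Z N u) +
    d * psum l [::] (closed_at j) (fun=> 1)).
  have Z1 g : 1 <= Z N u g.
    have [] := @flow_energy_ret _ G lf v0 R (Wt v0 a g) (fun x y => Wt_gt0 v0 a_gt0 g x y)
      (fun x y => WtC v0 a g x y) deg_gt0 N u N pot (leqnn N); done.
  have ret g : \sum_(c0 <- pths G N v0) kw (markov v0 (pr g)) [::] c0 * F c0 <= (1 - (Z N u g)^-1) ^+ m.
    have := @returns_le _ G lf v0 R (Wt v0 a g) (fun x y => Wt_gt0 v0 a_gt0 g x y)
      (fun x y => WtC v0 a g x y) deg_gt0 N u m pot.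
    apply: le_trans; rewrite [leRHS]big_mkcond; apply: ler_sum => c1 _.
    by rewrite /F; case: ifP => _; rewrite ?mulr1 ?mulr0.
  rewrite -!psumZ; set bad := fun g => closed_at j g && ~~ _.
  set good := fun g => closed_at j g && light _ _ _ _ _ _ _.
  have -> : psum l [::] bad (fun=> 1) + (psum l [::] good (fun g => z^-1 * Z N u g) +
     psum l [::] (closed_at j) (fun=> d * 1)) = psum l [::] predT (fun g =>
      (if bad g then 1 else 0) + ((if good g then z^-1 * Z N u g else 0) +
      (if closed_at j g then d * 1 else 0))).
    by rewrite !psumD; congr (_ + (_ + _)); exact: psum_mkcond.
  rewrite /S2 psum_mkcond; apply: psum_le => // g.
  - move=> pg _ _; split=> //; rewrite /bad /good; case: ifP => cl /=; last by rewrite !addr0.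
    have x0 : 0 <= 1 - (Z N u g)^-1.
      by rewrite subr_ge0 invf_le1 ?Z1// (lt_le_trans _ (Z1 g)).
    have x1 : (1 - (Z N u g)^-1) ^+ m <= 1.
      by rewrite exprn_ile1// gerBl invr_ge0 (le_trans _ (Z1 g)).
    apply: le_trans (ret g) _; case: ifP => lg /=.
      by apply: le_trans x1 _; rewrite (negbTE lg) add0r mulr1 lerDl ltW.
    rewrite add0r mulr1; have lg' := negbFE lg; rewrite lg'.
    have [Zz|zZ] := leP (Z N u g) z.
      apply: (@le_trans _ _ ((1 - z^-1) ^+ m)).
        apply: lerXn2r => //; first by rewrite nnegrE subr_ge0 invf_le1.
        by rewrite lerD2l lerN2 lef_pV2// posrE; exact: lt_le_trans (Z1 g).
      apply: le_trans Hm _; rewrite lerDr mulr_ge0 ?invr_ge0 ?(ltW z0)//.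
      by rewrite (le_trans _ (Z1 g)).
    apply: le_trans x1 _; apply: (@le_trans _ _ (z^-1 * Z N u g)).
      by rewrite mulrC ler_pdivlMr// mul1r ltW.
    by rewrite lerDl ltW.
  - case: ifP => // _; apply: sumr_ge0 => c1 _; rewrite mulr_ge0 ?kw_ge0//.
      by move=> *; exact: pr_ge0.
  - apply: addr_ge0; first by case: ifP.
    apply: addr_ge0; case: ifP => // _; last by rewrite mulr1 ltW.
    by rewrite mulr_ge0 ?invr_ge0 ?(ltW z0)// (le_trans _ (Z1 g)).
have h4 : psum l [::] (closed_at j) (fun=> 1) <= 1 by rewrite -rtn_psum// rtn_le1.
have h5 : z^-1 * psum l [::] (fun g => closed_at j g && light G v0 a H tau B g) (Z N u) <= d.
  by apply: le_trans Cz; rewrite mulrC ler_pM2r// invr_gt0.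
have h6 : d * psum l [::] (closed_at j) (fun=> 1) <= d by rewrite ler_piMr// ltW.
lra.
Qed.

(** Many visits to the end of [p] give many exits from it and, by [few_exits] along the reversed
    path, many exits from [v0] up to mass [eps / 2]; [rtn_vanish] makes the latter unlikely. *)
Lemma visits_vanish p (eps : R) : path G v0 p -> 0 < eps -> exists m, forall l,
  \sum_(h <- pths G l v0 | (m <= count_mem (last v0 p) h)%N) kw stp [::] h <= eps.
Proof.
move=> pp e0; have e2 : 0 < eps / 2 by rewrite divr_gt0.
have [m0 Hm0] := rtn_vanish e2.
set v := last v0 p.
have [p' pp' lp'] : exists2 p', path G v p' & last v p' = v0.
  exists (rev (belast v0 p)).
    by rewrite rev_path; under eq_path do rewrite adj_sym.
  by rewrite /v; case: (p) => [//|y p1] /=; rewrite rev_cons last_rcons.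
have [n Hn] := few_exits lf v0 a_ge4 deg_gt0 degK m0.+1 pp' e2.
(* The last visit need not be followed by an exit, hence [n.+1]; likewise [m0.+1] exits from [v0]
   include the initial one, which is no return. *)
exists n.+1 => l.
have pf := @prefix_free_size V l.
have E (A : pred (seq V)) : \sum_(h <- pths G l v0 | A h) kw stp [::] h =
    psum l [::] (fun c => (size c == l) && A c) (fun=> 1).
  rewrite -(sum_pths_psum lf v0 stp l A (fun=> 1)); apply: eq_bigr => h _.
  by rewrite mulr1.
rewrite E; apply: (@le_trans _ _ (eps / 2 + eps / 2)); last by rewrite -splitr.
apply: le_trans (@psumU _ _ _ lf v0 stp stp0 l _
  (fun h => [&& size h == l, (n <= exits v0 h v)%N & (exits v0 h (last v p') < m0.+1)%N])
  (fun h => (size h == l) && (m0 <= count_mem v0 h)%N) _) _.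
  move=> h _ /andP[-> nh] /=; rewrite lp'.
  have := exits_balance v0 h v; have := exits_balance v0 h v0.
  rewrite eqxx => h0 hv.
  have -> /= : (n <= exits v0 h v)%N.
    by move: hv nh; clear; case: (last v0 h == v); case: (v0 == v) => /=; lia.
  case: (ltnP (exits v0 h v0) m0.+1) => //= hm.
  by move: h0 hm; clear; case: (last v0 h == v0) => /=; lia.
apply: lerD; first exact: Hn.
by rewrite -E; exact: Hm0.
Qed.

End Vanish.

(** * From path sums to almost sure statements about the process *)

Section History.
Local Open Scope classical_set_scope.
Variables (R : realType) (V : choiceType) (G : graph V).
Hypothesis lf : locally_finite G.
Variables (v0 : V) (a : R).
Hypothesis a_ge4 : 4 <= a.
Hypothesis deg_gt0 : forall v, (0 < degree G v)%N.

Notation stp := (step_prob G v0 a).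

Definition traj (c : seq V) : nat -> V := nth v0 (v0 :: c).

Lemma traj_last c : traj c (size c) = last v0 c.
Proof. exact: nth_last. Qed.

Lemma traj_rcons c w i : (i <= size c)%N -> traj (rcons c w) i = traj c i.
Proof. by move=> ic; rewrite /traj -rcons_cons nth_rcons /= ltnS ic. Qed.

Lemma traj_rcons_last c w : traj (rcons c w) (size c).+1 = w.
Proof. by rewrite /traj /= nth_rcons ltnn eqxx. Qed.

Lemma edge_count_traj c x y : edge_count (traj c) (size c) [fset x; y] = ucount v0 c x y.
Proof.
elim/last_ind: c => [|c w IH]; first by rewrite /edge_count big_ord0.
rewrite ucount_rcons -IH size_rcons /edge_count big_ord_recr /=.
rewrite traj_rcons// traj_rcons_last traj_last eq_sym; congr (_ + _)%N.
by apply: eq_bigr => i _; rewrite !traj_rcons// ltnW.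
Qed.

Lemma lrrw_step_traj c w : lrrw_step G a (traj c) (size c) w =
  stp c w * (G (last v0 c) w)%:R.
Proof.
rewrite /lrrw_step traj_last edge_count_traj /step_prob /edge_prob; congr (_ / _ * _).
rewrite /Wv big_split /= big_const_seq count_predT iter_addr_0 mulr_natl.
congr (_ + _); rewrite /vertex_count -natr_sum; congr _%:R.
by apply: eq_bigr => u _; rewrite edge_count_traj.
Qed.

Variables (d : measure_display) (T : measurableType d) (P : probability T R)
  (X : nat -> T -> V).

Definition event (c : seq V) : set T := history X (size c) (traj c).

Lemma eventE c t : event c t <-> X 0%N t = v0 /\ mkseq (fun i => X i.+1 t) (size c) = c.
Proof.
rewrite /event /history /=; split=> [h|[h0 h] [|i] ic].
- split; first by rewrite h.
  apply: (@eq_from_nth _ v0); rewrite size_mkseq// => i ic.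
  by rewrite nth_mkseq// h.
- by [].
- by rewrite /traj /= -h nth_mkseq.
Qed.

Lemma event_rcons c w :
  event (rcons c w) = [set t | X (size c).+1 t = w] `&` event c.
Proof.
apply/seteqP; split=> t.
  rewrite /event size_rcons => h; split.
    by have /= -> := h _ (leqnn _); rewrite traj_rcons_last.
  by move=> i ic; rewrite h 1?ltnW// traj_rcons.
rewrite /event size_rcons => -[/= h1 h2] i; rewrite leq_eqVlt => /predU1P[->|ic].
  by rewrite traj_rcons_last.
by rewrite traj_rcons// h2.
Qed.

Hypothesis XP : is_LRRW P G a v0 X.

Lemma event_measurable c : measurable (event c).
Proof.
have [mX _ _] := XP; elim/last_ind: c => [|c w IH]; last first.
  by rewrite event_rcons; apply: measurableI.
rewrite (_ : event [::] = [set t | X 0%N t = v0]); first exact: mX.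
by apply/seteqP; split=> t => [/(_ 0%N (leqnn _))|/= h [|]].
Qed.

(** The transition rule is given for histories of positive probability only; beyond a null history
    both sides vanish. *)
Lemma event_prob c : path G v0 c -> P (event c) = (kw stp [::] c)%:E.
Proof.
have [mX X0 Xstep] := XP; elim/last_ind: c => [|c w IH].
  move=> _; rewrite (_ : event [::] = [set t | X 0%N t = v0]) ?X0//.
  by apply/seteqP; split=> t => [/(_ 0%N (leqnn _))|/= h [|]].
rewrite rcons_path => /andP[pc cw].
have Pc := IH pc; rewrite kw_rcons /=.
have mc := event_measurable c.
have := event_measurable (rcons c w); rewrite event_rcons => mcw.
have [h0|h0] := eqVneq (P (event c)) 0%E.
  have -> : kw stp [::] c = 0 by move: h0; rewrite Pc => -[].
  rewrite mul0r; apply/eqP; rewrite eq_le measure_ge0 andbT.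
  apply: (@le_trans _ _ (P (event c))); last by rewrite h0.
  by apply: le_measure; rewrite ?inE//; exact: subIsetr.
have := Xstep _ _ w h0; rewrite lrrw_step_traj cw mulr1 /cond_prob -/(event c) => E.
rewrite -[LHS]fineK ?fin_num_measure//; congr EFin.
have h1 : fine (P (event c)) != 0.
  by move: h0; rewrite Pc; apply: contra => /eqP /= ->.
by rewrite -(divfK h1 (fine _)) E Pc mulrC.
Qed.

Definition events (l : nat) (A : pred (seq V)) : set T :=
  \big[setU/set0]_(c <- pths G l v0 | A c) event c.

Lemma events_measurable l A : measurable (events l A).
Proof. by apply: bigsetU_measurable => c _; exact: event_measurable. Qed.

Lemma eventsP l A t : events l A t <->
  [/\ X 0%N t = v0, path G v0 (mkseq (fun i => X i.+1 t) l) &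
      A (mkseq (fun i => X i.+1 t) l)].
Proof.
rewrite /events -bigcup_seq_cond; split.
  move=> [c] /= /andP[]; rewrite mem_pths// => /andP[/eqP<- pc] Ac /eventE[h0 h].
  by rewrite h.
move=> [h0 pc Ac]; exists (mkseq (fun i => X i.+1 t) l) => /=.
  by rewrite mem_pths// size_mkseq eqxx pc.
by apply/eventE; rewrite size_mkseq.
Qed.

Lemma event_disjoint c c' : size c = size c' -> c != c' -> event c `&` event c' = set0.
Proof.
move=> sc cc'; apply/seteqP; split=> // t [/eventE[_ h] /eventE[_ h']].
by move: cc'; rewrite -h -h' sc eqxx.
Qed.

Lemma events_prob l A :
  P (events l A) = (\sum_(c <- pths G l v0 | A c) kw stp [::] c)%:E.
Proof.
rewrite /events.
suff H s : uniq s -> {subset s <= pths G l v0} ->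
    P (\big[setU/set0]_(c <- s | A c) event c) =
    (\sum_(c <- s | A c) kw stp [::] c)%:E.
  by apply: H => //; exact: pths_uniq.
elim: s => [|c s IH]; first by rewrite !big_nil measure0.
rewrite cons_uniq => /andP[cs us] sub; rewrite !big_cons.
have sub' : {subset s <= pths G l v0} by move=> x xs; apply: sub; rewrite inE xs orbT.
have {}IH := IH us sub'; case: ifP => // Ac.
have : c \in pths G l v0 by rewrite sub// mem_head.
rewrite mem_pths// => /andP[/eqP sc pc].
rewrite measureU; last 3 first.
- exact: event_measurable.
- by apply: bigsetU_measurable => x _; exact: event_measurable.
- rewrite big_distrr /= big_seq_cond big1// => x /andP[xs _].
  have := sub' _ xs; rewrite mem_pths// => /andP[/eqP sx _].
  rewrite event_disjoint ?sc ?sx//.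
  by apply: contraNneq cs => ->.
by rewrite EFinD; congr (_ + _)%E; [exact: event_prob|exact: IH].
Qed.

Definition off_path : set T := \bigcup_l ~` events l predT.

Lemma off_path_measurable : measurable off_path.
Proof.
apply: bigcupT_measurable => l; apply: measurableC; exact: events_measurable.
Qed.

Lemma off_path_null : P off_path = 0%E.
Proof.
apply/negligibleP; first exact: off_path_measurable.
apply: negligible_bigcup => l; apply/negligibleP.
  by apply: measurableC; exact: events_measurable.
apply: etrans (probability_setC _ (events_measurable _ _)) _.
by rewrite events_prob (@sum_kw _ _ _ v0 _ a_ge4 deg_gt0 l [::]) subee.
Qed.

Lemma on_path t l : ~ off_path t ->
  X 0%N t = v0 /\ path G v0 (mkseq (fun i => X i.+1 t) l).
Proof.
move=> nt; suff : events l predT t by case/eventsP.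
by apply: contrapT => h; apply: nt; exists l.
Qed.

Lemma infinite_visits (f : nat -> V) (v : V) m : ~ finite_set [set k | f k = v] ->
  exists l, (m <= count_mem v (mkseq (fun i => f i.+1) l))%N.
Proof.
move=> inf; elim: m => [|m [l IH]]; first by exists 0%N.
have [k [lk fk]] : exists k, (l < k)%N /\ f k = v.
  apply: contrapT => h; apply: inf; apply: (sub_finite_set _ (finite_II l.+1)) => k fk /=.
  by rewrite ltnS leqNgt; apply/negP => lk; apply: h; exists k.
case: k lk fk => // k; rewrite ltnS => lk fk; exists k.+1.
rewrite mkseqS -cats1 count_cat /= fk eqxx addn1 ltnS; apply: leq_trans IH _.
have /subnK <- := lk; rewrite /mkseq addnC iotaD map_cat count_cat.
exact: leq_addr.
Qed.

(** The bound is uniform in [l], so it survives continuity from below along the events of [m] visits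
    by time [l]; for every [m] their union contains the infinite visits, up to the null set
    [off_path]. *)
Lemma visits_negligible v : (forall eps : R, 0 < eps -> exists m, forall l,
    \sum_(h <- pths G l v0 | (m <= count_mem v h)%N) kw stp [::] h <= eps) ->
  P.-negligible [set t | ~ finite_set [set k | X k t = v]].
Proof.
move=> H.
have key (eps : R) : 0 < eps -> exists B, [/\ measurable B, (P B <= eps%:E)%E &
    [set t | ~ finite_set [set k | X k t = v]] `<=` B].
  move=> e0; have [m Hm] := H eps e0.
  (* Adjoining [off_path] makes the sequence increasing: a trajectory that follows a path up to time
     [l] might leave it at the next step. *)
  pose F l := off_path `|` events l (fun h => m <= count_mem v h)%N.
  have mF l : measurable (F l).
    by apply: measurableU; [exact: off_path_measurable|exact: events_measurable].
  have mUF : measurable (\bigcup_l F l) by exact: bigcupT_measurable.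
  exists (\bigcup_l F l); split=> //.
  - have ndF : nondecreasing_seq F.
      apply/nondecreasing_seqP => l; apply/subsetPset => t; rewrite /F.
      have [nt|nt] := pselect (off_path t); first by left.
      case=> // /eventsP[h0 ht hm]; right; apply/eventsP.
      have [_ ht'] := on_path l.+1 nt; split=> //.
      apply: leq_trans hm _; rewrite mkseqS -cats1 count_cat; exact: leq_addr.
    have cvF := @nondecreasing_cvg_mu _ _ _ P _ mF mUF ndF.
    apply: (cvge_to_le cvF).
    apply: nearW => l /=; apply: le_trans (measureU2 _ _ _) _.
    - exact: off_path_measurable.
    - exact: events_measurable.
    suff : (P off_path + P (events l (fun h => m <= count_mem v h)%N) <= eps%:E)%E by [].
    by rewrite off_path_null add0e events_prob lee_fin; exact: Hm.
  - move=> t ht; have [l hl] := @infinite_visits _ _ m ht.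
    exists l => //; rewrite /F.
    have [nt|nt] := pselect (off_path t); first by left.
    by right; apply/eventsP; have [h0 pt] := on_path l nt; split.
have /choice[B HB] : forall n : nat, exists B, [/\ measurable B, (P B <= (n.+1%:R^-1)%:E)%E &
    [set t | ~ finite_set [set k | X k t = v]] `<=` B].
  by move=> n; apply: key; rewrite invr_gt0.
exists (\bigcap_n B n); split.
- by apply: bigcapT_measurable => n; have [] := HB n.
- apply/eqP; rewrite eq_le measure_ge0 andbT.
  apply/lee_addgt0Pr => e e0; rewrite add0e.
  pose n := Num.truncn (e^-1).
  have [mB PB _] := HB n; apply: (@le_trans _ _ (P (B n))).
    apply: le_measure; rewrite ?inE//.
      by apply: bigcapT_measurable => k; have [] := HB k.
    by move=> t; apply.
  apply: le_trans PB _; rewrite lee_fin invf_ple ?posrE//.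
  by apply/ltW; exact: truncnS_gt.
- by move=> t ht n _; have [_ _] := HB n; apply.
Qed.

(** [V] may be uncountable, so the union of null sets runs over the end points of the countably many
    paths from [v0]; outside [off_path] no other vertex is visited. *)
Lemma visits_transient : (forall p, path G v0 p -> forall eps : R, 0 < eps ->
    exists m, forall l,
    \sum_(h <- pths G l v0 | (m <= count_mem (last v0 p) h)%N) kw stp [::] h <= eps) ->
  transient P X.
Proof.
move=> H.
pose p n i : seq V := nth [::] (pths G n v0) i.
have pp n i : path G v0 (p n i).
  rewrite /p; have [ic|ic] := ltnP i (size (pths G n v0)); last by rewrite nth_default.
  by have := mem_nth [::] ic; rewrite mem_pths// => /andP[].
have : P.-negligible (off_path `|` \bigcup_n \bigcup_i
    [set t | ~ finite_set [set k | X k t = last v0 (p n i)]]).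
  apply: negligibleU; last first.
    apply: negligible_bigcup => n; apply: negligible_bigcup => i.
    apply: visits_negligible; exact: H.
  by apply/negligibleP; [exact: off_path_measurable|exact: off_path_null].
apply: negligibleS => t /= ht.
have [?|nt] := pselect (off_path t); first by left.
right; have {}ht : exists v, ~ finite_set [set k | X k t = v].
  by apply: contrapT => h; apply: ht => v; apply: contrapT => h'; apply: h; exists v.
have [v hv] := ht.
have [k Xk] : exists k, X k t = v.
  apply: contrapT => h; apply: hv; rewrite (_ : [set _ | _] = set0)//.
  by apply/seteqP; split=> // k /= Xk; apply: h; exists k.
have [X0 pc] := on_path k nt.
set c := mkseq _ _ in pc.
have cp : c \in pths G k v0 by rewrite mem_pths// size_mkseq eqxx.
exists k => //; exists (index c (pths G k v0)) => //=.
rewrite /p nth_index// (_ : last v0 c = v)//.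
rewrite /c -Xk; case: (k) => [|k']; first by rewrite X0.
by rewrite mkseqS last_rcons.
Qed.

End History.

Theorem theorem3 (R : realType) (K : nat) (c0 : R) (c0_gt0 : (0 < c0)%R) :
  exists a0 : R,
    forall (V : choiceType) (G : graph V) (v0 : V) (a : R),
      locally_finite G ->
      (forall v, (degree G v <= K)%N) ->
      (c0%:E <= cheeger R G)%E ->
      (0 < a)%R -> (a0 < a)%R ->
      forall (d : measure_display) (T : measurableType d)
        (P : probability T R) (X : nat -> T -> V),
        is_LRRW P G a v0 X -> transient P X.
Proof.
have c_gt0 : 0 < c0 / 2 by rewrite divr_gt0.
set g := gap K (c0 / 2).
(* The summand 4 gives [4 <= a], the factor [4 K + 1] times 1 gives [kappa <= 1], and the rest gives
   [12 K kappa <= gap], as the Combes-Thomas estimate requires. *)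
exists (4 + (4 * K%:R + 1) * (1 + 12 * K%:R / g)).
move=> V G v0 a lf degK ch _ aa d T P X XP.
have expand := cheeger_edge_expansion lf c0_gt0 ch.
have deg_gt0 := expansion_deg_gt0 c_gt0 expand.
have K_gt0 : (0 < K)%N := leq_trans (deg_gt0 v0) (degK v0).
have g0 : 0 < g by exact: gap_gt0.
have q0 : 0 <= 12 * K%:R / g by rewrite divr_ge0 ?mulr_ge0// ltW.
have K1 : 0 < 4 * K%:R + 1 :> R by rewrite ltr_wpDl// mulr_ge0.
have Kq : 0 <= (4 * K%:R + 1) * (12 * K%:R / g) by rewrite mulr_ge0// ltW.
have a_ge4 : 4 <= a by lra.
have a_gt0 : 0 < a by lra.
have kap_le1 : kappa a K <= 1 by rewrite ler_pdivrMr//; lra.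
have kap_gap : 12 * K%:R * kappa a K <= g.
  rewrite /kappa mulrA ler_pdivrMr// -ler_pdivrMl// mulrC -mulrA.
  by rewrite mulrCA -mulrA mulrCA; lra.
by apply: visits_transient XP _ => // p pp eps e0;
  exact: (visits_vanish lf a_ge4 deg_gt0 degK c_gt0 expand).
Qed.
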